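(* Suppose that $nr_n^d\to\infty$ and $I_n\to\infty$ as $n\to\infty$. Let $\zeta_n$ be either $S_n$ or $S'_n$. Then there exists $\delta>0$ such that as $n\to\infty$, $$\mathbb E[\zeta_n]=I_n\big(1+O(e^{-\delta nr_n^d})\big),\qquad \operatorname{Var}[\zeta_n]=I_n\big(1+O(e^{-\delta nr_n^d})\big),$$ and also $$d_{\mathrm K}\big(I_n^{-1/2}(S'_n-I_n),N(0,1)\big)=O\big(e^{-\delta nr_n^d}+I_n^{-1/2}\big);$$ and, if $A$ has a $C^2$ boundary, $$d_{\mathrm K}\big(\tilde I_n^{-1/2}(S_n-\mathbb E[S_n]),N(0,1)\big)=O\big(e^{-\delta nr_n^d}+I_n^{-1/2}\big).$$
   Context: Setting: $d\ge2$ is an integer and $A\subset\mathbb R^d$ is compact, connected, nonempty and equal to the closure of its interior; moreover either $A$ has a $C^2$ boundary, or $d=2$ and $A=[0,1]^2$. Here $A$ has a $C^2$ boundary if for each $x\in\partial A$ there are a neighbourhood $U$ of $x$ and a real-valued twice continuously differentiable function $\phi$ on an open set in $\mathbb R^{d-1}$ such that $\partial A\cap U$, after a rotation, is the graph of $\phi$. $f:\mathbb R^d\to[0,\infty)$ is a probability density function with support $A$ (zero outside $A$), continuous on $A$, with $f_0:=\inf_A f>0$; $\nu(dx)=f(x)\,dx$. $(X_1,X_2,\ldots)$ are independent random vectors with density $f$; $\mathcal X_n:=\{X_1,\dots,X_n\}$ for $n\in\mathbb N$. $(Z_t)_{t>0}$ is a unit intensity Poisson counting process independent of $(X_i)$,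 and $\mathcal P_n:=\{X_1,\dots,X_{Z_n}\}$ for real $n\in[1,\infty)$, a Poisson process with intensity measure $n\nu$. In statements about $\mathcal X_n$, $n\in\mathbb N$; in statements about $\mathcal P_n$, $n\in[1,\infty)$. Numbers $r_n\in(0,\infty)$ are given for all $n\ge1$; $r_n^d$ means $(r_n)^d$. For finite $\mathcal X\subset\mathbb R^d$ and $r>0$, $G(\mathcal X,r)$ is the graph with vertex set $\mathcal X$ and an edge between each pair of distinct points at Euclidean distance at most $r$. $S_n$ (respectively $S'_n$) is the number of isolated vertices of $G(\mathcal X_n,r_n)$ (respectively $G(\mathcal P_n,r_n)$). With $B_r(x)$ the closed Euclidean ball of radius $r$ centred at $x$, $$I_n:=n\int_A\exp(-n\nu(B_{r_n}(x)))\,\nu(dx),\qquad \tilde I_n:=\mathbb E[S_n]=n\int(1-\nu(B_{r_n}(x)))^{n-1}\,\nu(dx).$$ $d_{\mathrm K}(X,Y):=\sup_{z\in\mathbb R}|\mathbb P[X\le z]-\mathbb P[Y\le z]|$, and $N(0,1)$ is a standard normal random variable. For $h>0$, $g=O(h)$ means $\limsup|g|/h<\infty$ as $n\to\infty$. *)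

(* Defs.v *)
From HB Require Import structures.
From mathcomp Require Import all_boot all_order all_algebra finmap.
From mathcomp Require Import all_classical all_reals all_analysis.
Set Implicit Arguments.
Unset Strict Implicit.
Unset Printing Implicit Defensive.
Import Order.TTheory GRing.Theory Num.Theory.
Import numFieldNormedType.Exports.
Local Open Scope classical_set_scope.
Local Open Scope ring_scope.

(* R^n is ['rV[R]_n] with its library topology (the sup norm, which induces the
   Euclidean topology).  Its sigma-algebra is generated by the coordinates, as
   the library does for tuples; over R this is the Borel sigma-algebra. *)
Definition rV_display : measure_display -> measure_display.
Proof. exact. Qed.

Section measurable_rV.
Context {d} {T : measurableType d} (n : nat).

Let coord : 'I_n -> 'rV[T]_n -> T := fun i v => v 0 i.

Let rV_set0 : g_sigma_preimage coord set0.
Proof. exact: sigma_algebra0. Qed.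

Let rV_setC A : g_sigma_preimage coord A -> g_sigma_preimage coord (~` A).
Proof. exact: sigma_algebraC. Qed.

Let rV_bigcup (F : _^nat) : (forall i, g_sigma_preimage coord (F i)) ->
  g_sigma_preimage coord (\bigcup_i (F i)).
Proof. exact: sigma_algebra_bigcup. Qed.

HB.instance Definition _ := @isMeasurable.Build (rV_display d)
  'rV[T]_n (g_sigma_preimage coord) rV_set0 rV_setC rV_bigcup.

End measurable_rV.

Section measurable_rV_theory.
Context {d} {T : measurableType d}.

Lemma measurable_rV_coord n (i : 'I_n) :
  measurable_fun [set: 'rV[T]_n] (fun v => v 0 i).
Proof.
move=> _ Y mY; rewrite setTI; apply: sub_sigma_algebra => /=.
rewrite -bigcup_seq/=; exists i => /=; first by rewrite mem_index_enum.
by exists Y => //; rewrite setTI.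
Qed.

Lemma measurable_fun_rV {d1} {T1 : measurableType d1} n (f : T1 -> 'rV[T]_n) :
  (forall i, measurable_fun [set: T1] (fun x => f x 0 i)) ->
  measurable_fun [set: T1] f.
Proof.
move=> mf _ A mA; rewrite setTI.
pose G : set (set 'rV[T]_n) := [set B | measurable (f @^-1` B)].
suff : measurable `<=` G by exact.
apply: smallest_sub.
  split; rewrite /G/=.
  - by rewrite preimage_set0.
  - move=> B mB; rewrite setTD preimage_setC; exact: measurableC.
  - by move=> F mF; rewrite preimage_bigcup; exact: bigcupT_measurable.
rewrite -bigcup_seq => B [i _ [Y mY <-]].
by have := mf i measurableT _ mY; rewrite !setTI.
Qed.

End measurable_rV_theory.

Section lebesgue_measure_rV.
Context {R : realType}.

Definition rV_cons n (p : measurableTypeR R * 'rV[R]_n) : 'rV[R]_n.+1 :=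
  row_mx (p.1)%:M p.2 : 'rV[R]_(1 + n).

Definition rV_uncons n (v : 'rV[R]_n.+1) : measurableTypeR R * 'rV[R]_n :=
  (v 0 (lshift n 0 : 'I_(1 + n)), \row_(i < n) v 0 (rshift 1 i : 'I_(1 + n))).

Lemma rV_consK n : cancel (@rV_cons n) (@rV_uncons n).
Proof.
case=> x v; rewrite /rV_uncons /rV_cons; congr pair.
  by rewrite [LHS](row_mxEl x%:M v 0 0) mxE mulr1n.
by apply/rowP => j; rewrite mxE; exact: (row_mxEr x%:M v 0 j).
Qed.

Lemma measurable_rV_cons n : measurable_fun setT (@rV_cons n).
Proof.
apply: measurable_fun_rV => i; case: (split_ordP (i : 'I_(1 + n))) => j ->.
  rewrite (_ : (fun _ => _) = fst); first exact: measurable_fst.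
  apply/funext => p; rewrite (ord1 j).
  by rewrite [LHS](row_mxEl (p.1)%:M p.2 0 0) mxE mulr1n.
rewrite (_ : (fun _ => _) = (fun v : 'rV[R]_n => v 0 j) \o snd).
  by apply: measurableT_comp; [exact: measurable_rV_coord | exact: measurable_snd].
by apply/funext => p; rewrite -[RHS](row_mxEr (p.1)%:M p.2 0 j).
Qed.

Lemma measurable_rV_uncons n : measurable_fun setT (@rV_uncons n).
Proof.
apply: measurable_fun_pair => /=; first exact: measurable_rV_coord.
apply: measurable_fun_rV => i.
under eq_fun do rewrite mxE.
exact: measurable_rV_coord.
Qed.

Section step.
Context n (mu : {sigma_finite_measure set 'rV[R]_n -> \bar R}).

Definition rV_cons_measure : set 'rV[R]_n.+1 -> \bar R :=
  pushforward (@lebesgue_measure R \x mu)%E (@rV_cons n).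

Let rV_cons_measure0 : rV_cons_measure set0 = 0%E.
Proof. by rewrite /rV_cons_measure /pushforward preimage_set0 measure0. Qed.

Let rV_cons_measure_ge0 A : (0 <= rV_cons_measure A)%E.
Proof. by rewrite /rV_cons_measure /pushforward; apply: measure_ge0. Qed.

Let rV_cons_measure_sigma_additive : semi_sigma_additive rV_cons_measure.
Proof.
move=> F mF tF mUF; rewrite /rV_cons_measure /pushforward preimage_bigcup.
have mcons B : measurable B -> measurable (@rV_cons n @^-1` B).
  by move=> mB; rewrite -[X in measurable X]setTI; exact: measurable_rV_cons.
apply: measure_semi_sigma_additive.
- by move=> i; exact: mcons.
- apply/trivIsetP => /= i j _ _ ij; rewrite -preimage_setI.
  by move/trivIsetP : tF => /(_ _ _ _ _ ij) ->//; rewrite preimage_set0.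
- by rewrite -preimage_bigcup; exact: mcons.
Qed.

HB.instance Definition _ := isMeasure.Build _ _ _ rV_cons_measure
  rV_cons_measure0 rV_cons_measure_ge0 rV_cons_measure_sigma_additive.

Let sigma_finite_rV_cons : sigma_finite setT rV_cons_measure.
Proof.
have /sigma_finiteP[F [FT ndF Foo]] := sigma_finiteT (@lebesgue_measure R).
have /sigma_finiteP[G [GT ndG Goo]] := sigma_finiteT mu.
exists (fun i => @rV_uncons n @^-1` (F i `*` G i)).
  rewrite -preimage_bigcup; apply/esym; rewrite -subTset => v _ /=.
  have [i _ Fi] : (\bigcup_i F i) (rV_uncons v).1 by rewrite -FT.
  have [j _ Gj] : (\bigcup_j G j) (rV_uncons v).2 by rewrite -GT.
  exists (maxn i j) => //; split.
    by move: Fi; exact/subsetPset/ndF/leq_maxl.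
  by move: Gj; exact/subsetPset/ndG/leq_maxr.
move=> i; have [mF Foo'] := Foo i; have [mG Goo'] := Goo i.
have mFG : measurable (F i `*` G i) by exact: measurableX.
split; first by rewrite -[X in measurable X]setTI; exact: measurable_rV_uncons.
rewrite /rV_cons_measure /pushforward -comp_preimage.
rewrite (_ : _ \o _ = id); last by apply/funext; exact: rV_consK.
by rewrite /= product_measure1E// lte_mul_pinfty// ge0_fin_numE.
Qed.

HB.instance Definition _ :=
  @Measure_isSigmaFinite.Build _ _ _ rV_cons_measure sigma_finite_rV_cons.

End step.

(* Iterated product of the one-dimensional Lebesgue measure. *)
Fixpoint lebesgue_rV n : {sigma_finite_measure set 'rV[R]_n -> \bar R} :=
  if n is n'.+1 then rV_cons_measure (lebesgue_rV n') else \d_(0 : 'rV[R]_0).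

(* This characterizes [lebesgue_rV n] as n-dimensional Lebesgue measure. *)
Lemma lebesgue_rV_box n (B : 'I_n -> set R) : (forall i, measurable (B i)) ->
  lebesgue_rV n [set v | forall i, B i (v 0 i)] =
  (\prod_(i < n) lebesgue_measure (B i))%E.
Proof.
elim: n B => [|n IH] B mB.
  rewrite big_ord0 /= diracE mem_set//. by case.
rewrite big_ord_recl -(IH (fun i => B (lift ord0 i)))//.
change ((@lebesgue_measure R \x lebesgue_rV n)%E
    (@rV_cons n @^-1` [set v : 'rV[R]_n.+1 | forall i, B i (v ord0 i)]) =
  lebesgue_measure (B ord0) *
  lebesgue_rV n [set v : 'rV[R]_n | forall i, B (lift ord0 i) (v ord0 i)])%E.
rewrite (_ : _ @^-1` _ = B ord0 `*`
    [set v : 'rV[R]_n | forall i, B (lift ord0 i) (v 0 i)]).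
  rewrite product_measure1E//.
  - exact: mB.
  - rewrite (_ : mkset _ = \bigcap_(i in [set: 'I_n])
        (fun v : 'rV[R]_n => v 0 i) @^-1` B (lift ord0 i)).
      apply: fin_bigcap_measurable => //= i _.
      by rewrite -[X in measurable X]setTI; apply: measurable_rV_coord.
    by apply/seteqP; split => [v h i _|v h i]; [exact: h|exact: (h i)].
have c0 x v : rV_cons (x, v) 0 (lshift n (0 : 'I_1)) = x :> R.
  by rewrite [LHS](row_mxEl (x : R)%:M v 0 0) mxE mulr1n.
have c1 x v i : rV_cons (x, v) 0 (rshift 1 i) = v 0 i :> R.
  exact: (row_mxEr (x : R)%:M v 0 i).
have e0 : lshift n (0 : 'I_1) = ord0 :> 'I_n.+1 by apply/val_inj.
have e1 (i : 'I_n) : rshift 1 i = lift ord0 i :> 'I_n.+1 by apply/val_inj.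
apply/seteqP; split => [[x v] h|[x v] [h1 h2] i] /=.
  split => [|i] /=.
    by have := h ord0; rewrite -e0 c0.
  by have := h (lift ord0 i); rewrite -e1 c1.
case: (unliftP ord0 i) => [j|] ->; first by rewrite -e1 c1 e1; exact: h2.
by rewrite -e0 c0 e0.
Qed.

End lebesgue_measure_rV.

Section geometry.
Context {R : realType} {d : nat}.
Implicit Types (A : set 'rV[R]_d) (x y : 'rV[R]_d) (r : R).

(* The library norm on ['rV[R]_d] is the sup norm, hence this definition. *)
Definition edist x y : R := Num.sqrt (\sum_(i < d) (x 0 i - y 0 i) ^+ 2).

Definition eball x r : set 'rV[R]_d := [set y | edist x y <= r].

Definition boundary A : set 'rV[R]_d := closure A `\` A°.

(* Continuous differentiability on an open set [V], through partial
   derivatives; nothing is required of [g] outside [V]. *)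
Definition C1_on n (V : set 'rV[R]_n) (g : 'rV[R]_n -> R) : Prop :=
  forall (i : 'I_n) (x : 'rV[R]_n), V x ->
    derivable g x (delta_mx 0 i) /\
    {for x, continuous ('D_(delta_mx 0 i) g)}.

Definition C2_on n (V : set 'rV[R]_n) (g : 'rV[R]_n -> R) : Prop :=
  C1_on V g /\ forall i : 'I_n, C1_on V ('D_(delta_mx 0 i) g).

(* The point (v_0, ..., v_(d-2), phi v): [insub] fails exactly at index d-1. *)
Definition graph_point (phi : 'rV[R]_d.-1 -> R) (v : 'rV[R]_d.-1) : 'rV[R]_d :=
  \row_(i < d) if insub (val i) is Some j then v 0 j else phi v.

Definition is_rotation (Q : 'M[R]_d) : Prop := Q *m Q^T = 1%:M /\ \det Q = 1.

(* Boundary points are row vectors, so a rotation acts on the right. *)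
Definition C2_boundary A : Prop :=
  forall x, boundary A x ->
    exists (U : set 'rV[R]_d) (Q : 'M[R]_d)
           (V : set 'rV[R]_d.-1) (phi : 'rV[R]_d.-1 -> R),
      [/\ nbhs x U, is_rotation Q, open V, C2_on V phi &
          (fun y => y *m Q) @` (boundary A `&` U) = graph_point phi @` V].

Definition unit_cube : set 'rV[R]_d := [set x | forall i, 0 <= x 0 i <= 1].

Definition rgg_edge (V : {fset 'rV[R]_d}) r : rel 'rV[R]_d :=
  [rel x y | [&& x \in V, y \in V, x != y & edist x y <= r]].

Definition isolated_vertices (V : {fset 'rV[R]_d}) r : {fset 'rV[R]_d} :=
  [fset x in V | [forall y : V, ~~ rgg_edge V r x (val y)]]%fset.

Definition num_isolated (V : {fset 'rV[R]_d}) r : nat :=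
  #|` isolated_vertices V r|.

End geometry.

Section density.
Context {R : realType} {d : nat}.
Implicit Types (A : set 'rV[R]_d) (f : 'rV[R]_d -> R).

Definition prob_density f : Prop :=
  [/\ measurable_fun setT f, forall x, 0 <= f x &
      (\int[@lebesgue_rV R d]_x (f x)%:E = 1)%E].

Definition density_measure f (B : set 'rV[R]_d) : R :=
  \int[@lebesgue_rV R d]_(x in B) f x.

(* t * \int_A exp(- t nu(B_(r t)(x))) nu(dx), where nu(dx) = f(x) dx. *)
Definition Ipoisson A f (r : R -> R) (t : R) : R :=
  t * \int[@lebesgue_rV R d]_(x in A)
        (expR (- (t * density_measure f (eball x (r t)))) * f x).

End density.

Section probability.
Context {R : realType} {dOm : measure_display} {Om : measurableType dOm}.
Variable P : probability Om R.

Definition mutually_independent (F : nat -> set (set Om)) : Prop :=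
  forall (J : {fset nat}) (E : nat -> set Om),
    (forall i, i \in J -> F i (E i)) ->
    P (\bigcap_(i in [set` J]) E i) = (\prod_(i <- J) P (E i))%E.

Definition sigma_of d' (T : measurableType d') (Y : Om -> T) :
  set (set Om) := preimage_set_system setT Y measurable.

Definition sigma_of_family d' (T : measurableType d') (I : Type) (D : set I)
    (Y : I -> Om -> T) : set (set Om) :=
  <<s \bigcup_(i in D) sigma_of (Y i) >>.

Definition iid_with_density d (X : nat -> Om -> 'rV[R]_d)
    (f : 'rV[R]_d -> R) : Prop :=
  mutually_independent (fun i => sigma_of (X i)) /\
  forall i B, measurable B ->
    P (X i @^-1` B) = (\int[@lebesgue_rV R d]_(x in B) (f x)%:E)%E.

(* Only the times t > 0 carry content: Z 0 = 0 is the usual normalization,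
   which makes Z t itself an increment, and negative times are unconstrained.
   Since Z is nondecreasing, the truncated subtraction is the increment. *)
Definition unit_poisson_process (Z : R -> Om -> nat) : Prop :=
  [/\ forall w, Z 0 w = 0%N,
      forall w s t, 0 <= s -> s <= t -> (Z s w <= Z t w)%N,
      forall w t, 0 < t -> \forall s \near t^'+, Z s w = Z t w,
      forall s t k, 0 <= s -> s < t ->
        P [set w | (Z t w - Z s w)%N = k] = (poisson_pmf (t - s) k)%:E &
      forall t : nat -> R, 0 <= t 0%N ->
        {homo t : m n / (m <= n)%N >-> m <= n} ->
        mutually_independent
          (fun i => sigma_of (fun w => Z (t i.+1) w - Z (t i) w)%N)].

Definition independent_families d d' (T : measurableType d)
    (T' : measurableType d') (X : nat -> Om -> T) (Z : R -> Om -> T') : Prop :=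
  forall E F, sigma_of_family setT X E ->
    sigma_of_family [set t | 0 < t] Z F -> P (E `&` F) = (P E * P F)%E.

(* The first n sample points; the sequence X is indexed from 0.  As a finite
   set, it identifies coinciding points. *)
Definition sample d (X : nat -> Om -> 'rV[R]_d) (n : nat) (w : Om) :
  {fset 'rV[R]_d} := [fset X (val i) w | i in 'I_n]%fset.

Definition isolated_binomial d (X : nat -> Om -> 'rV[R]_d) (r : R -> R) (n : nat)
    (w : Om) : R :=
  (num_isolated (sample X n w) (r n%:R))%:R.

Definition isolated_poisson d (X : nat -> Om -> 'rV[R]_d) (Z : R -> Om -> nat) (r : R -> R)
    (t : R) (w : Om) : R :=
  (num_isolated (sample X (Z t w) w) (r t))%:R.

Definition kolmogorov_dist (m1 m2 : set R -> \bar R) : R :=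
  sup (range (fun z : R =>
    `|fine (m1 `]-oo, z]%classic) - fine (m2 `]-oo, z]%classic)|)).

Definition dK_normal (Y : Om -> R) : R :=
  kolmogorov_dist (pushforward P Y) (normal_prob 0 1).

End probability.

(* Lets the library's [=O_F] be used with F = +oo. *)
Canonical pinfty_filter_on (R : realType) :=
  FilterType (pinfty_nbhs R) (@proper_pinfty_nbhs R).

(* E = I (1 + O(h)) along F; in particular E is eventually finite. *)
Definition eq_1plusO {R : realType} {T : Type} (F : filter_on T)
    (E : T -> \bar R) (I h : T -> R) : Prop :=
  exists2 g : T -> R, g =O_F h & \forall n \near F, E n = (I n * (1 + g n))%:E.

(* Main.v *)
From HB Require Import structures.
Require Import Defs.
From mathcomp Require Import all_boot all_order all_algebra finmap.
From mathcomp Require Import all_classical all_reals all_analysis measurable_realfun.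
From mathcomp Require Import ring lra zify.
Set Implicit Arguments.
Unset Strict Implicit.
Unset Printing Implicit Defensive.
Import Order.TTheory GRing.Theory Num.Theory.
Import numFieldNormedType.Exports.
Local Open Scope classical_set_scope.
Local Open Scope ring_scope.

(** Write nu for the law of one point, B(x) for the closed ball of radius r at x,
q(x) for nu (B x), s for t r^d, and I for the integral of t exp (- t q) against nu.
At a given time let W be the number of isolated vertices, and lambda its mean.

Isolated points are rare and nearly independent, so W is nearly a Poisson variable
of mean I.  This is made precise by Stein's identity: for every g >= 0 whose
increments are at most L, the numbers E[W g(W)] and lambda E[g(W + 1)] differ by at
most L alpha, where alpha <= K I exp (- c s) (1 + s)^2.  With g(w) = w it gives the
variance, and with g the solution of Stein's equation for the normal law, evaluated
at (w - lambda) / sqrt lambda, it gives the normal approximation: W takes integer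
values, so a difference of g is a derivative of that solution up to 1 / sqrt lambda,
and the jump of that derivative costs P(W = k), which g(w) = 1{k < w} bounds
(lemma stein_kolmogorov).

Stein's identity for n + 1 independent points ([stein_count]) comes from a coupling.
By exchangeability E[W g(W)] is n + 1 times the mean of 1{B(x) has no other point}
g(1 + number of isolated points among the others), where x is the last point.  On
that event the n others have the law of fresh points conditioned to avoid B(x), which
is also obtained from a fresh sample, independent of x, by replacing each fresh point
inside B(x) by the original one of the same index.  The two samples give almost the
same count: a discrepancy needs a pair of points at distance at most 2 r, or a pair
of simultaneously isolated points, so alpha is an integral over pairs (x, y).  The
delicate pairs are those at distance in (r, 2 r] that are isolated at the same time,
an event of probability (1 - nu(B(x) u B(y)))^(n-1).

Geometry makes it small: there is c > 0 such that nu(B(x) u B(y)) exceeds q(x) or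
q(y) by c r^d, and q(x) >= c r^d ([ball_bounds]).  Indeed A contains a thick cone at
each of its points, with an axis that can be chosen constant near each point
([support_cone]): a C^2 boundary is locally the graph of a Lipschitz function, and A
lies on exactly one side of it.  Of two neighbours x and y, one can move along the
cone away from the other ([cone_escape]).

A fixed and a Poisson number of points are handled together, as mixtures of the
counts for n points, because the powers (1 - v)^n times falling factorials have
means at most a constant times t^j exp (- t v) in both cases ([ffw_le],
[mix_poisson]).  For a Poisson number of points the mean is exactly I; for n points it
is n times the integral of (1 - q)^(n-1), whose relative distance to I is of order
q + n q^2.  Finally I -> oo and I <= t exp (- c s) force t >= exp (c s), hence
q <= C s / t is exponentially small in s ([regime]), and the powers of s are absorbed
by passing from c to c / 4. *)

(** * The normal law and the solution of Stein's equation *)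

Section std_normal.
Context {R : realType}.
Implicit Types x y z : R.
Local Notation mu := (@lebesgue_measure R).

Definition gpdf x : R := normal_pdf 0 1 x.
Definition gcdf x : R := fine (normal_prob (0 : R) 1 `]-oo, x]%classic).

Lemma gpdfE x : gpdf x = gpdf 0 * expR (- (x ^+ 2 / 2)).
Proof.
rewrite /gpdf !normal_pdfE ?oner_neq0// /normal_fun !subr0 expr0n/= oppr0 mul0r.
by rewrite expR0 mulr1 expr1n mulNr.
Qed.

Lemma gpdf_gt0 x : 0 < gpdf x.
Proof.
rewrite /gpdf normal_pdfE ?oner_neq0// mulr_gt0 ?expR_gt0//.
by rewrite normal_peak_gt0// oner_neq0.
Qed.

Lemma gpdf_ge0 x : 0 <= gpdf x.
Proof. by rewrite ltW// gpdf_gt0. Qed.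

Lemma gpdfN x : gpdf (- x) = gpdf x.
Proof. by rewrite gpdfE sqrrN -gpdfE. Qed.

Lemma is_derive_gpdf x : is_derive x (1 : R) gpdf (- (x * gpdf x)).
Proof.
have -> : gpdf = (fun y : R => gpdf 0 * expR (- (y ^+ 2 * 2^-1))).
  by apply/funext => y; exact: gpdfE.
apply: is_derive_eq.
rewrite /GRing.scale/= !mulr1; lra.
Qed.

Lemma continuous_gpdf : continuous gpdf.
Proof. by apply: continuous_normal_pdf; rewrite oner_neq0. Qed.

Lemma integrable_gpdf (D : set R) : measurable D -> mu.-integrable D (EFin \o gpdf).
Proof.
move=> mD; apply: (integrableS measurableT) => //.
exact: integrable_normal_pdf.
Qed.

Lemma normal_prob_fin (D : set R) : measurable D ->
  normal_prob (0 : R) 1 D \is a fin_num.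
Proof. by move=> mD; exact: fin_num_measure. Qed.

Lemma is_derive_gcdf x : is_derive x (1 : R) gcdf (gpdf x).
Proof.
have := @continuous_FTC1 R gpdf -oo%O x (x + 1).
case.
- by rewrite ltrDl.
- exact: integrable_gpdf.
- by rewrite ltNyr.
- exact: continuous_gpdf.
- move=> dF F'; apply: (DeriveDef dF); rewrite -F' derive1E; reflexivity.
Qed.

Lemma gcdf_compl x : (1 - gcdf x)%:E = (\int[mu]_(t in `[x, +oo[) (gpdf t)%:E)%E.
Proof.
have e : (normal_prob (0 : R) 1 [set: R] =
   normal_prob 0 1 `]-oo, x] + normal_prob 0 1 `]x, +oo[)%E.
  rewrite -measureU//.
    by rewrite -setCitvr setvU.
  by rewrite -setCitvr setICl.
rewrite probability_setT in e.
rewrite -integral_itv_obnd_cbnd; last first.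
  by apply/measurable_EFinP; apply: measurable_funTS; exact: measurable_normal_pdf.
have <- : normal_prob (0 : R) 1 `]x, +oo[ = (\int[mu]_(t in `]x, +oo[) (gpdf t)%:E)%E by [].
rewrite /gcdf EFinB fineK ?normal_prob_fin// e.
by rewrite addeAC subee ?normal_prob_fin// add0e.
Qed.

Lemma gcdfN x : gcdf (- x) = 1 - gcdf x.
Proof.
apply: EFin_inj; rewrite gcdf_compl /gcdf fineK ?normal_prob_fin//.
have := @ge0_integration_by_substitutionNy R gpdf x.
move=> e; rewrite /normal_prob e.
- by apply: eq_integral => y _ /=; rewrite gpdfN.
- by apply: continuous_subspaceT; exact: continuous_gpdf.
- by move=> y _; rewrite ltW// gpdf_gt0.
Qed.

Lemma gcdf_ge0 x : 0 <= gcdf x.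
Proof. by rewrite fine_ge0. Qed.

Lemma gcdf_le1 x : gcdf x <= 1.
Proof. by rewrite -subr_ge0 -gcdfN gcdf_ge0. Qed.

Lemma gcdf_nd x y : x <= y -> gcdf x <= gcdf y.
Proof.
move=> xy; rewrite fine_le ?normal_prob_fin//.
apply: le_measure; rewrite ?inE//.
by move=> z /=; rewrite !in_itv/= => /le_trans; exact.
Qed.

Lemma gpdf_cvg0 : gpdf x @[x --> +oo] --> (0 : R).
Proof.
have -> : gpdf = (fun y : R => gpdf 0 * expR (- (y ^+ 2 / 2))).
  by apply/funext => y; exact: gpdfE.
suff h : expR (- (y ^+ 2 / 2)) @[y --> +oo] --> (0 : R).
  by rewrite -[X in _ --> X](mulr0 (gpdf 0)); exact: (cvgM (cvg_cst _) h).
apply: (@cvg_comp _ _ _ (fun y : R => y ^+ 2 / 2) (fun y => expR (- y)) +oo +oo);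
  last exact: cvgr_expR.
apply/cvgryPge => A; near=> y.
have y1 : 1 <= y by near: y; apply: nbhs_pinfty_ge; exact: num_real.
have yA : 2 * `|A| <= y by near: y; apply: nbhs_pinfty_ge; exact: num_real.
have := ler_norm A; nra.
Unshelve. all: end_near. Qed.

(** By x p(t) <= t p(t) = - p'(t) for t >= x, p being the density. *)
Lemma mills x : 0 <= x -> x * (1 - gcdf x) <= gpdf x.
Proof.
move=> x0; rewrite -lee_fin EFinM gcdf_compl -ge0_integralZl//=.
- have -> : (gpdf x)%:E = (\int[mu]_(t in `[x, +oo[) (t * gpdf t)%:E)%E.
    rewrite (@ge0_continuous_FTC2y R _ (fun y => - gpdf y) x 0).
    + by rewrite -EFinB opprK add0r.
    + by move=> y xy; rewrite mulr_ge0 ?gpdf_ge0// (le_trans x0).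
    + apply: continuous_subspaceT => y; apply: cvgM; first exact: cvg_id.
      exact: continuous_gpdf.
    + by rewrite -oppr0; apply: cvgN; exact: gpdf_cvg0.
    + by move=> y _; apply: derivableN; have [] := is_derive_gpdf y.
    + apply: cvgN; apply: cvg_at_right_filter; exact: continuous_gpdf.
    + move=> y _; rewrite derive1E; have := is_derive_gpdf y => dg.
      by rewrite deriveN// derive_val opprK.
  apply: ge0_le_integral => //=.
  + by move=> y _; rewrite mule_ge0 ?lee_fin// ltW// gpdf_gt0.
  + apply: measurable_funeM; apply/measurable_EFinP; apply: measurable_funTS.
    exact: measurable_normal_pdf.
  + apply/measurable_EFinP; apply: measurable_funTS; apply: measurable_funM => //.
    exact: measurable_normal_pdf.
  + move=> y; rewrite in_itv/= andbT => xy; by rewrite -EFinM lee_fin ler_wpM2r ?gpdf_ge0.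
- by apply/measurable_EFinP; apply: measurable_funTS; exact: measurable_normal_pdf.
- by move=> y _; rewrite lee_fin ltW// gpdf_gt0.
Qed.

Definition mills_ratio x := (1 - gcdf x) / gpdf x.

(** Any bound for the Mills ratio on the half line would do: mul_mills_ratio_le1
covers x >= 1, and the density is at least its value at 1 on [0, 1]. *)
Definition mills_bound : R := 1 + (gpdf 1)^-1.

Lemma mills_bound_ge1 : 1 <= mills_bound.
Proof. by rewrite lerDl invr_ge0 gpdf_ge0. Qed.

Lemma mills_ratio_ge0 x : 0 <= mills_ratio x.
Proof. by rewrite divr_ge0 ?gpdf_ge0// subr_ge0 gcdf_le1. Qed.

Lemma mul_mills_ratio_le1 x : 0 <= x -> x * mills_ratio x <= 1.
Proof. by move=> x0; rewrite mulrA ler_pdivrMr ?gpdf_gt0// mul1r mills. Qed.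

Lemma mills_ratio_le x : 0 <= x -> mills_ratio x <= mills_bound.
Proof.
move=> x0; have [x1|/ltW x1] := leP 1 x.
  apply: le_trans mills_bound_ge1; apply: le_trans (mul_mills_ratio_le1 x0).
  by rewrite ler_peMl// mills_ratio_ge0.
apply: (@le_trans _ _ (gpdf 1)^-1); last by rewrite lerDr.
rewrite ler_pdivrMr ?gpdf_gt0// mulrC.
apply: (@le_trans _ _ 1); first by rewrite gerBl gcdf_ge0.
rewrite ler_pdivlMr ?gpdf_gt0// mul1r gpdfE (gpdfE x) ler_wpM2l ?gpdf_ge0//.
by rewrite ler_expR; nra.
Qed.

(** This differential equation is why the Mills ratio solves Stein's equation away
from the jump. *)
Lemma is_derive_mills_ratio x :
  is_derive x (1 : R) mills_ratio (x * mills_ratio x - 1).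
Proof.
have dc := is_derive_gcdf x; have dp := is_derive_gpdf x.
have p0 : gpdf x != 0 by rewrite gt_eqF ?gpdf_gt0.
have dV := is_deriveV p0.
have -> : mills_ratio = (fun y : R => (1 - gcdf y) * (gpdf y)^-1) by [].
apply: is_derive_eq; rewrite /GRing.scale/= /mills_ratio.
by field.
Qed.

(** The bounded solution F of F'(x) - x F(x) = 1{x <= z} - gcdf z. *)
Definition stein_sol z x : R :=
  if x <= z then (1 - gcdf z) * mills_ratio (- x) else gcdf z * mills_ratio x.

(** The derivative of stein_sol z, with the left limit chosen at the jump z. *)
Definition stein_der z x : R := x * stein_sol z x + ((x <= z)%R%:R - gcdf z).

Lemma stein_sol_ge0 z x : 0 <= stein_sol z x.
Proof.
by rewrite /stein_sol; case: ifP => _;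
  rewrite mulr_ge0 ?mills_ratio_ge0 ?gcdf_ge0// subr_ge0 gcdf_le1.
Qed.

(** The two branches agree at z. *)
Lemma stein_solE z x : z <= x -> stein_sol z x = gcdf z * mills_ratio x.
Proof.
rewrite le_eqVlt /stein_sol => /orP[/eqP->|zx]; last by rewrite leNgt zx.
by rewrite lexx /mills_ratio gpdfN gcdfN subKr; ring.
Qed.

(** On each side of 0 the solution is at most a Mills ratio, because gcdf is
monotone. *)
Lemma stein_sol_bounds z x :
  stein_sol z x <= mills_bound /\ `|x * stein_sol z x| <= 1.
Proof.
have [x0|/ltW x0] := leP 0 x.
  suff : stein_sol z x <= mills_ratio x.
    move=> h; split; first exact: (le_trans h (mills_ratio_le x0)).
    rewrite ger0_norm ?mulr_ge0 ?stein_sol_ge0//.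
    by rewrite (le_trans _ (mul_mills_ratio_le1 x0))// ler_wpM2l.
  rewrite /stein_sol; case: ifP => xz; last by rewrite ler_piMl ?mills_ratio_ge0 ?gcdf_le1.
  rewrite /mills_ratio gpdfN gcdfN subKr mulrA ler_wpM2r ?invr_ge0 ?gpdf_ge0//.
  have := gcdf_nd xz; have := gcdf_le1 x; have := gcdf_le1 z.
  by have := gcdf_ge0 x; have := gcdf_ge0 z; nra.
suff : stein_sol z x <= mills_ratio (- x).
  have x0' : 0 <= - x by rewrite oppr_ge0.
  move=> h; split; first exact: (le_trans h (mills_ratio_le x0')).
  rewrite ler0_norm ?mulr_le0_ge0 ?stein_sol_ge0// -mulNr.
  by rewrite (le_trans _ (mul_mills_ratio_le1 x0'))// ler_wpM2l.
rewrite /stein_sol; case: ifPn => xz.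
  by rewrite ler_piMl ?mills_ratio_ge0// gerBl gcdf_ge0.
rewrite /mills_ratio gpdfN gcdfN subKr mulrA ler_wpM2r ?invr_ge0 ?gpdf_ge0//.
rewrite -ltNge in xz; have := gcdf_nd (ltW xz); have := gcdf_le1 x; have := gcdf_le1 z.
by have := gcdf_ge0 x; have := gcdf_ge0 z; nra.
Qed.

Lemma stein_der_le2 z x : `|stein_der z x| <= 2.
Proof.
have [_] := stein_sol_bounds z x; have := gcdf_le1 z; have := gcdf_ge0 z.
rewrite /stein_der; set u := x * _; move: (gcdf z) => c; rewrite !ler_norml.
by case: (x <= z) => /=; lra.
Qed.

(** An interval that avoids the jump lies in one branch, where the solution is
smooth. *)
Lemma stein_mvt z x y : x < y -> z <= x \/ y <= z ->
  exists2 t, x < t < y & stein_sol z y - stein_sol z x = stein_der z t * (y - x).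
Proof.
move=> xy [zx|yz].
- have [||t txy e] := @MVT R (fun t => gcdf z * mills_ratio t)
     (fun t => gcdf z * (t * mills_ratio t - 1)) x y xy.
  + move=> t _; have dm := is_derive_mills_ratio t.
    by apply: is_derive_eq; rewrite /GRing.scale/=; ring.
  + apply: derivable_within_continuous => t _.
    have dm := is_derive_mills_ratio t.
    exact: ex_derive.
  exists t; first by move: txy; rewrite in_itv.
  move: txy; rewrite in_itv/= => /andP[xt ty].
  rewrite !stein_solE ?(le_trans zx) ?(ltW xy)// e; congr (_ * _).
  rewrite /stein_der stein_solE ?(le_trans zx (ltW xt))//.
  by rewrite leNgt (le_lt_trans zx xt)/=; ring.
- have [||t txy e] := @MVT R (fun t => (1 - gcdf z) * mills_ratio (- t))
     (fun t => (1 - gcdf z) * (1 + t * mills_ratio (- t))) x y xy.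
  + move=> t _; have dm := is_derive_mills_ratio (- t).
    have dc : is_derive t (1 : R) (mills_ratio \o -%R) (- (- t * mills_ratio (- t) - 1)).
      apply: is_derive_eq (is_derive1_comp dm _) _.
      by rewrite /GRing.scale/=; ring.
    apply: is_derive_eq; rewrite /GRing.scale/=; ring.
  + apply: derivable_within_continuous => t _.
    have dm := is_derive_mills_ratio (- t).
    exact: ex_derive.
  exists t; first by move: txy; rewrite in_itv.
  move: txy; rewrite in_itv/= => /andP[xt ty].
  have tz := le_trans (ltW ty) yz.
  rewrite /stein_sol yz (le_trans (ltW xy) yz) e; congr (_ * _).
  rewrite /stein_der /stein_sol tz/=; ring.
Qed.

Lemma stein_lip z x y : x <= y -> `|stein_sol z y - stein_sol z x| <= 2 * (y - x).
Proof.
rewrite le_eqVlt => /orP[/eqP->|xy]; first by rewrite !subrr normr0 mulr0.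
have key a b : a < b -> z <= a \/ b <= z ->
    `|stein_sol z b - stein_sol z a| <= 2 * (b - a).
  move=> ab /(stein_mvt ab)[t _ ->]; rewrite normrM (gtr0_norm (x := b - a)) ?subr_gt0//.
  by rewrite ler_wpM2r ?subr_ge0 ?(ltW ab)// stein_der_le2.
have [zx|xz] := leP z x; first by apply: key => //; left.
have [yz|zy] := leP y z; first by apply: key => //; right.
have h1 := key _ _ xz (or_intror (lexx z)); have h2 := key _ _ zy (or_introl (lexx z)).
have -> : stein_sol z y - stein_sol z x =
  (stein_sol z y - stein_sol z z) + (stein_sol z z - stein_sol z x) by ring.
by apply: (le_trans (ler_normD _ _)); lra.
Qed.

(** The indicator pays for the jump of the derivative; without a jump, x F(x) varies
by at most h times the bound on F plus |x| times the Lipschitz bound. *)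
Lemma stein_diff z x h : 0 < h ->
  `|h^-1 * (stein_sol z (x + h) - stein_sol z x) - stein_der z x| <=
  h * (mills_bound + 2 * `|x|) + 4 * (x <= z < x + h)%R%:R.
Proof.
move=> h0; have xh : x < x + h by rewrite ltrDl.
have B0 := le_trans ler01 mills_bound_ge1.
have [/andP[xz zx]|] := boolP (x <= z < x + h).
  have hB : 0 <= h * (mills_bound + 2 * `|x|) by rewrite mulr_ge0 ?(ltW h0)// addr_ge0// mulr_ge0.
  rewrite mulr1; apply: (le_trans (ler_normB _ _)).
  have := stein_der_le2 z x; have := stein_lip z (ltW xh).
  rewrite addrAC subrr add0r normrM (gtr0_norm (x := h^-1)) ?invr_gt0// => h1 h2.
  have : h^-1 * `|stein_sol z (x + h) - stein_sol z x| <= 2.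
    by rewrite ler_pdivrMl// mulrC.
  lra.
rewrite negb_and -ltNge -leNgt mulr0 addr0 => zc.
have zc' : z <= x \/ x + h <= z by move/orP: zc => [/ltW|]; [left|right].
have [t /andP[xt th] ->] := stein_mvt xh zc'.
have -> : h^-1 * (stein_der z t * (x + h - x)) = stein_der z t.
  by rewrite [x + h]addrC addrK mulrCA mulVf ?mulr1// gt_eqF.
have e : (t <= z) = (x <= z).
  move/orP: zc => [zx|hz]; first by rewrite !leNgt zx (lt_trans zx xt).
  by rewrite (le_trans (ltW th) hz) (le_trans (ltW xh) hz).
have -> : stein_der z t - stein_der z x =
  (t - x) * stein_sol z t + x * (stein_sol z t - stein_sol z x).
  by rewrite /stein_der e; ring.
apply: (le_trans (ler_normD _ _)); rewrite !normrM (gtr0_norm (x := t - x)) ?subr_gt0//.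
rewrite (ger0_norm (stein_sol_ge0 _ _)).
have [sB _] := stein_sol_bounds z t; have := stein_lip z (ltW xt).
have := stein_sol_ge0 z t; have := normr_ge0 x.
move: (stein_sol z t) (`|x|) (`|stein_sol z t - stein_sol z x|) sB => a b c sB b0 a0 hc.
have tx : t - x <= h by lra.
have tx0 : 0 <= t - x by lra.
have : (t - x) * a <= h * mills_bound by rewrite ler_pM.
have : b * c <= b * (2 * h) by rewrite ler_wpM2l//; lra.
lra.
Qed.

End std_normal.

(** * Normal approximation of a count that satisfies Stein's identity *)

Section count_expectation.
Context {R : realType} {dOm : measure_display} {Om : measurableType dOm}.
Variable P : probability Om R.
Variable W : Om -> nat.
Hypothesis mW : measurable_fun setT W.
Hypothesis iW : P.-integrable setT (fun w => (W w)%:R%:E).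
Implicit Types phi psi : nat -> R.

Definition Ew phi : R := \int[P]_w phi (W w).

(** The functions of a count with finite mean whose expectation is surely finite. *)
Definition lin_growth phi := exists a b : R, forall j, `|phi j| <= a + b * j%:R.

Lemma measurable_Ew phi : measurable_fun setT (phi \o W).
Proof. by apply: measurableT_comp. Qed.

Lemma integrable_Ew phi : lin_growth phi ->
  P.-integrable setT (EFin \o (fun w => phi (W w))).
Proof.
case=> a [b ab].
have ib : P.-integrable setT (EFin \o (fun w => `|a| + `|b| * (W w)%:R)).
  rewrite (_ : EFin \o _ = (fun w => (`|a|%:E + `|b|%:E * (W w)%:R%:E)%E)).
    apply: integrableD => //; first exact: finite_measure_integrable_cst.
    exact: integrableZl.
  by apply/funext => w /=; rewrite EFinD EFinM.
apply: (le_integrable _ _ _ ib) => //.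
  by apply/measurable_EFinP; exact: measurable_Ew.
move=> w _ /=; rewrite lee_fin (le_trans (ab _))//.
rewrite (@le_trans _ _ (`|a| + `|b| * (W w)%:R))// ?ler_norm// lerD ?ler_norm//.
by rewrite ler_wpM2r ?ler_norm.
Qed.

Lemma lin_growthD phi psi : lin_growth phi -> lin_growth psi ->
  lin_growth (fun j => phi j + psi j).
Proof.
move=> [a [b h]] [a' [b' h']]; exists (a + a'), (b + b') => j.
by apply: (le_trans (ler_normD _ _)); have := h j; have := h' j; lra.
Qed.

Lemma lin_growthZ c phi : lin_growth phi -> lin_growth (fun j => c * phi j).
Proof.
move=> [a [b h]]; exists (`|c| * a), (`|c| * b) => j.
by rewrite normrM -mulrA -mulrDr ler_wpM2l.
Qed.

Lemma lin_growthN phi : lin_growth phi -> lin_growth (fun j => - phi j).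
Proof. by move=> [a [b h]]; exists a, b => j; rewrite normrN. Qed.

Lemma lin_growthB phi psi : lin_growth phi -> lin_growth psi ->
  lin_growth (fun j => phi j - psi j).
Proof. by move=> h /lin_growthN; exact: lin_growthD. Qed.

Lemma lin_growth_bnd M phi : (forall j, `|phi j| <= M) -> lin_growth phi.
Proof. by move=> h; exists M, 0 => j; rewrite mul0r addr0. Qed.

Lemma lin_growth_cst c : lin_growth (fun=> c).
Proof. exact: (@lin_growth_bnd `|c|). Qed.

Lemma lin_growth_norm phi : lin_growth phi -> lin_growth (fun j => `|phi j|).
Proof. by move=> [a [b h]]; exists a, b => j; rewrite normr_id. Qed.

Lemma lin_growth_id : lin_growth (fun j => j%:R).
Proof. by exists 0, 1 => j; rewrite normr_nat mul1r add0r. Qed.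

Lemma lin_growthM M phi : (forall j, `|phi j| <= M) ->
  lin_growth (fun j => j%:R * phi j).
Proof.
by move=> h; exists 0, M => j; rewrite normrM normr_nat add0r mulrC ler_wpM2r.
Qed.

Lemma EwD phi psi : lin_growth phi -> lin_growth psi ->
  Ew (fun j => phi j + psi j) = Ew phi + Ew psi.
Proof. by move=> /integrable_Ew h /integrable_Ew h'; exact: RintegralD. Qed.

Lemma EwB phi psi : lin_growth phi -> lin_growth psi ->
  Ew (fun j => phi j - psi j) = Ew phi - Ew psi.
Proof. by move=> /integrable_Ew h /integrable_Ew h'; exact: RintegralB. Qed.

Lemma EwZ c phi : lin_growth phi -> Ew (fun j => c * phi j) = c * Ew phi.
Proof. by move=> /integrable_Ew h; exact: RintegralZl. Qed.

Lemma Ew_le phi psi : lin_growth phi -> lin_growth psi ->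
  (forall j, phi j <= psi j) -> Ew phi <= Ew psi.
Proof.
by move=> /integrable_Ew h /integrable_Ew h' hh; apply: le_Rintegral => // w _; exact: hh.
Qed.

Lemma Ew_norm phi : lin_growth phi -> `|Ew phi| <= Ew (fun j => `|phi j|).
Proof. by move=> /integrable_Ew h; exact: le_normr_Rintegral. Qed.

Lemma Ew_cst c : Ew (fun=> c) = c.
Proof. rewrite /Ew Rintegral_cst//; have := probability_setT P => /= ->.
by rewrite mulr1. Qed.

Lemma Ew_pred (Q : pred nat) :
  Ew (fun j => (Q j)%:R) = fine (P [set w | Q (W w)]).
Proof.
have mQ : measurable [set w | Q (W w)].
  by rewrite -[X in measurable X]setTI; exact: (mW measurableT (Y := [set j | Q j])).
rewrite /Ew /Rintegral; congr fine.
have := integral_indic P measurableT mQ; rewrite setIT => <-.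
apply: eq_integral => w _; rewrite indicE; congr (_ %:R%:E)%R.
by have [h|h] := boolP (Q (W w)); [rewrite mem_set|rewrite memNset//; exact/negP].
Qed.

End count_expectation.

Section stein_kolmogorov.
Context {R : realType} {dOm : measure_display} {Om : measurableType dOm}.
Variable P : probability Om R.
Variable W : Om -> nat.
Hypothesis mW : measurable_fun setT W.
Hypothesis iW : P.-integrable setT (fun w => (W w)%:R%:E).
Variables lambda alpha beta kappa : R.
Hypothesis lambda_gt0 : 0 < lambda.
Local Notation Ew := (Ew P W).

(** Stein's identity for the Poisson law of mean lam, up to an error. The term in M
is the price of a random sample size, whose conditional mean differs from lam. *)
Definition poisson_approx (lam a b : R) := forall (g : nat -> R) (L M : R),
  (forall j, 0 <= g j <= M) -> (forall j, `|g j.+1 - g j| <= L) ->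
  `|Ew (fun j => j%:R * g j) - lam * Ew (fun j => g j.+1)| <= L * a + M * b.

Hypothesis W_stein : poisson_approx lambda alpha beta.
Hypothesis W_dev : Ew (fun j => `|j%:R - lambda|) <= kappa.

Let lgB (M : R) (phi : nat -> R) : (forall j, `|phi j| <= M) -> lin_growth phi.
Proof. exact: lin_growth_bnd. Qed.

Let lg_bool (b : nat -> bool) : @lin_growth R (fun j => (b j)%:R).
Proof. by apply: (@lgB 1) => j; rewrite normr_nat lern1 leq_b1. Qed.

Let lg_dev : lin_growth (fun j => `|j%:R - lambda|).
Proof.
apply: lin_growth_norm; apply: lin_growthB; first exact: lin_growth_id.
exact: lin_growth_cst.
Qed.

(** The test function 1{k < j} has 1{j = k} as its increment, so Stein's identity
expresses lambda P(W = k) by an expectation of (j - lambda) 1{k < j}. *)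
Lemma count_concentration k :
  lambda * Ew (fun j => (j == k)%:R) <= kappa + alpha + beta.
Proof.
pose g j : R := (k < j)%N%:R.
have g01 j : 0 <= g j <= 1.
  by rewrite /g; case: ltnP => _ /=; rewrite ?ler01 lexx.
have gL j : `|g j.+1 - g j| <= 1.
  by have /andP[? ?] := g01 j; have /andP[? ?] := g01 j.+1; rewrite ler_norml; lra.
have := W_stein g01 gL.
rewrite !mul1r => /ler_normlP[h _].
have gj : forall j, `|g j| <= 1 by move=> j; rewrite normr_nat lern1 leq_b1.
have e : Ew (fun j => (j == k)%:R) = Ew (fun j => g j.+1) - Ew g.
  rewrite -EwB//; [|exact: lg_bool..].
  apply: eq_Rintegral => w _; rewrite /g ltnS.
  by case: ltngtP => _ /=; rewrite ?subrr// subr0.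
have : Ew (fun j => j%:R * g j) - lambda * Ew g <= kappa.
  have -> : Ew (fun j => j%:R * g j) - lambda * Ew g =
      Ew (fun j => j%:R * g j - lambda * g j).
    rewrite EwB ?EwZ//; [exact: lg_bool|exact: lin_growthM gj|].
    by apply: lin_growthZ; exact: lg_bool.
  apply: le_trans W_dev; apply: Ew_le => //.
    apply: lin_growthB; first exact: lin_growthM gj.
    by apply: lin_growthZ; exact: lg_bool.
  by move=> j; rewrite -mulrBl (le_trans (ler_norm _))// normrM ler_piMr.
by rewrite e mulrBr; lra.
Qed.

(** Stein's equation at y = (W - lambda) h, with h^2 lambda = 1, splits the
difference of distribution functions in two: the error of replacing the derivative
by the quotient of step h, and h times the defect in the Poisson identity. At most
one value of W sees the jump of the derivative, since consecutive values of y differ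
by h. *)
Lemma stein_kolmogorov (z h : R) : h = (Num.sqrt lambda)^-1 ->
  `|fine (P [set w | ((W w)%:R - lambda) / Num.sqrt lambda <= z]) - gcdf z| <=
  h * mills_bound * (1 + beta) + h ^+ 2 * (6 * kappa + 6 * alpha + 4 * beta).
Proof.
move=> hE; pose B : R := mills_bound.
have B0 : 0 <= B := le_trans ler01 mills_bound_ge1.
have h0 : 0 < h by rewrite hE invr_gt0 sqrtr_gt0.
have hl : h ^+ 2 * lambda = 1.
  by rewrite hE exprVn sqr_sqrtr ?(ltW lambda_gt0)// mulVf// gt_eqF.
pose y (j : nat) : R := (j%:R - lambda) / Num.sqrt lambda.
have yS j : y j.+1 = y j + h by rewrite /y -hE -natr1; ring.
pose g j : R := stein_sol z (y j).
pose b j : bool := y j <= z < y j + h.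
have g01 j : 0 <= g j <= B.
  by rewrite stein_sol_ge0; case: (stein_sol_bounds z (y j)).
have gL j : `|g j.+1 - g j| <= 2 * h.
  rewrite /g yS; have := @stein_lip _ z (y j) (y j + h).
  by rewrite [y j + h - y j]addrAC subrr add0r; apply; rewrite lerDl ltW.
have gB j : `|g j| <= B by rewrite ger0_norm; case/andP: (g01 j).
have W1 := W_stein g01 gL.
have W2 : lambda * Ew (fun j => (b j)%:R) <= kappa + alpha + beta.
  have [[k bk]|nb] := pselect (exists k, b k).
    apply: le_trans (count_concentration k).
    rewrite ler_wpM2l ?(ltW lambda_gt0)//; apply: Ew_le => // j.
    rewrite ler_nat; case: (boolP (b j)) => //= bj.
    suff -> : j = k by rewrite eqxx.
    have aux i i' : b i -> b i' -> (i < i')%N -> False.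
      rewrite /b => /andP[_ zi] /andP[zi' _] ii'.
      have : y i.+1 <= y i'.
        by rewrite /y -hE ler_wpM2r ?(ltW h0)// lerB// ler_nat.
      by rewrite yS; lra.
    case: (ltngtP j k) => // jk; [case: (aux _ _ bj bk jk)|case: (aux _ _ bk bj jk)].
  rewrite (_ : Ew _ = 0).
    have := count_concentration 0; apply: le_trans.
    rewrite mulr0 mulr_ge0 ?(ltW lambda_gt0)// /Ew Rintegral_ge0//.
  rewrite -[RHS](Ew_cst P W 0); apply: eq_Rintegral => w _.
  by case: (boolP (b (W w))) => // bw; case: nb; exists (W w).
have W3 : Ew (fun j => `|y j|) <= h * kappa.
  have -> : Ew (fun j => `|y j|) = h * Ew (fun j => `|j%:R - lambda|).
    rewrite -EwZ//; apply: eq_Rintegral => w _.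
    by rewrite /y -hE normrM (gtr0_norm h0) mulrC.
  by rewrite ler_wpM2l// ltW.
pose D j := stein_der z (y j).
have lD : lin_growth D by apply: (@lgB 2) => j; exact: stein_der_le2.
have lg1 : lin_growth (fun j => g j.+1) by exact: (@lgB B).
have lg0 : lin_growth g by exact: (@lgB B).
have ljg : lin_growth (fun j => j%:R * g j) by exact: lin_growthM gB.
have ly : lin_growth (fun j => `|y j|).
  rewrite (_ : (fun _ => _) = (fun j => h * `|j%:R - lambda|)); last first.
    by apply/funext => j; rewrite /y -hE normrM (gtr0_norm h0) mulrC.
  exact: lin_growthZ.
have e1 : fine (P [set w | ((W w)%:R - lambda) / Num.sqrt lambda <= z]) - gcdf z =
  Ew (fun j => D j - h^-1 * (g j.+1 - g j)) +
  h * (lambda * Ew (fun j => g j.+1) - Ew (fun j => j%:R * g j)).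
  have <- : Ew (fun j => (y j <= z)%R%:R - gcdf z) =
      fine (P [set w | ((W w)%:R - lambda) / Num.sqrt lambda <= z]) - gcdf z.
    rewrite EwB ?Ew_cst//; last exact: lin_growth_cst.
    by rewrite (Ew_pred P mW (fun j => y j <= z)).
  rewrite -EwZ// -EwB//; last exact: lin_growthZ.
  rewrite -EwZ//; last by apply: lin_growthB => //; exact: lin_growthZ.
  rewrite -EwD//.
  - apply: eq_Rintegral => w _; rewrite /D /stein_der -/(g _).
    move: (W w) => j; rewrite /y -hE.
    have hV : h != 0 by rewrite gt_eqF.
    have -> : lambda = (h ^+ 2)^-1.
      by apply: (mulfI (x := h ^+ 2)); rewrite ?expf_neq0// hl mulfV// expf_neq0.
    by field.
  - apply: lin_growthB => //; apply: lin_growthZ; exact: lin_growthB.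
  - by apply: lin_growthZ; apply: lin_growthB => //; exact: lin_growthZ.
rewrite e1; apply: (le_trans (ler_normD _ _)).
have W4 : `|Ew (fun j => D j - h^-1 * (g j.+1 - g j))| <=
   h * (B + 2 * (h * kappa)) + 4 * (h ^+ 2 * (kappa + alpha + beta)).
  apply: le_trans (Ew_norm mW iW _) _.
    by apply: lin_growthB => //; apply: lin_growthZ; exact: lin_growthB.
  apply: (@le_trans _ _ (Ew (fun j => (h * B + (h * 2) * `|y j|) + 4 * (b j)%:R))).
    apply: Ew_le => //.
    + apply: lin_growth_norm; apply: lin_growthB => //.
      by apply: lin_growthZ; exact: lin_growthB.
    + apply: lin_growthD; last exact: lin_growthZ.
      apply: lin_growthD; first exact: lin_growth_cst.
      exact: lin_growthZ.
    + move=> j; rewrite distrC /g yS -mulrA -mulrDr.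
      exact: stein_diff.
  have lhB : lin_growth (fun _ : nat => h * B) by exact: lin_growth_cst.
  have lhy : lin_growth (fun j => (h * 2) * `|y j|) by exact: lin_growthZ.
  rewrite EwD//; [|exact: lin_growthD|exact: lin_growthZ].
  rewrite EwD// Ew_cst !EwZ//; move: W3 W2; clearbody B.
  move: (Ew (fun j => `|y j|)) (Ew (fun j => (b j)%:R)) => ey eb W3 W2.
  have : h ^+ 2 * (lambda * eb) <= h ^+ 2 * (kappa + alpha + beta).
    by rewrite ler_wpM2l// exprn_ge0// ltW.
  rewrite mulrA hl mul1r.
  have : h * ey <= h * (h * kappa) by rewrite ler_wpM2l// ltW.
  lra.
have W5 : `|h * (lambda * Ew (fun j => g j.+1) - Ew (fun j => j%:R * g j))| <=
   h * (2 * h * alpha + B * beta).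
  by rewrite normrM (gtr0_norm h0) distrC ler_wpM2l ?(ltW h0).
move: W4 W5; rewrite -/B expr2; nra.
Qed.

End stein_kolmogorov.

(** * Sequences of independent identically distributed points *)

Section trajectories.
Context {d : measure_display} {T : measurableType d}.

Definition cyl (n : nat) (E : nat -> set T) : set (nat -> T) :=
  [set w | forall i, (i < n)%N -> E i (w i)].

Definition cylinders : set (set (nat -> T)) :=
  [set C | exists n E, (forall i, measurable (E i)) /\ C = cyl n E].

(** Sequences with the sigma-algebra generated by finite-dimensional cylinders. *)
Definition traj : Type := g_sigma_algebraType cylinders.
HB.instance Definition _ := Measurable.on traj.

Lemma cyl_cylinders n E : (forall i, measurable (E i)) -> cylinders (cyl n E).
Proof. by move=> mE; exists n, E. Qed.

Lemma measurable_cyl n E : (forall i, measurable (E i)) ->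
  measurable (cyl n E : set traj).
Proof. by move=> mE; apply: sub_sigma_algebra; exact: cyl_cylinders. Qed.

Lemma cylindersI : setI_closed cylinders.
Proof.
move=> _ _ [m [E [mE ->]]] [n [F [mF ->]]].
exists (maxn m n), (fun i => (if (i < m)%N then E i else setT) `&`
  (if (i < n)%N then F i else setT)); split.
  by move=> i; apply: measurableI; case: ifP.
apply/seteqP; split=> [w [hE hF] i _|w h].
  by split; case: ifP => // /[dup]; [move=> _ /hE|move=> _ /hF].
split=> i im; have := h i; rewrite leq_max im ?orbT /= => -[] //.
Qed.

Lemma measurable_coord i : measurable_fun setT (fun w : traj => w i).
Proof.
move=> _ Y mY; rewrite setTI.
have -> : (fun w : traj => w i) @^-1` Y =
    cyl i.+1 (fun j => if j == i then Y else setT).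
  apply/seteqP; split => [w Yw j _|w /(_ i)]; first by case: eqP => [->|].
  by rewrite eqxx; exact.
by apply: measurable_cyl => j; case: ifP.
Qed.

Lemma measurable_traj d' (Om : measurableType d') (f : Om -> traj) :
  (forall i, measurable_fun setT (fun x => f x i)) -> measurable_fun setT f.
Proof.
move=> mf _ A mA; rewrite setTI.
pose G : set (set traj) := [set B | measurable (f @^-1` B)].
suff : (measurable : set (set traj)) `<=` G by exact.
apply: smallest_sub.
  split; rewrite /G/=.
  - by rewrite preimage_set0.
  - by move=> B mB; rewrite setTD preimage_setC; exact: measurableC.
  - by move=> F mF; rewrite preimage_bigcup; exact: bigcupT_measurable.
move=> _ [n [E [mE ->]]]; rewrite /G/=.
have -> : f @^-1` cyl n E = \bigcap_(i < n) ((fun x => f x i) @^-1` E i).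
  by apply/seteqP; split => x h i /h.
apply: fin_bigcap_measurable => // i _.
by rewrite -[X in measurable X]setTI; exact: mf.
Qed.

End trajectories.

Section iid.
Context {R : realType} {d : measure_display} {T : measurableType d}.
Variable nu : probability T R.
Implicit Types (F : @traj d T -> \bar R).
Local Notation traj := (@traj d T).
Local Open Scope ereal_scope.

Definition iid_law (Q : set traj -> \bar R) := forall n E,
  (forall i, measurable (E i)) -> Q (cyl n E) = \prod_(0 <= i < n) nu (E i).

(** Cylinders are stable under intersection and determine the law. *)
Lemma iid_law_unique (m1 m2 : {measure set traj -> \bar R}) :
  iid_law m1 -> iid_law m2 -> forall A, measurable A -> m1 A = m2 A.
Proof.
move=> h1 h2 A mA; apply: (@measure_unique _ R traj cylinders (fun=> setT)) => //.
- exact: cylindersI.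
- move=> _; exists 0%N, (fun=> setT); split => //.
  by apply/seteqP; split.
- exact: bigcup_const.
- by move=> _ [n [E [mE ->]]]; rewrite h1 ?h2.
- move=> _; have -> : [set: nat -> T] = cyl 0 (fun=> setT) by apply/seteqP; split.
  by rewrite h1// big_geq// ltry.
Qed.

Variable Q : probability traj R.
Hypothesis Qiid : iid_law Q.

(** To integrate against an i.i.d. law it is enough to know a map with the right
cylinder probabilities; resampling, splicing and swapping below are such maps. *)
Lemma iid_change d' (Om : measurableType d') (P : {measure set Om -> \bar R})
    (Y : Om -> traj) : measurable_fun setT Y ->
  (forall n E, (forall i, measurable (E i)) ->
     P (Y @^-1` cyl n E) = \prod_(0 <= i < n) nu (E i)) ->
  forall F, measurable_fun setT F -> (forall w, 0 <= F w) ->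
  \int[P]_x F (Y x) = \int[Q]_w F w.
Proof.
move=> mY hY F mF F0.
have := @ge0_integral_pushforward _ _ _ _ _ Y mY P setT F measurableT mF.
rewrite preimage_setT => <-//.
apply: eq_measure_integral => A mA _.
exact: (@iid_law_unique (pushforward P Y) Q).
Qed.

Definition upd (i : nat) (x : T) (w : traj) : traj :=
  fun j => if j == i then x else w j.

Lemma measurable_upd i : measurable_fun setT (fun p : T * traj => upd i p.1 p.2).
Proof.
apply: measurable_traj => j; rewrite /upd; case: eqP => _.
  exact: measurable_fst.
by apply: measurableT_comp (measurable_coord j) _; exact: measurable_snd.
Qed.

(** Coordinate i may be replaced by an independent copy. *)
Lemma iid_resample i F : measurable_fun setT F -> (forall w, 0 <= F w) ->
  \int[Q]_w F w = \int[nu]_x \int[Q]_w F (upd i x w).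
Proof.
move=> mF F0.
rewrite -(@fubini_tonelli1 _ _ _ _ _ nu Q (fun p => F (upd i p.1 p.2)))//.
- apply/esym; apply: iid_change => // [|n E mE]; first exact: measurable_upd.
  pose E' j := if j == i then setT else E j.
  have mE' j : measurable (E' j) by rewrite /E'; case: ifP.
  pose A := if (i < n)%N then E i else setT.
  have mA : measurable A by rewrite /A; case: ifP.
  have -> : (fun x : T * traj => upd i x.1 x.2) @^-1` cyl n E = A `*` cyl n E'.
    apply/seteqP; split => [[x w] h|[x w] [/= Ax h] j jn].
      split => /=.
        by rewrite /A; case: ifP => // /h; rewrite /upd /= eqxx.
      by move=> j /h; rewrite /upd /E' /=; case: ifP.
    have := h j jn; rewrite /upd /E' /=; case: ifP => // /eqP ji _.
    by move: Ax; rewrite /A ji -ji jn.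
  rewrite [LHS](@product_measure1E _ _ _ _ _ nu Q A (cyl n E') mA); last exact: measurable_cyl.
  transitivity (nu A * \prod_(0 <= j < n) nu (E' j)).
    by congr (_ * _); exact: Qiid.
  rewrite /A; case: ifP => [|/negbT]; last first.
    rewrite -leqNgt probability_setT mul1e => ni.
    by apply: eq_big_nat => j /andP[_ jn]; rewrite /E' ltn_eqF// (leq_trans jn).
  move=> ltin; rewrite !big_mkord (bigD1 (Ordinal ltin))//= [in RHS](bigD1 (Ordinal ltin))//=.
  rewrite /E' eqxx probability_setT mul1e; congr (_ * _).
  by apply: eq_bigr => j; rewrite -val_eqE /= => /negbTE ->.
- by apply: measurableT_comp => //; exact: measurable_upd.
Qed.

Definition splice (m : nat) (w w' : traj) : traj :=
  fun j => if (j < m)%N then w j else w' (j - m)%N.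

Lemma iid_splice m F : measurable_fun setT F -> (forall w, 0 <= F w) ->
  \int[Q]_w F w = \int[Q]_w \int[Q]_w' F (splice m w w').
Proof.
move=> mF F0.
have ms : measurable_fun setT (fun p : traj * traj => splice m p.1 p.2).
  apply: measurable_traj => j; rewrite /splice; case: ltnP => _.
    by apply: measurableT_comp (measurable_coord j) _; exact: measurable_fst.
  by apply: measurableT_comp (measurable_coord (j - m)) _; exact: measurable_snd.
rewrite -(@fubini_tonelli1 _ _ _ _ _ Q Q (fun p => F (splice m p.1 p.2)))//; last first.
  exact: measurableT_comp.
apply/esym; apply: iid_change => // n E mE.
have -> : (fun p : traj * traj => splice m p.1 p.2) @^-1` cyl n E =
    cyl (minn n m) E `*` cyl (n - m) (fun j => E (m + j)%N).
  apply/seteqP; split => [[w w'] h|[w w'] [/= h h'] j jn].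
    split=> j /=.
      by rewrite leq_min => /andP[/h + jm]; rewrite /splice /= jm.
    rewrite ltn_subRL => /h; rewrite /splice /= ltnNge leq_addr /=.
    by rewrite addnC addnK.
  rewrite /splice /=; case: ltnP => jm; first by apply: h; rewrite leq_min jn.
  by have := h' (j - m)%N; rewrite ltn_sub2rE// subnKC//; exact.
rewrite [LHS](@product_measure1E _ _ _ _ _ Q Q); [|exact: measurable_cyl|exact: measurable_cyl].
transitivity (\prod_(0 <= j < minn n m) nu (E j) *
    \prod_(0 <= j < n - m) nu (E (m + j)%N)).
  by congr (_ * _); apply: Qiid => j; exact: mE.
have [nm|mn] := leqP n m.
  by move: nm; rewrite -subn_eq0 => /eqP ->; rewrite [X in _ * X]big_geq// mule1.
rewrite [RHS](big_cat_nat (n := m))//= ?(ltnW mn)//; congr (_ * _).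
rewrite -[in RHS](add0n m) big_addn; apply: eq_bigr => j _.
by rewrite addnC.
Qed.

Definition drop_traj (m : nat) (w : traj) : traj := fun j => w (m + j)%N.

Lemma measurable_drop_traj m : measurable_fun setT (drop_traj m).
Proof. by apply: measurable_traj => j; exact: measurable_coord. Qed.

(** Splice an independent sequence after the first m coordinates, the only ones on
which b depends. *)
Lemma iid_indep m (b F : traj -> R) :
  measurable_fun setT b -> (forall w, (0 <= b w)%R) ->
  measurable_fun setT F -> (forall w, (0 <= F w)%R) ->
  (forall w w', (forall i, (i < m)%N -> w i = w' i) -> b w = b w') ->
  \int[Q]_w (b w * F (drop_traj m w))%:E =
  \int[Q]_w (b w)%:E * \int[Q]_w (F w)%:E.
Proof.
move=> mb b0 mF F0 hb.
have mshift := measurable_drop_traj m.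
rewrite (@iid_splice m (fun w => (b w * F (drop_traj m w))%:E)); last 2 first.
- apply/measurable_EFinP; apply: measurable_funM => //.
  exact: (measurableT_comp mF mshift).
- by move=> w; rewrite lee_fin mulr_ge0.
under eq_integral => w _.
  under eq_integral => w' _.
    rewrite (_ : (b _ * F _)%:E = (b w)%:E * (F w')%:E); first over.
    rewrite -EFinM; congr (_ * F _)%:E.
      by apply: hb => i im; rewrite /splice im.
    by apply/funext => j; rewrite /drop_traj /splice ltnNge leq_addr /= addnC addnK.
  rewrite ge0_integralZl//=; last 3 first.
  - by apply/measurable_EFinP.
  - by move=> x _; rewrite lee_fin.
  - by rewrite lee_fin.
  over.
rewrite ge0_integralZr//=.
- by apply/measurable_EFinP.
- by move=> x _; rewrite lee_fin.
- by apply: integral_ge0 => x _; rewrite lee_fin.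
Qed.

Definition swapn (a b j : nat) : nat :=
  if j == a then b else if j == b then a else j.

Lemma swapnK a b : involutive (swapn a b).
Proof.
move=> j; rewrite /swapn; case: (eqVneq j a) => [->|ja].
  by rewrite eqxx; case: eqVneq => //.
by case: (eqVneq j b) => [->|jb]; rewrite ?eqxx// (negbTE ja) (negbTE jb).
Qed.

Lemma iid_swap a b F : measurable_fun setT F -> (forall w, 0 <= F w) ->
  \int[Q]_w F (w \o swapn a b) = \int[Q]_w F w.
Proof.
move=> mF F0; apply: iid_change => // [|n E mE].
  by apply: measurable_traj => j; exact: measurable_coord.
pose N := maxn n (maxn a.+1 b.+1).
have aN : (a < N)%N by rewrite /N !leq_max leqnn orbT.
have bN : (b < N)%N by rewrite /N !leq_max leqnn !orbT.
have sN j : (swapn a b j < N)%N = (j < N)%N.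
  rewrite /swapn; case: eqP => [->|_]; first by rewrite aN bN.
  by case: eqP => [->|//]; rewrite aN bN.
pose E' i := if (i < n)%N then E i else setT.
have mE' j : measurable (E' j) by rewrite /E'; case: ifP.
have -> : (fun w : traj => (w \o swapn a b : traj)) @^-1` cyl n E =
    cyl N (fun j => E' (swapn a b j)).
  apply/seteqP; split => [w h j jN|w h i ltin] /=.
    rewrite /E'; case: ifP => // /h /=; by rewrite swapnK.
  have := h (swapn a b i); rewrite sN swapnK /E' ltin; apply.
  by rewrite /N leq_max ltin.
transitivity (\prod_(0 <= j < N) nu (E' (swapn a b j))).
  by apply: Qiid => j; exact: mE'.
have -> : \prod_(0 <= i < n) nu (E i) = \prod_(0 <= i < N) nu (E' i).
  rewrite [RHS](big_cat_nat (n := n))//=; last by rewrite leq_maxl.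
  rewrite [X in _ * X]big1_seq ?mule1; last first.
    move=> i /andP[_]; rewrite mem_index_iota => /andP[ni _].
    by rewrite /E' ltnNge ni /= probability_setT.
  by apply: eq_big_nat => i /andP[_ ltin]; rewrite /E' ltin.
pose s (j : 'I_N) : 'I_N := Ordinal (etrans (sN j) (ltn_ord j)).
have sI : injective s.
  by apply: (can_inj (g := s)) => j; apply/val_inj; rewrite /= swapnK.
by rewrite !big_mkord [RHS](reindex_inj sI).
Qed.

End iid.

(** * Stein's identity for the number of isolated points *)

Lemma measurable_all {d} {Om : measurableType d} (b : nat -> Om -> bool) (s : seq nat) :
  (forall j, measurable_fun setT (b j)) ->
  measurable_fun setT (fun w => all (fun j => b j w) s).
Proof.
move=> mb; elim: s => [|j s ih] /=; first exact: measurable_cst.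
by apply: measurable_and.
Qed.

Lemma measurable_natb {R : realType} {d} {Om : measurableType d} (b : Om -> bool) :
  measurable_fun setT b -> measurable_fun setT (fun w => (b w)%:R : R).
Proof. by move=> mb; apply: (measurableT_comp (f := fun c : bool => c%:R : R)). Qed.

Lemma measurable_sumn {d} {Om : measurableType d} (b : nat -> Om -> nat) (s : seq nat) :
  (forall j, measurable_fun setT (b j)) ->
  measurable_fun setT (fun w => (\sum_(j <- s) b j w)%N).
Proof.
move=> mb; elim: s => [|j s ih].
  by under eq_fun do rewrite big_nil; exact: measurable_cst.
under eq_fun do rewrite big_cons.
by apply: measurable_fun_addn.
Qed.

Lemma prod_two_blocks (R : comNzRingType) k (F : nat -> R) :
  \prod_(0 <= i < k.+1 + k.+1) F i =
  (\prod_(0 <= i < k) F i) * F k * ((\prod_(0 <= j < k) F (k.+1 + j)%N) * F (k.+1 + k)%N).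
Proof.
rewrite (big_cat_nat (n := k.+1))//= ?leq_addr// big_nat_recr//=; congr (_ * _).
rewrite -{1}[k.+1]add0n big_addn addnK big_nat_recr//= addnC; congr (_ * _).
by apply: eq_bigr => j _; rewrite addnC.
Qed.

Lemma prod_except1 (R : comNzRingType) k i (u v : R) : (i < k)%N ->
  \prod_(0 <= j < k) (if j == i then u else v) = u * v ^+ k.-1.
Proof.
move=> ik; rewrite big_mkord (bigD1 (Ordinal ik))//= eqxx; congr (_ * _).
rewrite (eq_bigr (fun=> v)); last by move=> j; rewrite -val_eqE /= => /negbTE ->.
by rewrite prodr_const (cardC1 (Ordinal ik)) card_ord.
Qed.

Lemma prod_except2 (R : comNzRingType) k i j (u v s : R) : (i < k)%N -> (j < k)%N ->
  i != j ->
  \prod_(0 <= m < k) (if m == i then u else if m == j then s else v) =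
  u * s * v ^+ k.-2.
Proof.
move=> ik jk ij; rewrite big_mkord (bigD1 (Ordinal ik))//= eqxx -mulrA; congr (_ * _).
rewrite (bigD1 (Ordinal jk))//=; last by rewrite -val_eqE /= eq_sym.
rewrite eqxx eq_sym (negbTE ij); congr (_ * _).
rewrite (eq_bigr (fun=> v)); last first.
  by move=> m; rewrite -!val_eqE /= => /andP[/negbTE -> /negbTE ->].
rewrite prodr_const; congr (_ ^+ _).
rewrite -[k in RHS]card_ord -(cardC [pred m | m \in [:: Ordinal ik; Ordinal jk]]).
have -> : #|[pred m | m \in [:: Ordinal ik; Ordinal jk]]| = 2%N.
  rewrite (eq_card (B := mem [:: Ordinal ik; Ordinal jk])); last by move=> ?; rewrite !inE.
  by rewrite (card_uniqP _)//= inE -val_eqE /= ij.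
rewrite add2n /=; apply: eq_card => m.
by rewrite !inE negb_or.
Qed.

Section coupling.
Context {R : realType} {d : measure_display} {T : measurableType d}.
Variable nu : probability T R.
Local Notation traj := (@traj d T).
Variable Q : probability traj R.
Hypothesis Qiid : iid_law nu Q.
Variables near near2 : T -> T -> bool.
Hypothesis mnear : measurable_fun setT (fun p : T * T => near p.1 p.2).
Hypothesis mnear2 : measurable_fun setT (fun p : T * T => near2 p.1 p.2).
Hypothesis near_sym : forall x y, near x y = near y x.
Hypothesis near_near2 : forall x y z, near x z -> near y z -> near2 x y.

Definition pr (A : set T) : R := fine (nu A).

Lemma prE A : measurable A -> nu A = (pr A)%:E.
Proof. by move=> mA; rewrite /pr fineK// fin_num_measure. Qed.

Lemma pr_ge0 A : 0 <= pr A.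
Proof. by rewrite fine_ge0. Qed.

Lemma prT : pr setT = 1.
Proof. by rewrite /pr probability_setT. Qed.

Lemma prC A : measurable A -> pr (~` A) = 1 - pr A.
Proof.
move=> mA; apply: EFin_inj; rewrite -prE; last exact: measurableC.
by rewrite probability_setC// prE.
Qed.

Lemma pr_le A B : measurable A -> measurable B -> A `<=` B -> pr A <= pr B.
Proof. by move=> mA mB AB; rewrite -lee_fin -!prE//; apply: le_measure; rewrite ?inE. Qed.

Lemma pr_le1 A : measurable A -> pr A <= 1.
Proof. by move=> mA; rewrite -prT; apply: pr_le. Qed.

(** Fix the coordinates a and b to x and y by resampling. An event that confines
each other coordinate i < N to a set depending on x and y only then has conditional
probability at most the product of the probabilities of these sets. *)
Lemma two_point a b N (e : traj -> bool) (G : T -> T -> bool)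
    (E : nat -> T -> T -> T -> bool) (c : T -> T -> R) :
  a != b -> measurable_fun setT e ->
  (forall i x y, measurable [set z | E i x y z]) ->
  (forall w, e w -> G (w a) (w b) /\
     forall i, (i < N)%N -> i != a -> i != b -> E i (w a) (w b) (w i)) ->
  measurable_fun setT (fun p : T * T => c p.1 p.2) ->
  (forall x y, 0 <= c x y) ->
  (forall x y, G x y -> \prod_(0 <= i < N)
     (if (i == a) || (i == b) then 1 else pr [set z | E i x y z]) <= c x y) ->
  (\int[Q]_w ((e w)%:R)%:E <= \int[nu \x nu]_p (c p.1 p.2)%:E)%E.
Proof.
move=> ab me mE eGE mc c0 hc.
have meR : measurable_fun setT (fun w : traj => ((e w)%:R : R)%:E).
  by apply/measurable_EFinP; exact: measurable_natb.
have e0 w : (0 <= ((e w)%:R : R)%:E)%E by rewrite lee_fin.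
have mu2 : measurable_fun setT (fun q : (T * T) * traj => upd a q.1.1 (upd b q.1.2 q.2)).
  apply: measurable_traj => j; rewrite /upd; case: eqP => _.
    by apply: measurableT_comp; [exact: measurable_fst|exact: measurable_fst].
  case: eqP => _.
    by apply: measurableT_comp; [exact: measurable_snd|exact: measurable_fst].
  by apply: measurableT_comp (measurable_coord j) _; exact: measurable_snd.
have mh : measurable_fun setT (fun q : (T * T) * traj =>
    ((e (upd a q.1.1 (upd b q.1.2 q.2)))%:R : R)%:E).
  exact: (measurableT_comp meR mu2).
have step1 : (\int[Q]_w ((e w)%:R : R)%:E = \int[nu \x nu]_p \int[Q]_w
    ((e (upd a p.1 (upd b p.2 w)))%:R : R)%:E)%E.
  rewrite (iid_resample Qiid a)//.
  rewrite (fubini_tonelli1 (fun p : T * T => \int[Q]_w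
    ((e (upd a p.1 (upd b p.2 w)))%:R : R)%:E)%E)//=; last 2 first.
  - exact: (@measurable_fun_fubini_tonelli_F _ _ _ _ _ Q _ mh).
  - by move=> p; apply: integral_ge0.
  apply: eq_integral => x _; rewrite (iid_resample Qiid b).
  - reflexivity.
  - apply: (measurableT_comp meR).
  apply: measurable_traj => j; rewrite /upd; case: eqP => _; first exact: measurable_cst.
    exact: measurable_coord.
  - by move=> w; exact: e0.
rewrite step1; apply: ge0_le_integral => //.
- by move=> p _; apply: integral_ge0.
- exact: (@measurable_fun_fubini_tonelli_F _ _ _ _ _ Q _ mh).
- exact/measurable_EFinP.
move=> [x y] _ /=.
have [Gxy|nG] := boolP (G x y); last first.
  rewrite integral0_eq ?lee_fin// => w _; case: (boolP (e _)) => // /eGE[].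
  by rewrite /upd !eqxx eq_sym (negbTE ab) (negbTE nG).
apply: (@le_trans _ _ (Q (cyl N (fun i => if (i == a) || (i == b) then setT
   else [set z | E i x y z])))).
  have mC : measurable (cyl N (fun i => if (i == a) || (i == b) then setT
     else [set z | E i x y z]) : set traj).
    by apply: measurable_cyl => i; case: ifP.
  have := integral_indic Q measurableT mC; rewrite setIT => <-.
  apply: ge0_le_integral => //.
  - apply: (measurableT_comp meR).
    apply: measurable_traj => j; rewrite /upd; case: eqP => _; first exact: measurable_cst.
    by case: eqP => _; [exact: measurable_cst|exact: measurable_coord].
  - by apply/measurable_EFinP; exact: measurable_indic.
  move=> w _; rewrite lee_fin indicE.
  case: (boolP (e _)) => // /eGE[_ h]; rewrite mem_set// => i ltiN.
  case: ifPn => //; rewrite negb_or => /andP[ia ib].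
  have := h i ltiN ia ib.
  by rewrite /upd !eqxx [b == a]eq_sym (negbTE ab) (negbTE ia) (negbTE ib).
have -> : Q (cyl N (fun i => if (i == a) || (i == b) then setT
   else [set z | E i x y z])) = (\prod_(0 <= i < N)
     (if (i == a) || (i == b) then 1 else pr [set z | E i x y z]))%:E.
  rewrite -prodEFin; transitivity (\prod_(0 <= i < N) nu (if (i == a) || (i == b) then setT
   else [set z | E i x y z]))%E.
    by apply: Qiid => i; case: ifP.
  by apply: eq_bigr => i _; case: ifP => _; rewrite ?probability_setT// prE.
by rewrite lee_fin hc.
Qed.

Definition iso (k : nat) (w : nat -> T) (i : nat) : bool :=
  all (fun j => (j == i) || ~~ near (w i) (w j)) (iota 0 k).

Definition isocount (k : nat) (w : nat -> T) : nat := (\sum_(0 <= i < k) iso k w i)%N.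

Lemma isoP k w i : reflect (forall j, (j < k)%N -> j != i -> ~~ near (w i) (w j))
  (iso k w i).
Proof.
apply: (iffP allP) => h j; last first.
  by rewrite mem_iota add0n => /h; case: eqP => //= _; exact.
by move=> jk /negbTE ji; have := h j; rewrite mem_iota add0n jk ji /=; exact.
Qed.

Lemma iso_ext k w w' i : (i < k)%N -> (forall j, (j < k)%N -> w j = w' j) ->
  iso k w i = iso k w' i.
Proof.
move=> ik h; apply: eq_in_all => j; rewrite mem_iota add0n => /= jk.
by rewrite !h.
Qed.

Lemma isocount_ext k w w' : (forall j, (j < k)%N -> w j = w' j) ->
  isocount k w = isocount k w'.
Proof.
by move=> h; apply: eq_big_nat => i /andP[_ ik]; rewrite (iso_ext ik h).
Qed.

Lemma measurable_near d' (Om : measurableType d') (f g : Om -> T) (r : T -> T -> bool) :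
  measurable_fun setT (fun p : T * T => r p.1 p.2) ->
  measurable_fun setT f -> measurable_fun setT g ->
  measurable_fun setT (fun w => r (f w) (g w)).
Proof. by move=> mr mf mg; apply: (measurableT_comp mr (measurable_fun_pair mf mg)). Qed.

Lemma measurable_iso k i : measurable_fun setT (fun w : traj => iso k w i).
Proof.
apply: measurable_all => j; apply: measurable_or; first exact: measurable_cst.
apply: measurable_neg; apply: (measurable_near mnear); exact: measurable_coord.
Qed.

Lemma measurable_isocount k : measurable_fun setT (isocount k : traj -> nat).
Proof.
apply: measurable_sumn => i.
by apply: (measurableT_comp (f := nat_of_bool)) => //; exact: measurable_iso.
Qed.

Definition clear (k : nat) (w : nat -> T) : bool :=
  all (fun i => ~~ near (w k) (w i)) (iota 0 k).

Lemma clearP k w : reflect (forall i, (i < k)%N -> ~~ near (w k) (w i)) (clear k w).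
Proof.
apply: (iffP allP) => h j; last by rewrite mem_iota add0n => /h.
by move=> jk; apply: h; rewrite mem_iota add0n.
Qed.

Lemma measurable_clear k : measurable_fun setT (fun w : traj => clear k w).
Proof.
apply: measurable_all => j.
by apply: measurable_neg; apply: (measurable_near mnear); exact: measurable_coord.
Qed.

(** The coordinates 0 to k - 1 are the sample, k is the marked point, and those
after k form an independent fresh sample. *)
Definition fresh (k : nat) (w : nat -> T) : nat -> T := fun j => w (k.+1 + j)%N.

(** The sample conditioned to avoid the neighbourhood of the marked point, rebuilt
from the fresh sample: a fresh point is used unless it is near the marked point.
Given clear k w this has the law of the sample itself, by hybrid_exchange. *)
Definition repl (k : nat) (w : nat -> T) (i : nat) : T :=
  if near (w k) (fresh k w i) then w i else fresh k w i.

(** Interpolates between the sample (m = 0) and repl (m = k); one swap leads from m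
to m + 1. *)
Definition hybrid (k m : nat) (w : nat -> T) : nat -> T :=
  fun i => if (i < m)%N then repl k w i else if (i < k)%N then w i else point.

Lemma measurable_repl k i : measurable_fun setT (fun w : traj => repl k w i).
Proof.
apply: measurable_fun_if => //.
- by apply: (measurable_near mnear); exact: measurable_coord.
- apply: measurable_funTS; exact: measurable_coord.
- apply: measurable_funTS; exact: (measurable_coord (k.+1 + i)).
Qed.

Lemma measurable_hybrid k m : measurable_fun setT (hybrid k m : traj -> traj).
Proof.
apply: measurable_traj => i; rewrite /hybrid; case: (i < m)%N.
  exact: measurable_repl.
by case: (i < k)%N; [exact: measurable_coord|exact: measurable_cst].
Qed.

Definition swap_inv (k : nat) (F : traj -> traj -> R) := forall w z j, (j < k)%N ->
  ~~ near (w k) (w j) -> ~~ near (w k) (fresh k w j) ->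
  F (w \o swapn j (k.+1 + j)) z = F w z.

(** When both the sample point m and the fresh point m avoid the neighbourhood of
the marked point, swapping them preserves the law, the event clear k w and the
factor F, and turns hybrid m + 1 into hybrid m. Otherwise the two hybrids agree. *)
Lemma hybrid_exchange k (F : traj -> traj -> R) m :
  measurable_fun setT (fun p : traj * traj => F p.1 p.2) ->
  (forall w z, 0 <= F w z) -> swap_inv k F -> (m <= k)%N ->
  (\int[Q]_w ((clear k w)%:R * F w (hybrid k m w))%:E =
   \int[Q]_w ((clear k w)%:R * F w (hybrid k 0 w))%:E)%E.
Proof.
move=> mF F0 sF; elim: m => // m ih mk.
rewrite -ih; last exact: ltnW.
pose far (w : traj) := ~~ near (w k) (fresh k w m).
have mfar : measurable_fun setT far.
  by apply: measurable_neg; apply: (measurable_near mnear); exact: measurable_coord.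
have mFh n : measurable_fun setT (fun w : traj => F w (hybrid k n w)).
  have mp : measurable_fun setT (fun w : traj => (w, hybrid k n w : traj)).
    by apply: measurable_fun_pair => //; exact: measurable_hybrid.
  exact: (measurableT_comp mF mp).
have mc : measurable_fun setT (fun w : traj => (clear k w)%:R : R).
  by apply: measurable_natb; exact: measurable_clear.
have mfR : measurable_fun setT (fun w : traj => (far w)%:R : R) by exact: measurable_natb.
have mnR : measurable_fun setT (fun w : traj => (~~ far w)%:R : R).
  by apply: measurable_natb; exact: measurable_neg.
have split n : (\int[Q]_w ((clear k w)%:R * F w (hybrid k n w))%:E =
    \int[Q]_w ((far w)%:R * ((clear k w)%:R * F w (hybrid k n w)))%:E +
    \int[Q]_w ((~~ far w)%:R * ((clear k w)%:R * F w (hybrid k n w)))%:E)%E.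
  rewrite -ge0_integralD//.
  - apply: eq_integral => w _; rewrite -EFinD -mulrDl.
    by case: (far w) => /=; rewrite ?addr0 ?add0r mul1r.
  - by move=> w _; rewrite lee_fin !mulr_ge0.
  - by apply/measurable_EFinP; do 2 apply: measurable_funM => //.
  - by move=> w _; rewrite lee_fin !mulr_ge0.
  - by apply/measurable_EFinP; do 2 apply: measurable_funM => //.
rewrite (split m.+1) (split m); congr (_ + _)%E; last first.
  apply: eq_integral => w _; congr (_%:E).
  case: (boolP (far w)) => [_|nf]; first by rewrite !mul0r.
  congr (_ * (_ * F _ _)); apply/funext => i; rewrite /hybrid ltnS leq_eqVlt.
  case: eqP => [->|_] //=; rewrite ltnn mk /repl.
  by move: nf; rewrite negbK => ->.
have := iid_swap Qiid m (k.+1 + m) (F := fun w =>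
  ((far w)%:R * ((clear k w)%:R * F w (hybrid k m.+1 w)))%:E).
rewrite /= => <-; last 2 first.
- by apply/measurable_EFinP; do 2 apply: measurable_funM => //.
- by move=> w; rewrite lee_fin !mulr_ge0.
apply: eq_integral => w _; congr (_%:E).
set w' := w \o swapn m (k.+1 + m).
have ltk i j : (i < k)%N -> (i < k.+1 + j)%N.
  by move=> ik; rewrite addSn ltnS (leq_trans (ltnW ik))// leq_addr.
have w'k : w' k = w k.
  by rewrite /w' /= /swapn (gtn_eqF mk) ltn_eqF// leq_addr.
have w'm : w' m = fresh k w m by rewrite /w' /= /swapn eqxx.
have w'f : fresh k w' m = w m.
  rewrite /fresh /w' /= /swapn eqxx gtn_eqF//.
  exact: ltk.
have w'i i : (i < k)%N -> i != m -> w' i = w i.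
  move=> ik im; rewrite /w' /= /swapn (negbTE im) ltn_eqF//.
  exact: ltk.
have w'fi i : i != m -> fresh k w' i = fresh k w i.
  move=> im; rewrite /fresh /w' /= /swapn eqn_add2l (negbTE im) gtn_eqF//.
  exact: ltk.
have e1 : (far w')%:R * (clear k w')%:R = (far w)%:R * (clear k w)%:R :> R.
  rewrite -!natrM !mulnb; congr (nat_of_bool _)%:R.
  apply/idP/idP => /andP[]; rewrite /far w'k w'f => h /clearP hc.
    apply/andP; split; first by have := hc _ mk; rewrite w'k w'm.
    apply/clearP => i ik; have [->|im] := eqVneq i m; first by [].
    by have := hc _ ik; rewrite w'k w'i.
  apply/andP; split; first exact: hc.
  apply/clearP => i ik; rewrite w'k; have [->|im] := eqVneq i m; first by rewrite w'm.
  by rewrite w'i// hc.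
rewrite !mulrA e1; case: (boolP (far w)) => [fw|]; last by rewrite !mul0r.
case: (boolP (clear k w)) => [/clearP cw|]; last by rewrite mulr0 !mul0r.
congr (_ * _); rewrite sF//; last exact: cw.
congr (F w _); apply/funext => i; rewrite /hybrid ltnS leq_eqVlt.
case: (eqVneq i m) => [->|im] /=.
  rewrite /repl w'f w'k w'm ltnn mk.
  by rewrite (negbTE (cw _ mk)).
case: (ltnP i m) => [lim|_].
  by rewrite /repl w'k w'fi// w'i// (ltn_trans lim mk).
by case: ifP => // ik; rewrite w'i.
Qed.

(** On clear k w, the ways in which the fresh and the replaced sample can count
differently: the point i was replaced and is isolated in one of them
(dev_fresh_near, dev_repl_near); i lost its neighbours by replacement
(dev_repl_ring) or got one (dev_fresh_hit); the extra fresh point is isolated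
(dev_last) or spoils an isolated one (dev_last_hit). *)
Definition dev_fresh_near k i (w : nat -> T) : bool :=
  [&& clear k w, near (w k) (fresh k w i) & iso k (fresh k w) i].
Definition dev_repl_near k i (w : nat -> T) : bool :=
  [&& clear k w, near (w k) (fresh k w i) & iso k (repl k w) i].
Definition dev_repl_ring k i (w : nat -> T) : bool :=
  [&& clear k w, ~~ near (w k) (repl k w i), near2 (w k) (repl k w i)
    & iso k (repl k w) i].
Definition dev_fresh_hit k i j (w : nat -> T) : bool :=
  [&& clear k w, j != i, near (w k) (fresh k w j), near (fresh k w i) (w j)
    & iso k (fresh k w) i].
Definition dev_last k (w : nat -> T) : bool := clear k w && iso k.+1 (fresh k w) k.
Definition dev_last_hit k i (w : nat -> T) : bool :=
  [&& clear k w, near (fresh k w i) (fresh k w k) & iso k (fresh k w) i].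

(** The number of discrepancies between the counts for the fresh sample with k + 1
points and for the replaced sample with k points. *)
Definition devcount k (w : nat -> T) : nat :=
  (\sum_(0 <= i < k) (dev_fresh_near k i w + dev_repl_near k i w + dev_repl_ring k i w +
     \sum_(0 <= j < k) dev_fresh_hit k i j w) + (dev_last k w + \sum_(0 <= i < k) dev_last_hit k i w))%N.

(** If the index i is isolated in one sample only, then i itself or a point near it
was replaced. A fresh neighbour of i that was replaced is near both i and the marked
point, so i is then in the ring around the latter. *)
Lemma iso_repl_fresh k w i : clear k w -> (i < k)%N ->
  (iso k (fresh k w) i <= iso k (repl k w) i +
    (dev_fresh_near k i w + dev_repl_near k i w + dev_repl_ring k i w + \sum_(0 <= j < k) dev_fresh_hit k i j w) /\
  iso k (repl k w) i <= iso k (fresh k w) i +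
    (dev_fresh_near k i w + dev_repl_near k i w + dev_repl_ring k i w + \sum_(0 <= j < k) dev_fresh_hit k i j w))%N.
Proof.
move=> cw ik; have [nx|nx] := boolP (near (w k) (fresh k w i)).
  rewrite /dev_fresh_near /dev_repl_near cw nx /=.
  by case: (iso k (fresh k w) i); case: (iso k (repl k w) i).
have ri : repl k w i = fresh k w i by rewrite /repl (negbTE nx).
split.
  case: (boolP (iso k (fresh k w) i)) => //= hX.
  case: (boolP (iso k (repl k w) i)) => //= /isoP hX'.
  rewrite add0n addn_gt0 big_mkord; apply/orP; right.
  apply: contrapT => s0; apply: hX' => j jk ji; apply/negP => nij; apply: s0.
  rewrite (bigD1 (Ordinal jk))//= addn_gt0; apply/orP; left.
  rewrite /dev_fresh_hit cw ji hX andbT /=.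
  move: nij; rewrite ri /repl; case: ifP => [_ -> //|_].
  by move/isoP: hX => /(_ j jk ji) /negbTE ->.
case: (boolP (iso k (repl k w) i)) => //= hX'.
case: (boolP (iso k (fresh k w) i)) => //= hX.
rewrite /dev_repl_ring cw ri nx hX' /=.
suff -> : near2 (w k) (fresh k w i) by rewrite addn_gt0 addnS.
apply: contrapT => n2; move/isoP: hX; apply => j jk ji; apply/negP => nij.
have [nxj|nxj] := boolP (near (w k) (fresh k w j)).
  exact: n2 (near_near2 nxj nij).
move/isoP: hX' => /(_ j jk ji); rewrite ri /repl (negbTE nxj).
by rewrite nij.
Qed.

Lemma isocountS k w : (isocount k.+1 w =
  iso k.+1 w k + \sum_(0 <= i < k) (iso k w i && ~~ near (w i) (w k)))%N.
Proof.
rewrite /isocount big_nat_recr//= addnC; congr (_ + _)%N.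
apply: eq_big_nat => i /andP[_ ik]; congr nat_of_bool.
by rewrite /iso -[k.+1 in LHS]addn1 iotaD all_cat /= add0n gtn_eqF//= andbT.
Qed.

(** The fresh sample is taken with one more point, of index k, so that its count has
the law of the count of k + 1 points; devcount also pays for that point. *)
Lemma isocount_repl k w : clear k w ->
  (isocount k (repl k w) <= isocount k.+1 (fresh k w) + devcount k w /\
   isocount k.+1 (fresh k w) <= isocount k (repl k w) + devcount k w)%N.
Proof.
move=> cw; set Y := fresh k w.
have h i : (i < k)%N -> _ := iso_repl_fresh cw (i := i).
have e6 i : (i < k)%N -> (iso k Y i = (iso k Y i && ~~ near (Y i) (Y k)) + dev_last_hit k i w :> nat)%N.
  by move=> ik; rewrite /dev_last_hit cw -/Y /=; case: (iso k Y i); case: (near _ _).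
rewrite isocountS /devcount /dev_last cw /= -/Y; set A := (iso k.+1 Y k : nat).
rewrite /isocount; set sr := (\sum_(0 <= i < k) iso k (repl k w) i)%N.
have hb : (\sum_(0 <= i < k) iso k Y i = \sum_(0 <= i < k) (iso k Y i && ~~ near (Y i) (Y k)) +
   \sum_(0 <= i < k) dev_last_hit k i w)%N.
  by rewrite -big_split /=; apply: eq_big_nat => i /andP[_ ik]; exact: e6.
set s6 := (\sum_(0 <= i < k) dev_last_hit k i w)%N in hb *.
set sn := (\sum_(0 <= i < k) (iso k Y i && ~~ near (Y i) (Y k)))%N in hb *.
set sd := (\sum_(0 <= i < k) (_ + _ + _ + _))%N.
have h1 : (\sum_(0 <= i < k) iso k Y i <= \sum_(0 <= i < k) iso k (repl k w) i + sd)%N.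
  rewrite -big_split /= big_nat_cond [leqRHS]big_nat_cond; apply: leq_sum => i.
  by rewrite andbT => /andP[_ /h[]].
have h2 : (\sum_(0 <= i < k) iso k (repl k w) i <= \sum_(0 <= i < k) iso k Y i + sd)%N.
  rewrite -big_split /= big_nat_cond [leqRHS]big_nat_cond; apply: leq_sum => i.
  by rewrite andbT => /andP[_ /h[]].
have h3 : (sr <= sn + s6 + sd)%N by rewrite -hb.
have h4 : (sn + s6 <= sr + sd)%N by rewrite -hb.
by clearbody sr s6 sn sd A; lia.
Qed.

(** For balls of radius r this is q(x) = nu (B x). *)
Definition near_pr (x : T) : R := pr [set z | near x z].
Definition near_pr2 (x y : T) : R := pr [set z | near x z || near y z].

Lemma measurable_bset (b : T -> bool) : measurable_fun setT b -> measurable [set z | b z].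
Proof. by move=> mb; rewrite -[X in measurable X]setTI; exact: (mb measurableT [set true]). Qed.

Lemma measurable_near1 x : measurable_fun setT (near x).
Proof. by apply: (measurable_near mnear) => //; exact: measurable_cst. Qed.

Lemma measurable_pr d' (Om : measurableType d') (b : Om -> T -> bool) :
  measurable_fun setT (fun p : Om * T => b p.1 p.2) ->
  measurable_fun setT (fun x => pr [set z | b x z]).
Proof.
move=> mb.
have mA : measurable [set p : Om * T | b p.1 p.2].
  by rewrite -[X in measurable X]setTI; exact: (mb measurableT [set true]).
have h := measurableT_comp (@fine_measurable R setT measurableT) (measurable_fun_xsection nu mA).
apply: (eq_measurable_fun _ _ h) => x _ /=.
rewrite /pr; congr (fine (nu _)); rewrite /xsection; apply/seteqP; split => z /=.
  by rewrite inE.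
by rewrite inE.
Qed.

Lemma measurable_near_pr : measurable_fun setT near_pr.
Proof. exact: measurable_pr. Qed.

Lemma measurable_near_pr2 : measurable_fun setT (fun p : T * T => near_pr2 p.1 p.2).
Proof.
apply: (@measurable_pr _ _ (fun (p : T * T) z => near p.1 z || near p.2 z)).
apply: measurable_or; apply: (measurable_near mnear); try exact: measurable_snd.
  by apply: measurableT_comp; exact: measurable_fst.
by apply: measurableT_comp; [exact: measurable_snd|exact: measurable_fst].
Qed.

Lemma mset_near x : measurable [set z | near x z].
Proof. by apply: measurable_bset; exact: measurable_near1. Qed.

Lemma mset_near2 x y : measurable [set z | near x z || near y z].
Proof. by apply: measurable_bset; apply: measurable_or; exact: measurable_near1. Qed.

Lemma near_pr_ge0 x : 0 <= near_pr x. Proof. exact: pr_ge0. Qed.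
Lemma near_pr_le1 x : near_pr x <= 1. Proof. by apply: pr_le1; exact: mset_near. Qed.
Lemma near_pr2_ge0 x y : 0 <= near_pr2 x y. Proof. exact: pr_ge0. Qed.
Lemma near_pr2_le1 x y : near_pr2 x y <= 1. Proof. by apply: pr_le1; exact: mset_near2. Qed.

Lemma pr_far x : pr [set z | ~~ near x z] = 1 - near_pr x.
Proof.
rewrite -prC; last exact: mset_near.
by congr pr; apply/seteqP; split => z /=; [move/negP|move=> /negP].
Qed.

Lemma pr_far2 x y : pr [set z | ~~ near x z && ~~ near y z] = 1 - near_pr2 x y.
Proof.
rewrite -prC; last exact: mset_near2.
congr pr; apply/seteqP; split => z /=; rewrite -negb_or; first by move/negP.
by move=> /negP.
Qed.

Lemma near_pr2_disjoint x y : ~~ near2 x y -> near_pr2 x y = near_pr x + near_pr y.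
Proof.
move=> n2; apply: EFin_inj; rewrite /near_pr2 /near_pr EFinD.
rewrite -(prE (mset_near2 x y)) -(prE (mset_near x)) -(prE (mset_near y)).
rewrite -measureU; [|exact: mset_near|exact: mset_near|].
  by congr (nu _); apply/seteqP; split => z /= /orP.
apply/seteqP; split => // z [/= xz yz].
by rewrite (near_near2 xz yz) in n2.
Qed.

Lemma far2_le x y : ~~ near2 x y -> 1 - near_pr2 x y <= (1 - near_pr x) * (1 - near_pr y).
Proof.
by move=> /near_pr2_disjoint ->; have := near_pr_ge0 x; have := near_pr_ge0 y; nra.
Qed.

Definition kern (c : T -> T -> R) := measurable_fun setT (fun p : T * T => c p.1 p.2) /\
  forall x y, 0 <= c x y.

Definition pair_int (c : T -> T -> R) : \bar R := (\int[nu \x nu]_p (c p.1 p.2)%:E)%E.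

Lemma J_ge0 c : kern c -> (0 <= pair_int c)%E.
Proof. by move=> [_ c0]; apply: integral_ge0 => p _; rewrite lee_fin. Qed.

Lemma kernD c c' : kern c -> kern c' -> kern (fun x y => c x y + c' x y).
Proof.
move=> [mc c0] [mc' c0']; split; first exact: measurable_funD.
by move=> x y; rewrite addr_ge0.
Qed.

Lemma kernM c c' : kern c -> kern c' -> kern (fun x y => c x y * c' x y).
Proof.
move=> [mc c0] [mc' c0']; split; first exact: measurable_funM.
by move=> x y; rewrite mulr_ge0.
Qed.

Lemma kern_cst (a : R) : 0 <= a -> kern (fun _ _ => a).
Proof. by move=> a0; split => //; exact: measurable_cst. Qed.

Lemma kernX c n : kern c -> kern (fun x y => c x y ^+ n).
Proof.
move=> [mc c0]; split; first exact: measurable_funX.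
by move=> x y; rewrite exprn_ge0.
Qed.

Lemma kern_fst (f : T -> R) : measurable_fun setT f -> (forall x, 0 <= f x) ->
  kern (fun x _ => f x).
Proof.
move=> mf f0; split => [|x _]; last exact: f0.
by apply: measurableT_comp mf _; exact: measurable_fst.
Qed.

Lemma kern_snd (f : T -> R) : measurable_fun setT f -> (forall x, 0 <= f x) ->
  kern (fun _ y => f y).
Proof.
move=> mf f0; split => [|_ y]; last exact: f0.
by apply: measurableT_comp mf _; exact: measurable_snd.
Qed.

Lemma kern_bool (b : T -> T -> bool) : measurable_fun setT (fun p : T * T => b p.1 p.2) ->
  kern (fun x y => (b x y)%:R).
Proof. by move=> mb; split; [exact: measurable_natb|move=> x y; exact: ler0n]. Qed.

Lemma JD c c' : kern c -> kern c' -> pair_int (fun x y => c x y + c' x y) = (pair_int c + pair_int c')%E.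
Proof.
move=> [mc c0] [mc' c0']; rewrite /pair_int -ge0_integralD//.
- by move=> p _; rewrite lee_fin.
- exact/measurable_EFinP.
- by move=> p _; rewrite lee_fin.
- exact/measurable_EFinP.
Qed.

Lemma JZ (a : R) c : 0 <= a -> kern c -> pair_int (fun x y => a * c x y) = (a%:E * pair_int c)%E.
Proof.
move=> a0 [mc c0]; rewrite /pair_int -ge0_integralZl//.
- exact/measurable_EFinP.
- by move=> p _; rewrite lee_fin.
Qed.

Lemma J_le c c' : kern c -> kern c' -> (forall x y, c x y <= c' x y) -> (pair_int c <= pair_int c')%E.
Proof.
move=> [mc c0] [mc' c0'] h; apply: ge0_le_integral => //.
- by move=> p _; rewrite lee_fin.
- exact/measurable_EFinP.
- exact/measurable_EFinP.
- by move=> p _; rewrite lee_fin.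
Qed.

Definition both_far x y : R := (1 - near_pr x) * (1 - near_pr y).

Lemma both_far_ge0 x y : 0 <= both_far x y.
Proof. by rewrite mulr_ge0// subr_ge0 near_pr_le1. Qed.

Lemma both_far_le1 x y : both_far x y <= 1.
Proof. by rewrite mulr_ile1// ?subr_ge0 ?near_pr_le1// gerBl near_pr_ge0. Qed.

Lemma kern_near_prx : kern (fun x _ => near_pr x).
Proof. by apply: kern_fst; [exact: measurable_near_pr|exact: near_pr_ge0]. Qed.

Lemma kern_near_pry : kern (fun _ y => near_pr y).
Proof. by apply: kern_snd; [exact: measurable_near_pr|exact: near_pr_ge0]. Qed.

Lemma kern_far2 : kern (fun x y => 1 - near_pr2 x y).
Proof.
split; first by apply: measurable_funB => //; exact: measurable_near_pr2.
by move=> x y; rewrite subr_ge0 near_pr2_le1.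
Qed.

Lemma kern_both_far : kern both_far.
Proof.
have mn : measurable_fun setT (fun x => 1 - near_pr x).
  by apply: measurable_funB => //; exact: measurable_near_pr.
have n0 x : 0 <= 1 - near_pr x by rewrite subr_ge0 near_pr_le1.
by apply: kernM; [exact: kern_fst|exact: kern_snd].
Qed.

(** Pairs that are not neighbours, but whose neighbourhoods may meet. *)
Definition ring2 x y : bool := ~~ near x y && near2 x y.

Lemma kern_near : kern (fun x y => (near x y)%:R).
Proof. exact: kern_bool. Qed.

Lemma kern_ring2 : kern (fun x y => (ring2 x y)%:R).
Proof. by apply: kern_bool; apply: measurable_and => //; exact: measurable_neg. Qed.

(** The form of two_point used below: the other coordinates are the sample (EY), the
fresh sample (EX) and the last fresh point (EL), and the first of the two fixed
points is the marked one. *)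
Lemma two_point_blocks k b (e : traj -> bool) (G : T -> T -> bool)
    (EY EX : nat -> T -> T -> T -> bool) (EL : T -> T -> T -> bool) (c : T -> T -> R) :
  b != k -> measurable_fun setT e ->
  (forall j x y, measurable_fun setT (EY j x y)) ->
  (forall j x y, measurable_fun setT (EX j x y)) ->
  (forall x y, measurable_fun setT (EL x y)) ->
  (forall w, e w -> [/\ G (w k) (w b),
     forall j, (j < k)%N -> j != b -> EY j (w k) (w b) (w j),
     forall j, (j < k)%N -> (k.+1 + j)%N != b -> EX j (w k) (w b) (fresh k w j) &
     (k.+1 + k)%N != b -> EL (w k) (w b) (fresh k w k)]) ->
  kern c ->
  (forall x y, G x y ->
     (\prod_(0 <= j < k) (if j == b then 1 else pr [set z | EY j x y z])) *
     ((\prod_(0 <= j < k) (if (k.+1 + j)%N == b then 1 else pr [set z | EX j x y z])) *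
      (if (k.+1 + k)%N == b then 1 else pr [set z | EL x y z])) <= c x y) ->
  (\int[Q]_w ((e w)%:R)%:E <= pair_int c)%E.
Proof.
move=> bk me mEY mEX mEL eE [mc c0] hc.
pose E m x y z := if (m < k)%N then EY m x y z else
  if (m == k.+1 + k)%N then EL x y z else EX (m - k.+1)%N x y z.
have Ek j : (j < k)%N -> E (k.+1 + j)%N = EX j.
  move=> jk; rewrite /E ltnNge (leq_trans (leqnSn k) (leq_addr _ _)) /=.
  by rewrite eqn_add2l (ltn_eqF jk) addnC addnK.
apply: (two_point (a := k) (b := b) (N := (k.+1 + k.+1)%N) (G := G) (E := E)) => //.
- by rewrite eq_sym.
- move=> m x y; apply: measurable_bset; rewrite /E.
  by case: (m < k)%N => //; case: (m == _).
- move=> w /eE[Gw hY hX hL]; split => // m mN mk mb.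
  rewrite /E; case: (ltnP m k) => [ltmk|]; first exact: hY.
  rewrite leq_eqVlt eq_sym (negbTE mk) /= => km.
  case: (eqVneq m (k.+1 + k)%N) => [e1|ne]; first by rewrite e1; apply: hL; rewrite -e1.
  have := hX (m - k.+1)%N; rewrite /fresh subnKC//; apply => //.
  by rewrite ltn_subLR//; move: mN ne; rewrite addnS ltnS leq_eqVlt => /orP[/eqP->|//]; rewrite eqxx.
- move=> x y Gxy; apply: le_trans (hc x y Gxy).
  rewrite prod_two_blocks eqxx /= mulr1.
  rewrite le_eqVlt; apply/orP; left; apply/eqP; congr (_ * (_ * _)).
  + apply: eq_big_nat => j /andP[_ jk]; rewrite (ltn_eqF jk) /=.
    by case: eqP => // _; rewrite /E jk.
  + apply: eq_big_nat => j /andP[_ jk]; rewrite gtn_eqF; last by rewrite addSn ltnS leq_addr.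
    by case: eqP => //= _; rewrite Ek.
  + rewrite gtn_eqF; last by rewrite addSn ltnS leq_addr.
    case: eqP => //= _; rewrite /E eqxx ltnNge (leq_trans (leqnSn k)) ?leq_addr//.
Qed.

Lemma measurable_isof k i d' (Om : measurableType d') (f : Om -> traj) :
  measurable_fun setT f -> measurable_fun setT (fun w => iso k (f w) i).
Proof. by move=> mf; apply: (measurableT_comp (measurable_iso k i) mf). Qed.

Lemma measurable_replT k : measurable_fun setT (repl k : traj -> traj).
Proof. by apply: measurable_traj => i; exact: measurable_repl. Qed.

Lemma measurable_fresh k : measurable_fun setT (fresh k : traj -> traj).
Proof. exact: measurable_drop_traj. Qed.

Lemma mnear_coord i j : measurable_fun setT (fun w : traj => near (w i) (w j)).
Proof. by apply: (measurable_near mnear); exact: measurable_coord. Qed.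

Let prtrue : pr [set _ | true] = 1.
Proof. by rewrite -prT; congr pr; apply/seteqP; split. Qed.

Let mfar1 x : measurable_fun setT (fun z => ~~ near x z).
Proof. by apply: measurable_neg; exact: measurable_near1. Qed.

Let expr_far x n m : (m <= n)%N -> (1 - near_pr x) ^+ n <= (1 - near_pr x) ^+ m.
Proof.
by move=> mn; rewrite ler_wiXn2l// ?subr_ge0 ?near_pr_le1// gerBl near_pr_ge0.
Qed.

Let far_ge0 x n : 0 <= (1 - near_pr x) ^+ n.
Proof. by rewrite exprn_ge0// subr_ge0 near_pr_le1. Qed.

Let shiftk_neq k i : (k.+1 + i)%N != k.
Proof. by rewrite gtn_eqF// addSn ltnS leq_addr. Qed.

Let neq_shiftk k i j : (j < k)%N -> (j == k.+1 + i)%N = false.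
Proof. by move=> jk; rewrite ltn_eqF// addSn ltnS (leq_trans (ltnW jk))// leq_addr. Qed.

Let neqk_shiftk k i j : (j < k)%N -> (k.+1 + i == j)%N = false.
Proof. by move=> jk; rewrite eq_sym neq_shiftk. Qed.

Lemma prod_cst (x : R) k (F : nat -> R) : (forall j, (j < k)%N -> F j = x) ->
  \prod_(0 <= j < k) F j = x ^+ k.
Proof.
move=> h; rewrite (eq_big_nat _ _ (F2 := fun=> x)); last by move=> j /andP[_]; exact: h.
by rewrite prodr_const_nat subn0.
Qed.

Lemma dev_fresh_near_bound k i : (i < k)%N -> (\int[Q]_w ((dev_fresh_near k i w)%:R)%:E <=
  pair_int (fun x y => (near x y)%:R * both_far x y ^+ k.-1)%R)%E.
Proof.
move=> ik; apply: (two_point_blocks (k := k) (b := (k.+1 + i)%N) (G := near)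
  (EY := fun _ x _ z => ~~ near x z) (EX := fun _ _ y z => ~~ near y z)
  (EL := fun _ _ _ => true)) => //.
- apply: measurable_and; first exact: measurable_clear.
  apply: measurable_and; first exact: (mnear_coord k (k.+1 + i)).
  by apply: measurable_isof; exact: measurable_fresh.
- move=> w /and3P[/clearP cw nx /isoP h]; split => // [j jk _|j jk ji]; first exact: cw.
  by apply: h => //; rewrite eqn_add2l in ji.
- by apply: kernM; [exact: kern_near|apply: kernX; exact: kern_both_far].
- move=> x y Gxy; rewrite Gxy mul1r eqn_add2l (gtn_eqF ik) prtrue mulr1.
  rewrite (prod_cst (x := 1 - near_pr x)); last by move=> j jk; rewrite neq_shiftk// pr_far.
  rewrite (eq_bigr (fun j => if j == i then 1 else 1 - near_pr y)); last first.
    by move=> j _; rewrite eqn_add2l pr_far.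
  by rewrite prod_except1// mul1r /both_far exprMn ler_wpM2r// expr_far// leq_pred.
Qed.

(** The replaced sample is first exchanged for the original one, for which the
points are independent. If x and y are in the ring, both are isolated with
probability (1 - near_pr2 x y)^(k-1); otherwise their neighbourhoods are disjoint
and far2_le applies. *)
Lemma dev_repl_near_bound k i : (i < k)%N -> (\int[Q]_w ((dev_repl_near k i w)%:R)%:E <=
  pair_int (fun x y => (ring2 x y)%:R * (1 - near_pr2 x y) ^+ k.-1 + near_pr x * both_far x y ^+ k.-1)%R)%E.
Proof.
move=> ik.
pose F (w z : traj) : R := (near (w k) (fresh k w i) && iso k z i)%:R.
have mF : measurable_fun setT (fun p : traj * traj => F p.1 p.2).
  apply: measurable_natb; apply: measurable_and.
    apply: (measurableT_comp (mnear_coord k (k.+1 + i))); exact: measurable_fst.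
  by apply: measurable_isof; exact: measurable_snd.
have sF : swap_inv k F.
  move=> w z j jk nw nf; rewrite /F; congr ((_ && _)%:R).
  rewrite /fresh /= /swapn (gtn_eqF jk) (ltn_eqF (m := k)) ?addSn ?ltnS ?leq_addr//.
  rewrite -addSn neqk_shiftk// eqn_add2l; case: eqP => // ->.
  by rewrite (negbTE nw); move: nf; rewrite /fresh => /negbTE ->.
have := hybrid_exchange mF _ sF (leqnn k); move=> /(_ (fun w z => ler0n _ _)) e.
rewrite (_ : (\int[Q]_w _)%E = (\int[Q]_w ((clear k w)%:R * F w (hybrid k 0 w))%:E)%E); last first.
  rewrite -e; apply: eq_integral => w _; rewrite -natrM mulnb /dev_repl_near /F.
  congr ((_ && (_ && _))%:R%:E); apply: iso_ext => // j jk.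
  by rewrite /hybrid jk.
under eq_integral do rewrite /F -natrM mulnb.
apply: (two_point_blocks (k := k) (b := i) (G := fun x y => ~~ near x y)
  (EY := fun _ x y z => ~~ near x z && ~~ near y z)
  (EX := fun j x _ z => (j == i) ==> near x z)
  (EL := fun _ _ _ => true)) => //.
- by rewrite ltn_eqF.
- apply: measurable_and; first exact: measurable_clear.
  apply: measurable_and; first exact: (mnear_coord k (k.+1 + i)).
  by apply: measurable_isof; exact: measurable_hybrid.
- by move=> _ x y; exact: measurable_and.
- by move=> j x _; case: eqP => //= _; exact: measurable_near1.
- move=> w /and3P[/clearP cw nx /isoP h]; split => //.
  + exact: cw.
  + move=> j jk ji; rewrite cw//=; have := h j jk ji.
    by rewrite /hybrid /= ik jk.
  + by move=> j _ _; apply/implyP => /eqP ->.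
- apply: kernD; apply: kernM.
  + exact: kern_ring2.
  + by apply: kernX; exact: kern_far2.
  + exact: kern_near_prx.
  + by apply: kernX; exact: kern_both_far.
- move=> x y nxy; rewrite neqk_shiftk// prtrue mulr1.
  rewrite (eq_bigr (fun j => if j == i then 1 else 1 - near_pr2 x y)); last first.
    by move=> j _; rewrite pr_far2.
  rewrite [X in _ * X](eq_bigr (fun j => if j == i then near_pr x else 1)); last first.
    by move=> j _; rewrite neqk_shiftk//; case: eqP.
  rewrite !prod_except1// mul1r expr1n mulr1 /ring2 nxy /=.
  have u0 : 0 <= 1 - near_pr2 x y by rewrite subr_ge0 near_pr2_le1.
  case: (boolP (near2 x y)) => n2 /=.
    rewrite mul1r (le_trans (y := (1 - near_pr2 x y) ^+ k.-1))//.
      by rewrite ler_piMr ?exprn_ge0// near_pr_le1.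
    by rewrite lerDl mulr_ge0 ?near_pr_ge0// exprn_ge0// both_far_ge0.
  rewrite mul0r add0r mulrC ler_wpM2l ?near_pr_ge0//.
  by rewrite lerXn2r ?nnegrE ?both_far_ge0// far2_le.
Qed.

(** As above, the replaced sample is exchanged for the original one. *)
Lemma dev_repl_ring_bound k i : (i < k)%N -> (\int[Q]_w ((dev_repl_ring k i w)%:R)%:E <=
  pair_int (fun x y => (ring2 x y)%:R * (1 - near_pr2 x y) ^+ k.-1)%R)%E.
Proof.
move=> ik.
pose F (w z : traj) : R :=
  [&& ~~ near (w k) (z i), near2 (w k) (z i) & iso k z i]%:R.
have mw : measurable_fun setT (fun p : traj * traj => p.1 k).
  by apply: measurableT_comp (measurable_coord k) _; exact: measurable_fst.
have mz : measurable_fun setT (fun p : traj * traj => p.2 i).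
  by apply: measurableT_comp (measurable_coord i) _; exact: measurable_snd.
have mF : measurable_fun setT (fun p : traj * traj => F p.1 p.2).
  apply: measurable_natb; apply: measurable_and.
    by apply: measurable_neg; exact: (measurable_near mnear).
  apply: measurable_and; first exact: (measurable_near mnear2).
  by apply: measurable_isof; exact: measurable_snd.
have sF : swap_inv k F.
  move=> w z j jk nw nf; rewrite /F /= /swapn (gtn_eqF jk) (ltn_eqF (m := k))//.
  by rewrite addSn ltnS leq_addr.
have := hybrid_exchange mF _ sF (leqnn k).
move=> /(_ (fun w z => ler0n _ _)) e.
rewrite (_ : (\int[Q]_w _)%E = (\int[Q]_w ((clear k w)%:R * F w (hybrid k 0 w))%:E)%E); last first.
  rewrite -e; apply: eq_integral => w _; rewrite -natrM mulnb /dev_repl_ring /F.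
  have -> : iso k (hybrid k k w) i = iso k (repl k w) i.
    by apply: iso_ext => // j jk; rewrite /hybrid jk.
  by rewrite /hybrid ik.
under eq_integral do rewrite /F -natrM mulnb.
apply: (two_point_blocks (k := k) (b := i) (G := ring2)
  (EY := fun _ x y z => ~~ near x z && ~~ near y z)
  (EX := fun j x _ z => true)
  (EL := fun _ _ _ => true)) => //.
- by rewrite ltn_eqF.
- apply: measurable_and; first exact: measurable_clear.
  have mh : measurable_fun setT (fun w : traj => hybrid k 0 w i).
    by apply: measurableT_comp (measurable_coord i) _; exact: measurable_hybrid.
  apply: measurable_and.
    apply: measurable_neg; apply: (measurable_near mnear) => //.
    exact: measurable_coord.
  apply: measurable_and.
    by apply: (measurable_near mnear2) => //; exact: measurable_coord.
  by apply: measurable_isof; exact: measurable_hybrid.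
- by move=> _ x y; exact: measurable_and.
- move=> w /and4P[/clearP cw]; rewrite {1 2}/hybrid /= ik => nx n2 /isoP h; split => //.
  + by rewrite /ring2 nx n2.
  + move=> j jk ji; rewrite cw//=; have := h j jk ji.
    by rewrite /hybrid /= ik jk.
- apply: kernM; first exact: kern_ring2.
  by apply: kernX; exact: kern_far2.
- move=> x y ->; rewrite neqk_shiftk// prtrue mulr1 mul1r.
  rewrite (eq_bigr (fun j => if j == i then 1 else 1 - near_pr2 x y)); last first.
    by move=> j _; rewrite pr_far2.
  rewrite [X in _ * X](prod_cst (x := 1)); last by move=> j jk; rewrite neqk_shiftk// prtrue.
  by rewrite expr1n mulr1 prod_except1// mul1r.
Qed.

Lemma dev_fresh_hit_bound k i j : (i < k)%N -> (j < k)%N -> j != i ->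
  (\int[Q]_w ((dev_fresh_hit k i j w)%:R)%:E <=
  pair_int (fun x y => near_pr x * near_pr y * both_far x y ^+ k.-2)%R)%E.
Proof.
move=> ik jk ji; apply: (two_point_blocks (k := k) (b := (k.+1 + i)%N) (G := fun _ _ => true)
  (EY := fun m x y z => if m == j then near y z else ~~ near x z)
  (EX := fun m x y z => if m == j then near x z else ~~ near y z)
  (EL := fun _ _ _ => true)) => //.
- apply: measurable_and; first exact: measurable_clear.
  apply: measurable_and => //.
  apply: measurable_and; first exact: (mnear_coord k (k.+1 + j)).
  apply: measurable_and; first exact: (mnear_coord (k.+1 + i) j).
  by apply: measurable_isof; exact: measurable_fresh.
- by move=> m x y; case: (m == j) => //; exact: measurable_near1.
- by move=> m x y; case: (m == j) => //; exact: measurable_near1.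
- move=> w /and5P[/clearP cw _ nx ny /isoP h]; split => // m mk mi.
    by case: eqP => [->//|_]; exact: cw.
  case: eqP => [->//|_]; apply: h => //; by rewrite eqn_add2l in mi.
- apply: kernM; last by apply: kernX; exact: kern_both_far.
  by apply: kernM; [exact: kern_near_prx|exact: kern_near_pry].
- move=> x y _; rewrite eqn_add2l (gtn_eqF ik) prtrue mulr1.
  rewrite (eq_big_nat _ _ (F2 := fun m => if m == j then near_pr y else 1 - near_pr x)); last first.
    by move=> m /andP[_ mk]; rewrite neq_shiftk//; case: eqP => // _; rewrite pr_far.
  rewrite [X in _ * X](eq_bigr (fun m => if m == i then 1 else if m == j then near_pr x else 1 - near_pr y)); last first.
    move=> m _; rewrite eqn_add2l; case: eqP => // _.
    by case: eqP => // _; rewrite pr_far.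
  rewrite prod_except1// prod_except2//; last by rewrite eq_sym.
  rewrite mul1r /both_far exprMn.
  have -> : near_pr y * (1 - near_pr x) ^+ k.-1 * (near_pr x * (1 - near_pr y) ^+ k.-2) =
    near_pr x * near_pr y * ((1 - near_pr x) ^+ k.-1 * (1 - near_pr y) ^+ k.-2) by ring.
  rewrite ler_wpM2l ?mulr_ge0 ?near_pr_ge0// ler_wpM2r// expr_far//.
  by case: (k) => [|[|]].
Qed.

Lemma dev_last_bound k : (\int[Q]_w ((dev_last k w)%:R)%:E <=
  pair_int (fun x y => both_far x y ^+ k)%R)%E.
Proof.
apply: (two_point_blocks (k := k) (b := (k.+1 + k)%N) (G := fun _ _ => true)
  (EY := fun m x y z => ~~ near x z)
  (EX := fun m x y z => ~~ near y z)
  (EL := fun _ _ _ => true)) => //.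
- apply: measurable_and; first exact: measurable_clear.
  by apply: measurable_isof; exact: measurable_fresh.
- move=> w /andP[/clearP cw /isoP h]; split => // m mk mi; first exact: cw.
  by apply: h; [exact: ltnW|rewrite ltn_eqF].
- by apply: kernX; exact: kern_both_far.
- move=> x y _; rewrite eqxx mulr1.
  rewrite (prod_cst (x := 1 - near_pr x)); last by move=> m mk; rewrite neq_shiftk// pr_far.
  rewrite (prod_cst (x := 1 - near_pr y)); last first.
    by move=> m mk; rewrite eqn_add2l (ltn_eqF mk) pr_far.
  by rewrite -exprMn.
Qed.

Lemma dev_last_hit_bound k i : (i < k)%N -> (\int[Q]_w ((dev_last_hit k i w)%:R)%:E <=
  pair_int (fun x y => near_pr y * both_far x y ^+ k.-1)%R)%E.
Proof.
move=> ik; apply: (two_point_blocks (k := k) (b := (k.+1 + i)%N) (G := fun _ _ => true)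
  (EY := fun m x y z => ~~ near x z)
  (EX := fun m x y z => ~~ near y z)
  (EL := fun x y z => near y z)) => //.
- apply: measurable_and; first exact: measurable_clear.
  apply: measurable_and; first exact: (mnear_coord (k.+1 + i) (k.+1 + k)).
  by apply: measurable_isof; exact: measurable_fresh.
- by move=> x y; exact: measurable_near1.
- move=> w /and3P[/clearP cw nx /isoP h]; split => // m mk mi; first exact: cw.
  by apply: h => //; rewrite eqn_add2l in mi.
- by apply: kernM; [exact: kern_near_pry|apply: kernX; exact: kern_both_far].
- move=> x y _; rewrite eqn_add2l (gtn_eqF ik) -/(near_pr y).
  rewrite (prod_cst (x := 1 - near_pr x)); last by move=> m mk; rewrite neq_shiftk// pr_far.
  rewrite (eq_bigr (fun j => if j == i then 1 else 1 - near_pr y)); last first.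
    by move=> j _; rewrite eqn_add2l pr_far.
  rewrite prod_except1// mul1r mulrA mulrC ler_wpM2l ?near_pr_ge0// /both_far exprMn.
  by rewrite ler_wpM2r// expr_far// leq_pred.
Qed.

(** The sum over pairs of the bounds on the terms of devcount, times the sample
size; the binomial-like coefficients count the choices of indices. *)
Definition errk (n : nat) (x y : T) : R :=
  (n ^_ 2)%:R * ((near x y)%:R * both_far x y ^+ n.-2
     + 2 * ((ring2 x y)%:R * (1 - near_pr2 x y) ^+ n.-2)
     + (near_pr x + near_pr y) * both_far x y ^+ n.-2)
  + (n ^_ 3)%:R * (near_pr x * near_pr y * both_far x y ^+ n.-1.-2)
  + n%:R * both_far x y ^+ n.-1.

Lemma kern_errk n : kern (errk n).
Proof.
have kX m : kern (fun x y => both_far x y ^+ m) by apply: kernX; exact: kern_both_far.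
have kc (m : nat) : kern (fun _ _ => m%:R) by exact: kern_cst.
apply: kernD; [apply: kernD|]; apply: kernM => //.
- apply: kernD; [apply: kernD|].
  + by apply: kernM => //; exact: kern_near.
  + apply: kernM => //; apply: kernM; first exact: kern_ring2.
    by apply: kernX; exact: kern_far2.
  + by apply: kernM => //; apply: kernD; [exact: kern_near_prx|exact: kern_near_pry].
- by apply: kernM => //; apply: kernM; [exact: kern_near_prx|exact: kern_near_pry].
Qed.

Lemma measurable_dev_fresh_near k i : measurable_fun setT (dev_fresh_near k i : traj -> bool).
Proof.
apply: measurable_and; first exact: measurable_clear.
apply: measurable_and; first exact: (mnear_coord k (k.+1 + i)).
by apply: measurable_isof; exact: measurable_fresh.
Qed.

Lemma measurable_dev_repl_near k i : measurable_fun setT (dev_repl_near k i : traj -> bool).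
Proof.
apply: measurable_and; first exact: measurable_clear.
apply: measurable_and; first exact: (mnear_coord k (k.+1 + i)).
by apply: measurable_isof; exact: measurable_replT.
Qed.

Lemma measurable_dev_repl_ring k i : measurable_fun setT (dev_repl_ring k i : traj -> bool).
Proof.
apply: measurable_and; first exact: measurable_clear.
apply: measurable_and.
  apply: measurable_neg; apply: (measurable_near mnear); first exact: measurable_coord.
  exact: measurable_repl.
apply: measurable_and.
  by apply: (measurable_near mnear2); [exact: measurable_coord|exact: measurable_repl].
by apply: measurable_isof; exact: measurable_replT.
Qed.

Lemma measurable_dev_fresh_hit k i j : measurable_fun setT (dev_fresh_hit k i j : traj -> bool).
Proof.
apply: measurable_and; first exact: measurable_clear.
apply: measurable_and => //.
apply: measurable_and; first exact: (mnear_coord k (k.+1 + j)).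
apply: measurable_and; first exact: (mnear_coord (k.+1 + i) j).
by apply: measurable_isof; exact: measurable_fresh.
Qed.

Lemma measurable_dev_last k : measurable_fun setT (dev_last k : traj -> bool).
Proof.
apply: measurable_and; first exact: measurable_clear.
by apply: measurable_isof; exact: measurable_fresh.
Qed.

Lemma measurable_dev_last_hit k i : measurable_fun setT (dev_last_hit k i : traj -> bool).
Proof.
apply: measurable_and; first exact: measurable_clear.
apply: measurable_and; first exact: (mnear_coord (k.+1 + i) (k.+1 + k)).
by apply: measurable_isof; exact: measurable_fresh.
Qed.

Definition EN (m : traj -> nat) : \bar R := (\int[Q]_w ((m w)%:R)%:E)%E.

Lemma mEN (m : traj -> nat) : measurable_fun setT m ->
  measurable_fun setT (fun w => ((m w)%:R : R)%:E).
Proof.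
by move=> mm; apply/measurable_EFinP; apply: (measurableT_comp (f := fun j : nat => j%:R : R)).
Qed.

Lemma EN_add (m m' : traj -> nat) : measurable_fun setT m -> measurable_fun setT m' ->
  EN (fun w => m w + m' w)%N = (EN m + EN m')%E.
Proof.
move=> mm mm'; rewrite /EN -ge0_integralD//; [|exact: mEN..].
by apply: eq_integral => w _; rewrite natrD EFinD.
Qed.

Lemma EN_sum k (m : nat -> traj -> nat) : (forall i, measurable_fun setT (m i)) ->
  EN (fun w => \sum_(0 <= i < k) m i w)%N = (\sum_(0 <= i < k) EN (m i))%E.
Proof.
move=> mm; rewrite /EN -ge0_integral_sum//; last by move=> i; exact: mEN.
by apply: eq_integral => w _; rewrite natr_sum sumEFin.
Qed.

Lemma measurable_nob (b : traj -> bool) : measurable_fun setT b ->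
  measurable_fun setT (fun w => b w : nat).
Proof. by move=> mb; apply: (measurableT_comp (f := nat_of_bool)). Qed.

Lemma sum_le_cst k (F : nat -> \bar R) (c : \bar R) :
  (forall i, (i < k)%N -> (F i <= c)%E) ->
  (\sum_(0 <= i < k) F i <= k%:R%:E * c)%E.
Proof.
move=> h; apply: (@le_trans _ _ (\sum_(0 <= i < k) c)%E).
  by rewrite !big_mkord; apply: lee_sum => i _; exact: h.
by rewrite mule_natl big_const_nat subn0 iter_addr adde0.
Qed.

Lemma sum_le_cst1 k i (F : nat -> \bar R) (c : \bar R) : (i < k)%N -> F i = 0%E ->
  (forall j, (j < k)%N -> j != i -> (F j <= c)%E) ->
  (\sum_(0 <= j < k) F j <= k.-1%:R%:E * c)%E.
Proof.
move=> ik Fi h; rewrite big_mkord (bigD1 (Ordinal ik))//= Fi add0e.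
apply: (@le_trans _ _ (\sum_(j < k | j != Ordinal ik) c)%E).
  by apply: lee_sum => j ji; apply: h => //; rewrite -val_eqE in ji.
by rewrite mule_natl sumr_const (cardC1 (Ordinal ik)) card_ord.
Qed.

Lemma measurable_devcount k : measurable_fun setT (devcount k : traj -> nat).
Proof.
have m1 i := measurable_nob (measurable_dev_fresh_near k i).
have m2 i := measurable_nob (measurable_dev_repl_near k i).
have m3 i := measurable_nob (measurable_dev_repl_ring k i).
have m4 i j := measurable_nob (measurable_dev_fresh_hit k i j).
have m5 := measurable_nob (measurable_dev_last k).
have m6 i := measurable_nob (measurable_dev_last_hit k i).
do ?[apply: measurable_fun_addn => //|apply: measurable_sumn => // ?].
Qed.

Lemma devcount_bound k : (k.+1%:R%:E * EN (devcount k) <= pair_int (errk k.+1))%E.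
Proof.
have m1 i := measurable_nob (measurable_dev_fresh_near k i).
have m2 i := measurable_nob (measurable_dev_repl_near k i).
have m3 i := measurable_nob (measurable_dev_repl_ring k i).
have m4 i j := measurable_nob (measurable_dev_fresh_hit k i j).
have m5 := measurable_nob (measurable_dev_last k).
have m6 i := measurable_nob (measurable_dev_last_hit k i).
have ms4 i : measurable_fun setT (fun w : traj => \sum_(0 <= j < k) dev_fresh_hit k i j w)%N.
  by apply: measurable_sumn.
have m12 i : measurable_fun setT (fun w : traj => dev_fresh_near k i w + dev_repl_near k i w)%N.
  exact: measurable_fun_addn.
have m123 i : measurable_fun setT (fun w : traj => dev_fresh_near k i w + dev_repl_near k i w + dev_repl_ring k i w)%N.
  exact: measurable_fun_addn.
pose a x y := both_far x y ^+ k.-1.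
pose v x y := (ring2 x y)%:R * (1 - near_pr2 x y) ^+ k.-1.
pose c1 x y := (near x y)%:R * a x y + (v x y + near_pr x * a x y) + v x y + near_pr y * a x y.
pose aX x y := both_far x y ^+ k.
pose c4 x y := near_pr x * near_pr y * both_far x y ^+ k.-2.
have ka : kern a by apply: kernX; exact: kern_both_far.
have kv : kern v by apply: kernM; [exact: kern_ring2|apply: kernX; exact: kern_far2].
have kna : kern (fun x y => (near x y)%:R * a x y) by apply: kernM => //; exact: kern_near.
have kxa : kern (fun x y => near_pr x * a x y) by apply: kernM => //; exact: kern_near_prx.
have kya : kern (fun x y => near_pr y * a x y) by apply: kernM => //; exact: kern_near_pry.
have kvx : kern (fun x y => v x y + near_pr x * a x y) by exact: kernD.
have kc1 : kern c1 by do ! apply: kernD => //.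
have kc4 : kern c4.
  apply: kernM; last by apply: kernX; exact: kern_both_far.
  by apply: kernM; [exact: kern_near_prx|exact: kern_near_pry].
have kX : kern aX by apply: kernX; exact: kern_both_far.
have h : (EN (devcount k) <=
    k%:R%:E * pair_int c1 + (k%:R%:E * (k.-1%:R%:E * pair_int c4) + pair_int aX))%E.
  rewrite EN_add; last 2 first.
  - by apply: measurable_sumn => i; apply: measurable_fun_addn.
  - by apply: measurable_fun_addn => //; apply: measurable_sumn.
  rewrite EN_sum; last by move=> i; apply: measurable_fun_addn.
  rewrite EN_add//; last by apply: measurable_sumn.
  rewrite EN_sum//.
  rewrite addeCA [leRHS]addeA [leRHS]addeC; apply: leeD; first exact: dev_last_bound.
  rewrite -big_split /= -muleDr//; last first.
    by rewrite ge0_adde_def// inE ?mule_ge0 ?J_ge0// ?lee_fin.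
  apply: sum_le_cst => i ik.
  rewrite EN_add// EN_add// EN_add// EN_sum//.
  rewrite -addeA [X in (_ + X <= _)%E]addeC addeA; apply: leeD.
    rewrite /c1 JD//; last by do ! apply: kernD => //.
    rewrite JD//; last by do ! apply: kernD => //.
    rewrite JD//; apply: leeD; last exact: dev_last_hit_bound.
    apply: leeD; last exact: dev_repl_ring_bound.
    by apply: leeD; [exact: dev_fresh_near_bound|exact: dev_repl_near_bound].
  apply: (sum_le_cst1 ik) => [|j jk ji]; last exact: dev_fresh_hit_bound.
  by rewrite /EN integral0_eq// => w _; rewrite /dev_fresh_hit eqxx /= andbF.
have JA : pair_int (errk k.+1) = (k.+1%:R%:E * (k%:R%:E * pair_int c1 + (k%:R%:E * (k.-1%:R%:E * pair_int c4) +
    pair_int aX)))%E.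
  have kc (m : nat) : kern (fun _ _ => m%:R) by exact: kern_cst.
  have k1 : kern (fun x y => k%:R * c1 x y) by exact: kernM.
  have k4 : kern (fun x y => k.-1%:R * c4 x y) by exact: kernM.
  have k4' : kern (fun x y => k%:R * (k.-1%:R * c4 x y)) by exact: kernM.
  have k4X : kern (fun x y => k%:R * (k.-1%:R * c4 x y) + aX x y) by exact: kernD.
  have k14X : kern (fun x y => k%:R * c1 x y + (k%:R * (k.-1%:R * c4 x y) + aX x y)).
    exact: kernD.
  rewrite -(JZ (ler0n _ k) kc1) -(JZ (ler0n _ k.-1) kc4) -(JZ (ler0n _ k) k4).
  rewrite -(JD k4' kX) -(JD k1 k4X) -(JZ (ler0n _ k.+1) k14X).
  congr pair_int; apply/funext => x; apply/funext => y.
  rewrite /errk /c1 /c4 /a /v /aX /= !ffactnS ffactn0 !muln1 !natrM /=.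
  by ring.
by rewrite JA; apply: lee_wpmul2l.
Qed.

(** The mean number of isolated points in a sample of size n; clear is the event
that the last one is isolated. *)
Definition count_mean (n : nat) : R := n%:R * fine (\int[Q]_w ((clear n.-1 w)%:R)%:E)%E.

Lemma int_clear k : (\int[Q]_w ((clear k w)%:R)%:E = \int[nu]_x ((1 - near_pr x) ^+ k)%:E)%E.
Proof.
have mcR : measurable_fun setT (fun w : traj => ((clear k w)%:R : R)%:E).
  by apply/measurable_EFinP; apply: measurable_natb; exact: measurable_clear.
rewrite (iid_resample Qiid k)//.
apply: eq_integral => x _.
pose E (i : nat) : set T := [set z | ~~ near x z].
have mE i : measurable (E i) by apply: measurable_bset; exact: mfar1.
have := integral_indic Q measurableT (measurable_cyl k mE); rewrite setIT => e.
transitivity (Q (cyl k E)).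
  rewrite -e; apply: eq_integral => w _; rewrite indicE; congr ((nat_of_bool _)%:R%:E).
  apply/idP/idP => [/clearP h|/set_mem h].
    apply/mem_set => i ik; have := h i ik; rewrite /upd eqxx.
    by rewrite (ltn_eqF ik).
  by apply/clearP => i ik; rewrite /upd eqxx (ltn_eqF ik); exact: h.
transitivity (\prod_(0 <= i < k) nu (E i))%E; first by apply: Qiid.
rewrite (eq_bigr (fun=> (1 - near_pr x)%:E)); last first.
  by move=> i _; rewrite prE// pr_far.
by rewrite prodEFin prodr_const_nat subn0.
Qed.

Lemma int_clear_fin k : (\int[Q]_w ((clear k w)%:R)%:E)%E \is a fin_num.
Proof.
rewrite ge0_fin_numE; last by apply: integral_ge0 => w _; rewrite lee_fin.
apply: (@le_lt_trans _ _ (\int[Q]_w 1%:E)%E).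
  apply: ge0_le_integral => //.
  - by apply/measurable_EFinP; apply: measurable_natb; exact: measurable_clear.
  - by move=> w _; rewrite lee_fin lern1 leq_b1.
by rewrite integral_cst// mul1e; have := probability_setT Q => /= ->; exact: ltry.
Qed.

Lemma count_meanE n : (count_mean n)%:E =
  (n%:R%:E * \int[nu]_x ((1 - near_pr x) ^+ n.-1)%:E)%E.
Proof. by rewrite /count_mean EFinM fineK ?int_clear_fin// int_clear. Qed.

Lemma count_mean_ge0 n : 0 <= count_mean n.
Proof. by rewrite mulr_ge0// fine_ge0// integral_ge0// => w _; rewrite lee_fin. Qed.

Lemma iso_last_clear k (w : nat -> T) : iso k.+1 w k = clear k w.
Proof.
apply/isoP/clearP => h j jk; first by apply: h; [exact: ltnW|rewrite ltn_eqF].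
by move=> jn; apply: h; rewrite ltn_neqAle jn.
Qed.

Lemma isocount_clear k (w : nat -> T) : clear k w -> isocount k.+1 w = (isocount k w).+1.
Proof.
move=> cw; rewrite isocountS iso_last_clear cw add1n; congr S.
apply: eq_big_nat => i /andP[_ ik]; move/clearP: cw => /(_ i ik).
by rewrite near_sym => ->; rewrite andbT.
Qed.

Lemma iso_swap n i k (w : nat -> T) j : (i < n)%N -> (k < n)%N ->
  iso n (w \o swapn i k) j = iso n w (swapn i k j).
Proof.
move=> ltin kn.
have sn m : (m < n)%N -> (swapn i k m < n)%N.
  by rewrite /swapn; case: eqP => // _; case: eqP.
apply/isoP/isoP => h m mn mj.
  have := h _ (sn _ mn); rewrite /= swapnK; apply.
  by apply: contraNN mj => /eqP <-; rewrite swapnK.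
apply: h; first exact: sn.
by apply: contraNN mj => /eqP/(can_inj (swapnK i k)) ->.
Qed.

Lemma isocount_swap n i k (w : nat -> T) : (i < n)%N -> (k < n)%N ->
  isocount n (w \o swapn i k) = isocount n w.
Proof.
move=> ltin kn.
have sn m : (m < n)%N -> (swapn i k m < n)%N.
  by rewrite /swapn; case: eqP => // _; case: eqP.
pose s (j : 'I_n) : 'I_n := Ordinal (sn _ (ltn_ord j)).
have sI : injective s.
  by apply: (can_inj (g := s)) => j; apply/val_inj; rewrite /= swapnK.
rewrite /isocount !big_mkord [RHS](reindex_inj sI).
by apply: eq_bigr => j _; rewrite iso_swap.
Qed.

Section stein_identity.
Variables (g : nat -> R) (L : R).
Hypothesis g0 : forall j, 0 <= g j.
Hypothesis gL : forall j, `|g j.+1 - g j| <= L.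

Let L0 : 0 <= L. Proof. exact: le_trans (gL 0). Qed.

Lemma lip_nat (a b m : nat) : (a <= b + m)%N -> (b <= a + m)%N -> g a <= g b + L * m%:R.
Proof.
have up p q : g (p + q)%N <= g p + L * q%:R /\ g p <= g (p + q)%N + L * q%:R.
  elim: q => [|q [ih1 ih2]]; first by rewrite addn0 mulr0 addr0.
  have := gL (p + q)%N; rewrite addnS ler_norml -natr1 => /andP[h1 h2].
  by split; lra.
move=> ab ba; have [le_ab|/ltnW le_ba] := leqP a b.
  have [_] := up a (b - a)%N; rewrite subnKC// => /le_trans; apply.
  by rewrite lerD2l ler_wpM2l// ler_nat leq_subLR.
have [+ _] := up b (a - b)%N; rewrite subnKC// => /le_trans; apply.
by rewrite lerD2l ler_wpM2l// ler_nat leq_subLR.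
Qed.

Lemma measurable_g (m : traj -> nat) : measurable_fun setT m ->
  measurable_fun setT (fun w => g (m w)).
Proof. by move=> mm; apply: (measurableT_comp (f := g)). Qed.

(** Exchangeability: each of the k + 1 points contributes as the last one does. *)
Lemma int_count_g k : (\int[Q]_w ((isocount k.+1 w)%:R * g (isocount k.+1 w))%:E =
  k.+1%:R%:E * \int[Q]_w ((clear k w)%:R * g (isocount k w).+1)%:E)%E.
Proof.
have mG : measurable_fun setT (fun w : traj => g (isocount k.+1 w)).
  by apply: measurable_g; exact: measurable_isocount.
have mI i : measurable_fun setT (fun w : traj => ((iso k.+1 w i)%:R * g (isocount k.+1 w))%:E).
  apply/measurable_EFinP; apply: measurable_funM => //.
  by apply: measurable_natb; exact: measurable_iso.
have pI i (w : traj) : (0 <= ((iso k.+1 w i)%:R * g (isocount k.+1 w))%:E)%E.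
  by rewrite lee_fin mulr_ge0.
have e : (\int[Q]_w ((isocount k.+1 w)%:R * g (isocount k.+1 w))%:E =
    \sum_(i < k.+1) \int[Q]_w ((iso k.+1 w i)%:R * g (isocount k.+1 w))%:E)%E.
  rewrite -ge0_integral_sum//.
  apply: eq_integral => w _; rewrite sumEFin -big_distrl /= -natr_sum.
  by rewrite {1}/isocount big_mkord.
rewrite e.
have ei (i : 'I_k.+1) : (\int[Q]_w ((iso k.+1 w i)%:R * g (isocount k.+1 w))%:E =
    \int[Q]_w ((clear k w)%:R * g (isocount k w).+1)%:E)%E.
  rewrite -(iid_swap Qiid i k (F := fun w => ((iso k.+1 w i)%:R * g (isocount k.+1 w))%:E))//.
  apply: eq_integral => w _; rewrite iso_swap// isocount_swap//.
  rewrite {1}/swapn eqxx iso_last_clear.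
  by case: (boolP (clear k w)) => [/isocount_clear ->|]; rewrite ?mul0r.
by rewrite (eq_bigr _ (fun i _ => ei i)) sumr_const card_ord mule_natl.
Qed.

Lemma int_clear_repl k : (\int[Q]_w ((clear k w)%:R * g (isocount k w).+1)%:E =
  \int[Q]_w ((clear k w)%:R * g (isocount k (repl k w)).+1)%:E)%E.
Proof.
pose F (w z : traj) : R := g (isocount k z).+1.
have mF : measurable_fun setT (fun p : traj * traj => F p.1 p.2).
  apply: (measurableT_comp (f := fun j : nat => g j.+1)) => //.
  by apply: measurableT_comp (measurable_isocount k) _; exact: measurable_snd.
have := hybrid_exchange (k := k) mF _ _ (leqnn k).
move=> /(_ (fun _ _ => g0 _) (fun _ _ _ _ _ _ => erefl)) e.
transitivity (\int[Q]_w ((clear k w)%:R * F w (hybrid k 0 w))%:E)%E.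
  apply: eq_integral => w _; rewrite /F; congr (_ * g _.+1)%:E.
  by apply: isocount_ext => i ik; rewrite /hybrid ik.
rewrite -e; apply: eq_integral => w _; rewrite /F; congr (_ * g _.+1)%:E.
by apply: isocount_ext => i ik; rewrite /hybrid ik.
Qed.

(** The marked point is isolated on clear k w; there the sample may be replaced
(int_clear_repl), and the replaced count differs from the fresh one by at most
devcount. The fresh sample is independent of clear k w, whose probability times n is
the mean. *)
Lemma stein_count n :
  (\int[Q]_w ((isocount n w)%:R * g (isocount n w))%:E <=
   (count_mean n)%:E * \int[Q]_w (g (isocount n w).+1)%:E + L%:E * pair_int (errk n))%E /\
  ((count_mean n)%:E * \int[Q]_w (g (isocount n w).+1)%:E <=
   \int[Q]_w ((isocount n w)%:R * g (isocount n w))%:E + L%:E * pair_int (errk n))%E.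
Proof.
case: n => [|k].
  have -> : count_mean 0 = 0 by rewrite /count_mean mul0r.
  have -> : (\int[Q]_w ((isocount 0 w)%:R * g (isocount 0 w))%:E = 0)%E.
    by rewrite integral0_eq// => w _; rewrite /isocount big_geq// mul0r.
  by rewrite mul0e add0e mule_ge0// ?lee_fin// J_ge0//; exact: kern_errk.
rewrite int_count_g int_clear_repl.
set A := (\int[Q]_w ((clear k w)%:R * g (isocount k (repl k w)).+1)%:E)%E.
pose B := (\int[Q]_w ((clear k w)%:R * g (isocount k.+1 (fresh k w)).+1)%:E)%E.
have mc : measurable_fun setT (fun w : traj => (clear k w)%:R : R).
  by apply: measurable_natb; exact: measurable_clear.
have mgS m (f : traj -> traj) : measurable_fun setT f ->
    measurable_fun setT (fun w => g (isocount m (f w)).+1).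
  move=> mf; apply: (measurableT_comp (f := fun j : nat => g j.+1)) => //.
  by apply: measurableT_comp (measurable_isocount m) _.
have mA : measurable_fun setT (fun w : traj =>
    ((clear k w)%:R * g (isocount k (repl k w)).+1)%:E).
  by apply/measurable_EFinP; apply: measurable_funM => //; apply: mgS; exact: measurable_replT.
have mB : measurable_fun setT (fun w : traj =>
    ((clear k w)%:R * g (isocount k.+1 (fresh k w)).+1)%:E).
  by apply/measurable_EFinP; apply: measurable_funM => //; apply: mgS; exact: measurable_fresh.
have mD : measurable_fun setT (fun w : traj => (L%:E * ((devcount k w)%:R)%:E)%E).
  by apply: measurable_funeM; apply: mEN; exact: measurable_devcount.
have D0 (w : traj) : (0 <= L%:E * ((devcount k w)%:R : R)%:E)%E.
  by rewrite mule_ge0// lee_fin.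
have BE : ((count_mean k.+1)%:E * \int[Q]_w (g (isocount k.+1 w).+1)%:E =
    k.+1%:R%:E * B)%E.
  rewrite /count_mean EFinM fineK ?int_clear_fin// -muleA; congr (_ * _)%E.
  rewrite /B -(iid_indep Qiid (m := k.+1) (b := fun w => (clear k w)%:R)
    (F := fun w => g (isocount k.+1 w).+1))//.
    by apply: (mgS _ id); exact: measurable_id.
  move=> w w' h; congr (nat_of_bool _)%:R; apply: eq_in_all => i.
  rewrite mem_iota add0n => /= ik.
  by rewrite (h k)// (h i)// ltnS ltnW.
have intL : (\int[Q]_w (L%:E * ((devcount k w)%:R)%:E) = L%:E * EN (devcount k))%E.
  rewrite ge0_integralZl//.
  by apply: mEN; exact: measurable_devcount.
have AB : (A <= B + L%:E * EN (devcount k))%E.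
  rewrite -intL -ge0_integralD//; last by move=> w _; rewrite lee_fin mulr_ge0.
  apply: ge0_le_integral => //.
  - by move=> w _; rewrite lee_fin mulr_ge0.
  - exact: emeasurable_funD.
  move=> w _; rewrite -EFinM -EFinD lee_fin.
  case: (boolP (clear k w)) => cw; last first.
    by rewrite !mul0r add0r mulr_ge0.
  have [h1 h2] := isocount_repl cw.
  by rewrite !mul1r; apply: lip_nat; rewrite addSn ltnS.
have BA : (B <= A + L%:E * EN (devcount k))%E.
  rewrite -intL -ge0_integralD//; last by move=> w _; rewrite lee_fin mulr_ge0.
  apply: ge0_le_integral => //.
  - by move=> w _; rewrite lee_fin mulr_ge0.
  - exact: emeasurable_funD.
  move=> w _; rewrite -EFinM -EFinD lee_fin.
  case: (boolP (clear k w)) => cw; last first.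
    by rewrite !mul0r add0r mulr_ge0.
  have [h1 h2] := isocount_repl cw.
  by rewrite !mul1r; apply: lip_nat; rewrite addSn ltnS.
have key C C' : (0 <= C')%E -> (C <= C' + L%:E * EN (devcount k))%E ->
    (k.+1%:R%:E * C <= k.+1%:R%:E * C' + L%:E * pair_int (errk k.+1))%E.
  move=> C'0 h; apply: (@le_trans _ _ (k.+1%:R%:E * (C' + L%:E * EN (devcount k)))%E).
    by apply: lee_wpmul2l; rewrite ?lee_fin.
  have EN0 : (0 <= EN (devcount k))%E by apply: integral_ge0 => w _; rewrite lee_fin.
  rewrite ge0_muleDr//; last by rewrite mule_ge0// lee_fin.
  rewrite leeD2l// muleCA; apply: lee_wpmul2l; first by rewrite lee_fin.
  exact: devcount_bound.
have A0 : (0 <= A)%E by apply: integral_ge0 => w _; rewrite lee_fin mulr_ge0.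
have B0 : (0 <= B)%E by apply: integral_ge0 => w _; rewrite lee_fin mulr_ge0.
by rewrite BE; split; apply: key.
Qed.

End stein_identity.

End coupling.

(** * Random sample size: mixtures of counts *)

Lemma integral_prob_cst {d} {T : measurableType d} {R : realType}
  (P : probability T R) (c : R) : (\int[P]_w c%:E = c%:E)%E.
Proof. by rewrite integral_cst//; have := probability_setT P => /= ->; rewrite mule1. Qed.

Section mixture.
Context {R : realType}.
Variable p : nat -> R.
Hypothesis p0 : forall k, 0 <= p k.
Implicit Types F : nat -> \bar R.
Local Open Scope ereal_scope.

Definition mix F : \bar R := \sum_(k <oo) (p k)%:E * F k.

Lemma mix_le F F' : (forall k, 0 <= F k) -> (forall k, F k <= F' k) -> mix F <= mix F'.
Proof.
move=> F0 FF'; apply: lee_nneseries => [k _ _|k _].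
  by rewrite mule_ge0// lee_fin.
by apply: lee_wpmul2l; rewrite ?lee_fin.
Qed.

Lemma mixD F F' : (forall k, 0 <= F k) -> (forall k, 0 <= F' k) ->
  mix (fun k => F k + F' k) = mix F + mix F'.
Proof.
move=> F0 F'0; rewrite /mix -nneseriesD => [|k _ _|k _ _]; last 2 first.
- by rewrite mule_ge0// lee_fin.
- by rewrite mule_ge0// lee_fin.
by apply: eq_eseriesr => k _; rewrite ge0_muleDr.
Qed.

Lemma mixZ c F : (0 <= c)%R -> (forall k, 0 <= F k) ->
  mix (fun k => c%:E * F k) = c%:E * mix F.
Proof.
move=> c0 F0; rewrite /mix -nneseriesZl => [|k _]; last by rewrite mule_ge0// lee_fin.
by apply: eq_eseriesr => k _; rewrite muleCA.
Qed.

End mixture.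

Section mixture_count.
Context {R : realType}.
Variables (p : nat -> R).
Hypothesis p0 : forall k, 0 <= p k.
Context {d' : measure_display} {Om' : measurableType d'} (Q : probability Om' R).
Variable S : nat -> Om' -> nat.
Hypothesis mS : forall k, measurable_fun setT (S k).
Variables (lam : nat -> R) (err : nat -> \bar R).
Hypothesis lam0 : forall k, 0 <= lam k.
Hypothesis err0 : forall k, (0 <= err k)%E.
Hypothesis S_stein : forall (g : nat -> R) (L : R) (k : nat), (forall j, 0 <= g j) ->
  (forall j, `|g j.+1 - g j| <= L) ->
  (\int[Q]_w ((S k w)%:R * g (S k w))%:E <=
   (lam k)%:E * \int[Q]_w (g (S k w).+1)%:E + L%:E * err k)%E /\
  ((lam k)%:E * \int[Q]_w (g (S k w).+1)%:E <=
   \int[Q]_w ((S k w)%:R * g (S k w))%:E + L%:E * err k)%E.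
Context {dOm : measure_display} {Om : measurableType dOm}.
Variable P : probability Om R.
Variable W : Om -> nat.
Hypothesis mW : measurable_fun setT W.
Hypothesis HW : forall h : nat -> R, (forall j, 0 <= h j) ->
  (\int[P]_w (h (W w))%:E = mix p (fun k => \int[Q]_w (h (S k w))%:E))%E.
Variables lambda alpha sigma : R.
Hypothesis lambda_gt0 : 0 < lambda.
Hypothesis alpha0 : 0 <= alpha.
Hypothesis sigma_gt0 : 0 < sigma.
Hypothesis mix_lam : mix p (fun k => (lam k)%:E) = lambda%:E.
Hypothesis mix_lam2 : (mix p (fun k => (lam k ^+ 2)%:E) <= (lambda ^+ 2 + sigma ^+ 2)%:E)%E.
Hypothesis mix_err : (mix p err <= alpha%:E)%E.

Let mix1 : mix p (fun=> 1%:E) = 1%:E.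
Proof.
have := HW (h := fun=> 1) (fun=> ler01).
rewrite integral_prob_cst => e; rewrite [RHS]e; congr (mix p _); apply/funext => k.
by rewrite integral_prob_cst.
Qed.

Let mixc (c : R) : 0 <= c -> mix p (fun=> c%:E) = c%:E.
Proof.
move=> c0; rewrite -[RHS]mule1 -mix1 -mixZ//.
by congr (mix p _); apply/funext => k; rewrite mule1.
Qed.

Let mh (k : nat) (h : nat -> R) : measurable_fun setT (fun w => (h (S k w))%:E).
Proof. by apply/measurable_EFinP; apply: (measurableT_comp (f := h)). Qed.

Let mean_S k : (\int[Q]_w ((S k w)%:R)%:E = (lam k)%:E)%E.
Proof.
have := S_stein (g := fun=> 1) (L := 0) k (fun=> ler01).
rewrite integral_prob_cst mule1 mul0e !adde0.
case/(_ _) => [|h1 h2]; first by move=> j; rewrite subrr normr0.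
apply/eqP; rewrite eq_le.
under eq_integral do rewrite -[X in X%:E]mulr1.
by rewrite h1 h2.
Qed.

Lemma mixture_mean : (\int[P]_w ((W w)%:R)%:E = lambda%:E)%E.
Proof.
rewrite (HW (h := fun j => j%:R))// -mix_lam.
by congr (mix p _); apply/funext => k; rewrite mean_S.
Qed.

Let mean_S1 k : (\int[Q]_w ((S k w).+1%:R)%:E = (lam k + 1)%:E)%E.
Proof.
under eq_integral do rewrite -natr1 EFinD.
rewrite ge0_integralD//.
by rewrite mean_S integral_prob_cst.
Qed.

Let id_lip (j : nat) : `|j.+1%:R - j%:R| <= 1 :> R.
Proof. by rewrite -natr1 addrAC subrr add0r normr1. Qed.

Let sq0 k : (0 <= (lam k ^+ 2)%:E)%E. Proof. by rewrite lee_fin sqr_ge0. Qed.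

Let lamE0 k : (0 <= (lam k)%:E)%E. Proof. by rewrite lee_fin. Qed.

(** Stein's identity with g(j) = j. *)
Lemma mixture_moment2_le :
  (\int[P]_w (((W w)%:R) ^+ 2)%:E <= (lambda ^+ 2 + sigma ^+ 2 + lambda + alpha)%:E)%E.
Proof.
rewrite (HW (h := fun j => j%:R ^+ 2)); last by move=> j; rewrite exprn_ge0.
apply: (@le_trans _ _ (mix p (fun k => (lam k ^+ 2)%:E + (lam k)%:E + err k)%E)).
  apply: mix_le => // k.
    by apply: integral_ge0 => w _; rewrite lee_fin exprn_ge0.
  have [+ _] := S_stein (g := fun j => j%:R) (L := 1) k (fun j => ler0n _ j) id_lip.
  rewrite mean_S1 mul1e -EFinM mulrDr mulr1 -expr2 EFinD.
  by under eq_integral do rewrite -expr2.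
rewrite mixD//; last by move=> k; rewrite -EFinD lee_fin addr_ge0 ?sqr_ge0.
rewrite mixD//.
rewrite mix_lam [leRHS]EFinD; apply: leeD => //.
by rewrite [leRHS]EFinD; exact: leeD2r.
Qed.

Let jensen : ((lambda ^+ 2)%:E <= mix p (fun k => (lam k ^+ 2)%:E))%E.
Proof.
have : ((2 * lambda * lambda)%:E <= mix p (fun k => (lam k ^+ 2)%:E) + (lambda ^+ 2)%:E)%E.
  rewrite EFinM -mix_lam -mixZ//; last by rewrite mulr_ge0// ltW.
  rewrite -[X in (_ + X)%E]mixc ?sqr_ge0// -mixD//; last by move=> k; rewrite lee_fin sqr_ge0.
  apply: mix_le => // k; first by rewrite -EFinM lee_fin !mulr_ge0// ltW.
  by rewrite -EFinM -EFinD lee_fin; have := sqr_ge0 (lambda - lam k); lra.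
rewrite (_ : 2 * lambda * lambda = lambda ^+ 2 + lambda ^+ 2)%R; last by ring.
by rewrite EFinD leeD2rE.
Qed.

Lemma mixture_moment2_ge :
  ((lambda ^+ 2 + lambda - alpha)%:E <= \int[P]_w (((W w)%:R) ^+ 2)%:E)%E.
Proof.
rewrite (HW (h := fun j => j%:R ^+ 2)); last by move=> j; rewrite exprn_ge0.
have : ((lambda ^+ 2 + lambda)%:E <=
    mix p (fun k => \int[Q]_w (((S k w)%:R) ^+ 2)%:E) + alpha%:E)%E.
  apply: (@le_trans _ _ (mix p (fun k => (lam k ^+ 2)%:E + (lam k)%:E)%E)).
    rewrite mixD//.
    by rewrite mix_lam EFinD leeD2r.
  apply: (@le_trans _ _ (mix p (fun k => \int[Q]_w (((S k w)%:R) ^+ 2)%:E + err k)%E)).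
    apply: mix_le => // k; first by rewrite -EFinD lee_fin addr_ge0// sqr_ge0.
    have [_] := S_stein (g := fun j => j%:R) (L := 1) k (fun j => ler0n _ j) id_lip.
    rewrite mean_S1 mul1e -EFinM mulrDr mulr1 -expr2 EFinD.
    by under eq_integral do rewrite -expr2.
  rewrite mixD//; last by move=> k; apply: integral_ge0 => w _; rewrite lee_fin exprn_ge0.
  exact: leeD2l.
by move=> h; rewrite EFinB leeBlDr.
Qed.

Let mix_dev2 : (mix p (fun k => ((lam k - lambda) ^+ 2)%:E) <= (sigma ^+ 2)%:E)%E.
Proof.
have l0 := ltW lambda_gt0.
have : (mix p (fun k => ((lam k - lambda) ^+ 2)%:E) + (2 * lambda * lambda)%:E <=
   (sigma ^+ 2)%:E + (2 * lambda * lambda)%:E)%E.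
  have e2 : (2 * lambda * lambda)%:E = mix p (fun k => (2 * lambda)%:E * (lam k)%:E)%E.
    by rewrite mixZ ?mulr_ge0// mix_lam EFinM.
  rewrite {1}e2 -mixD//; last 2 first.
  - by move=> k; rewrite lee_fin sqr_ge0.
  - by move=> k; rewrite -EFinM lee_fin !mulr_ge0.
  rewrite (_ : mix p _ = mix p (fun k => (lam k ^+ 2)%:E + (lambda ^+ 2)%:E)%E); last first.
    congr (mix p _); apply/funext => k; rewrite -EFinM -!EFinD; congr (_%:E); ring.
  rewrite mixD//; last by move=> k; rewrite lee_fin sqr_ge0.
  rewrite mixc ?sqr_ge0//.
  rewrite (_ : (_ + (2 * lambda * lambda)%:E)%E =
    ((lambda ^+ 2 + sigma ^+ 2)%:E + (lambda ^+ 2)%:E)%E); first exact: leeD2r.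
  by rewrite -!EFinD; congr (_%:E); ring.
by rewrite leeD2rE.
Qed.

Let mix_dev : (mix p (fun k => `|lam k - lambda|%:E) <= sigma%:E)%E.
Proof.
have s0 := ltW sigma_gt0.
apply: (@le_trans _ _ (mix p (fun k => ((2 * sigma)^-1)%:E * ((lam k - lambda) ^+ 2)%:E +
    (sigma / 2)%:E)%E)).
  (* x <= x^2 / (2 sigma) + sigma / 2 *)
  apply: mix_le => // k; rewrite -EFinM -EFinD lee_fin -real_normK ?num_real//.
  move: (`|lam k - lambda|) => x; rewrite -subr_ge0.
  have -> : (2 * sigma)^-1 * x ^+ 2 + sigma / 2 - x = (2 * sigma)^-1 * (x - sigma) ^+ 2.
    by field; rewrite gt_eqF.
  by rewrite mulr_ge0 ?sqr_ge0// invr_ge0 mulr_ge0.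
have s20 : 0 <= (2 * sigma)^-1 by rewrite invr_ge0 mulr_ge0.
rewrite mixD//; last 2 first.
- by move=> k; rewrite -EFinM lee_fin mulr_ge0 ?sqr_ge0.
- by move=> k; rewrite lee_fin divr_ge0.
rewrite mixZ//; last by move=> k; rewrite lee_fin sqr_ge0.
rewrite mixc ?divr_ge0//.
apply: (@le_trans _ _ (((2 * sigma)^-1)%:E * (sigma ^+ 2)%:E + (sigma / 2)%:E)%E).
  by rewrite leeD2r// lee_wpmul2l// lee_fin.
rewrite -EFinM -EFinD lee_fin le_eqVlt; apply/orP; left; apply/eqP.
by field; rewrite gt_eqF.
Qed.

(** Average Stein's identity over the sample size k, and replace the conditional
mean lam k by lambda, at the cost of M times the mean of |lam k - lambda|, at most M
sigma. *)
Lemma mixture_stein : poisson_approx P W lambda alpha sigma.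
Proof.
move=> g L M gM gL.
have g0 j : 0 <= g j by case/andP: (gM j).
have gB j : `|g j| <= M by rewrite ger0_norm//; case/andP: (gM j).
have M0 : 0 <= M by exact: le_trans (g0 0%N) (le_trans (ler_norm _) (gB 0%N)).
have L0 : 0 <= L by exact: le_trans (gL 0%N).
have iW : P.-integrable setT (fun w => ((W w)%:R)%:E).
  apply/integrableP; split.
    by apply/measurable_EFinP; apply: (measurableT_comp (f := fun j : nat => j%:R : R)).
  by under eq_integral do rewrite gee0_abs ?lee_fin//; rewrite mixture_mean ltry.
have EwE (h : nat -> R) : (forall j, 0 <= h j) -> lin_growth h ->
    (Ew P W h)%:E = mix p (fun k => \int[Q]_w (h (S k w))%:E)%E.
  move=> h0 lh; rewrite -HW// /Ew /Rintegral fineK//.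
  by apply: integrable_fin_num => //; exact: integrable_Ew.
have ejg := EwE (fun j => j%:R * g j) (fun j => mulr_ge0 (ler0n _ _) (g0 j)) (lin_growthM gB).
have lg1 : lin_growth (fun j => g j.+1) by exact: (@lin_growth_bnd _ M).
have eg1 := EwE (fun j => g j.+1) (fun j => g0 _) lg1.
have I0 k : (0 <= \int[Q]_w (g (S k w).+1)%:E)%E.
  by apply: integral_ge0 => w _; rewrite lee_fin.
have J0 k : (0 <= \int[Q]_w ((S k w)%:R * g (S k w))%:E)%E.
  by apply: integral_ge0 => w _; rewrite lee_fin mulr_ge0.
have IM k : (\int[Q]_w (g (S k w).+1)%:E <= M%:E)%E.
  apply: (@le_trans _ _ (\int[Q]_w M%:E)%E).
    apply: ge0_le_integral => //.
    - by move=> w _; rewrite lee_fin.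
    - exact: (mh k (fun j => g j.+1)).
    - by move=> w _; rewrite lee_fin; case/andP: (gM (S k w).+1).
  by rewrite integral_prob_cst.
have Ifin k : (\int[Q]_w (g (S k w).+1)%:E)%E \is a fin_num.
  by rewrite ge0_fin_numE// (le_lt_trans (IM k)) ?ltry.
have tail0 k : (0 <= `|lam k - lambda|%:E * M%:E + L%:E * err k)%E.
  by rewrite adde_ge0// ?mule_ge0 ?lee_fin.
have tailE : (mix p (fun k => `|lam k - lambda|%:E * M%:E + L%:E * err k) <=
    (L * alpha + M * sigma)%:E)%E.
  rewrite mixD//; last 2 first.
  - by move=> k; rewrite -EFinM lee_fin mulr_ge0.
  - by move=> k; rewrite mule_ge0// lee_fin.
  rewrite addeC EFinD; apply: leeD.
    by rewrite mixZ// EFinM; apply: lee_wpmul2l; rewrite ?lee_fin.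
  under [X in mix p X]eq_fun do rewrite muleC.
  rewrite mixZ//.
  by rewrite EFinM; apply: lee_wpmul2l; rewrite ?lee_fin.
have swap k (a b : R) : `|a - b| = `|lam k - lambda| ->
  (a%:E * \int[Q]_w (g (S k w).+1)%:E <= b%:E * \int[Q]_w (g (S k w).+1)%:E +
     `|lam k - lambda|%:E * M%:E)%E.
  move=> ab; have := IM k; have := I0 k.
  rewrite -(fineK (Ifin k)); move: (fine _) => x; rewrite !lee_fin => x0 xM.
  rewrite -ab.
  have : (a - b) * x <= `|a - b| * M.
    by rewrite (le_trans (ler_norm _))// normrM (ger0_norm x0) ler_wpM2l.
  lra.
rewrite ler_norml; apply/andP; split; last first.
  rewrite lerBlDl -lee_fin EFinD EFinM ejg eg1 -mixZ ?(ltW lambda_gt0)//.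
  apply: (@le_trans _ _ (mix p (fun k => lambda%:E * \int[Q]_w (g (S k w).+1)%:E +
      (`|lam k - lambda|%:E * M%:E + L%:E * err k))%E)).
    apply: mix_le => // k.
    have [h _] := S_stein k g0 gL; apply: (le_trans h).
    by rewrite addeA leeD2r// swap.
  rewrite mixD//; last by move=> k; rewrite mule_ge0// lee_fin ltW.
  exact: leeD2l.
suff : lambda * Ew P W (fun j => g j.+1) <=
    Ew P W (fun j => j%:R * g j) + (L * alpha + M * sigma) by lra.
rewrite -lee_fin [leRHS]EFinD EFinM ejg eg1 -mixZ ?(ltW lambda_gt0)//.
apply: (@le_trans _ _ (mix p (fun k => \int[Q]_w ((S k w)%:R * g (S k w))%:E +
    (`|lam k - lambda|%:E * M%:E + L%:E * err k))%E)).
  apply: mix_le => // k; first by rewrite mule_ge0// lee_fin ltW.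
  have [_ h] := S_stein k g0 gL.
  have := swap k lambda (lam k) (distrC _ _) => /le_trans; apply.
  by rewrite addeCA addeC leeD2r// addeC.
rewrite mixD//; exact: leeD2l.
Qed.

Let iW : P.-integrable setT (fun w => ((W w)%:R)%:E).
Proof.
apply/integrableP; split.
  by apply/measurable_EFinP; apply: (measurableT_comp (f := fun j : nat => j%:R : R)).
by under eq_integral do rewrite gee0_abs ?lee_fin//; rewrite mixture_mean ltry.
Qed.

Let mWh (h : nat -> R) : measurable_fun setT (fun w => (h (W w))%:E).
Proof. by apply/measurable_EFinP; apply: (measurableT_comp (f := h)). Qed.

Lemma mixture_dev2 :
  (\int[P]_w (((W w)%:R - lambda) ^+ 2)%:E <= (lambda + alpha + sigma ^+ 2)%:E)%E.
Proof.
have l0 := ltW lambda_gt0.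
have e : (\int[P]_w (((W w)%:R - lambda) ^+ 2)%:E + (2 * lambda * lambda)%:E =
    \int[P]_w (((W w)%:R) ^+ 2)%:E + (lambda ^+ 2)%:E)%E.
  rewrite [X in (_ + X)%E]EFinM -mixture_mean -ge0_integralZl//; last by rewrite lee_fin mulr_ge0.
  rewrite -ge0_integralD//; last 4 first.
  - by move=> w _; rewrite lee_fin sqr_ge0.
  - exact: (mWh (fun j => (j%:R - lambda) ^+ 2)).
  - by move=> w _; rewrite -EFinM lee_fin !mulr_ge0.
  - by apply: measurable_funeM; exact: (mWh (fun j => j%:R)).
  rewrite -(integral_prob_cst P (lambda ^+ 2)) -ge0_integralD//; last 2 first.
  - exact: (mWh (fun j => j%:R ^+ 2)).
  - by move=> w _; rewrite lee_fin sqr_ge0.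
  by apply: eq_integral => w _; rewrite -EFinM -!EFinD; congr (_%:E); ring.
have : (\int[P]_w (((W w)%:R - lambda) ^+ 2)%:E + (2 * lambda * lambda)%:E <=
    (lambda + alpha + sigma ^+ 2)%:E + (2 * lambda * lambda)%:E)%E.
  rewrite e; apply: (@le_trans _ _ ((lambda ^+ 2 + sigma ^+ 2 + lambda + alpha)%:E +
    (lambda ^+ 2)%:E)%E); first by rewrite leeD2r// mixture_moment2_le.
  by rewrite -!EFinD lee_fin; lra.
by rewrite leeD2rE.
Qed.

Lemma mixture_dev :
  Ew P W (fun j => `|j%:R - lambda|) <= Num.sqrt (lambda + alpha + sigma ^+ 2).
Proof.
set v := lambda + alpha + sigma ^+ 2.
have v0 : 0 < v by rewrite ltr_pwDl ?sqr_ge0// ltr_pwDl.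
set s := Num.sqrt v; have s0 : 0 < s by rewrite sqrtr_gt0.
have sv : s ^+ 2 = v by rewrite sqr_sqrtr// ltW.
have h0 : 0 <= (2 * s)^-1 by rewrite invr_ge0 mulr_ge0// ltW.
have ld : lin_growth (fun j => `|j%:R - lambda|).
  by apply: lin_growth_norm; apply: lin_growthB;
    [exact: lin_growth_id|exact: lin_growth_cst].
rewrite -lee_fin /Ew /Rintegral fineK; last first.
  by apply: integrable_fin_num => //; exact: (integrable_Ew mW iW ld).
apply: (@le_trans _ _ (\int[P]_w (((2 * s)^-1)%:E * (((W w)%:R - lambda) ^+ 2)%:E +
    (s / 2)%:E))%E).
  apply: ge0_le_integral => //.
  - exact: (mWh (fun j => `|j%:R - lambda|)).
  - apply: emeasurable_funD => //; apply: measurable_funeM.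
    exact: (mWh (fun j => (j%:R - lambda) ^+ 2)).
  move=> w _; rewrite -EFinM -EFinD lee_fin -real_normK ?num_real//.
  move: (`|(W w)%:R - lambda|) => x; rewrite -subr_ge0.
  have -> : (2 * s)^-1 * x ^+ 2 + s / 2 - x = (2 * s)^-1 * (x - s) ^+ 2.
    by field; rewrite gt_eqF.
  by rewrite mulr_ge0 ?sqr_ge0.
rewrite ge0_integralD//; last 3 first.
- by move=> w _; rewrite -EFinM lee_fin mulr_ge0 ?sqr_ge0.
- by apply: measurable_funeM; exact: (mWh (fun j => (j%:R - lambda) ^+ 2)).
- by move=> w _; rewrite lee_fin divr_ge0// ltW.
rewrite ge0_integralZl//; last 2 first.
- exact: (mWh (fun j => (j%:R - lambda) ^+ 2)).
- by move=> w _; rewrite lee_fin sqr_ge0.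
rewrite integral_prob_cst.
apply: (@le_trans _ _ (((2 * s)^-1)%:E * v%:E + (s / 2)%:E)%E).
  by rewrite leeD2r// lee_wpmul2l// ?lee_fin// mixture_dev2.
rewrite -EFinM -EFinD lee_fin -sv le_eqVlt; apply/orP; left; apply/eqP.
by field; rewrite gt_eqF.
Qed.

Lemma mixture_clt z h : h = (Num.sqrt lambda)^-1 ->
  `|fine (P [set w | ((W w)%:R - lambda) / Num.sqrt lambda <= z]) - gcdf z| <=
  h * mills_bound * (1 + sigma) +
  h ^+ 2 * (6 * Num.sqrt (lambda + alpha + sigma ^+ 2) + 6 * alpha + 4 * sigma).
Proof. exact: (stein_kolmogorov mW iW lambda_gt0 mixture_stein mixture_dev). Qed.

Definition Wr (w : Om) : R := (W w)%:R.

Lemma mixture_expectation : ('E_P[Wr] = lambda%:E)%E.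
Proof. by rewrite unlock mixture_mean. Qed.

Lemma mixture_variance : exists2 v : R,
  ('V_P[Wr] = v%:E)%E & `|v - lambda| <= alpha + sigma ^+ 2.
Proof.
have mWR : measurable_fun setT (fun w => (W w)%:R : R).
  by apply: (measurableT_comp (f := fun j : nat => j%:R : R)).
pose m2 := (\int[P]_w (((W w)%:R) ^+ 2)%:E)%E.
have m2fin : m2 \is a fin_num.
  rewrite ge0_fin_numE.
    by apply: le_lt_trans mixture_moment2_le _; exact: ltry.
  by apply: integral_ge0 => w _; rewrite lee_fin sqr_ge0.
have L2 : Wr \in Lfun P 2%:E.
  rewrite inE; apply/andP; split; rewrite inE//= /finite_norm unlock /=.
  apply: poweR_lty.
  under eq_integral do rewrite powR_mulrn// real_normK ?num_real//.
  by apply: le_lt_trans mixture_moment2_le _; exact: ltry.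
exists (fine m2 - lambda ^+ 2).
  rewrite varianceE// mixture_expectation EFinB fineK//.
  rewrite unlock; congr (_ - _)%E.
have := mixture_moment2_le; have := mixture_moment2_ge; rewrite -/m2 -(fineK m2fin) !lee_fin.
have := sqr_ge0 sigma; rewrite /=; move: (fine m2) => x s0 h1 h2.
by rewrite ler_norml; apply/andP; split; lra.
Qed.

End mixture_count.

(** * Binomial and Poisson weights, and bounds on the error integral *)

Section weights.
Context {R : realType}.

(** The k-th term of the j-th derivative of the series of v^k; its Poisson mean is
explicit. *)
Definition ffw (j : nat) (v : R) (k : nat) : R := (k ^_ j)%:R * v ^+ (k - j).

Lemma ffw_ge0 j v k : 0 <= v -> 0 <= ffw j v k.
Proof. by move=> v0; rewrite mulr_ge0// exprn_ge0. Qed.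

(** Shifting k by j in the sum turns it into the exponential series of t v. *)
Lemma mix_poisson (t v : R) j : 0 < t -> 0 <= v ->
  mix (poisson_pmf t) (fun k => (ffw j v k)%:E) = (t ^+ j * expR (- (t * (1 - v))))%:E.
Proof.
move=> t0 v0; have p0 k := poisson_pmf_ge0 t k.
rewrite /mix (nneseries_split 0 j); last first.
  by move=> k _; rewrite -EFinM lee_fin mulr_ge0// ffw_ge0.
rewrite big1_seq; last first.
  move=> k /andP[_]; rewrite mem_index_iota add0n => /andP[_ kj].
  by rewrite /ffw ffact_small// mul0r mule0.
rewrite add0e add0n -nneseries_addn; last first.
  by move=> k; rewrite -EFinM lee_fin mulr_ge0// ffw_ge0.
transitivity (\sum_(k <oo) (t ^+ j * expR (- t))%:E * ((t * v) ^+ k / k`!%:R)%:E)%E.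
  apply: eq_eseriesr => k _; rewrite -!EFinM; congr (_%:E).
  rewrite /ffw /poisson_pmf t0 addnK exprD exprMn -(ffact_fact (leq_addl k j)) addnK natrM.
  have f0 : k`!%:R != 0 :> R by rewrite pnatr_eq0 -lt0n fact_gt0.
  have f1 : ((k + j) ^_ j)%:R != 0 :> R.
    by rewrite pnatr_eq0 -lt0n ffact_gt0 leq_addl.
  by field; rewrite f0 f1.
rewrite nneseriesZl/=; last first.
  by move=> k _; rewrite lee_fin divr_ge0// exprn_ge0// mulr_ge0// ltW.
have -> : (\sum_(k <oo) ((t * v) ^+ k / k`!%:R)%:E)%E = (expR (t * v))%:E.
  rewrite expRE -EFin_lim; last first.
    rewrite /pseries/=; under eq_fun do rewrite mulrC.
    exact: is_cvg_series_exp_coeff.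
  apply/congr_lim/funext => n/=; rewrite /pseries/= /series/= -sumEFin//.
  by under [RHS]eq_bigr do rewrite mulrC.
rewrite -EFinM -mulrA -expRD; congr ((_ * expR _)%:E); ring.
Qed.

(** A deterministic sample size is a mixture with one atom. *)
Definition point_weight (n k : nat) : R := (k == n)%:R.

Lemma mix_point n (F : nat -> \bar R) : (forall k, 0 <= F k)%E ->
  mix (point_weight n) F = F n.
Proof.
move=> F0; rewrite /mix (@nneseriesD1 _ _ n)//; last first.
  by move=> k _; rewrite mule_ge0// lee_fin.
rewrite /point_weight eqxx mul1e eseries0 ?adde0// => k _ /andP[_ /negbTE ->].
by rewrite mul0e.
Qed.

Lemma ffact_le_expn n j : (n ^_ j <= n ^ j)%N.
Proof.
elim: j n => [|j ih] n; first by rewrite ffactn0 expn0.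
by rewrite ffactnSr expnSr leq_mul// leq_subr.
Qed.

(** By n^_j <= n^j and v <= exp (- (1 - v)); the factor exp 3 pays for the j <= 3
missing powers of v. *)
Lemma ffw_le n j v : (j <= 3)%N -> 0 <= v <= 1 ->
  ffw j v n <= expR 3 * (n%:R ^+ j * expR (- (n%:R * (1 - v)))).
Proof.
move=> j3 /andP[v0 v1]; have e3 : 0 <= expR 3 :> R := expR_ge0 _.
have r0 : 0 <= expR 3 * (n%:R ^+ j * expR (- (n%:R * (1 - v)))) :> R.
  by rewrite !mulr_ge0// ?exprn_ge0// expR_ge0.
have [nj|jn] := ltnP n j; first by rewrite /ffw ffact_small// mul0r.
have vle : v <= expR (- (1 - v)).
  by have := expR_ge1Dx (- (1 - v)); lra.
rewrite /ffw mulrCA; apply: ler_pM => //; first by rewrite exprn_ge0.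
  by rewrite -natrX ler_nat ffact_le_expn.
apply: (@le_trans _ _ (expR (- (1 - v)) ^+ (n - j))).
  by rewrite lerXn2r// ?nnegrE// expR_ge0.
rewrite -expRM_natl -expRD ler_expR natrB//.
have : j%:R <= 3 :> R by rewrite ler_nat.
have : 0 <= 1 - v by lra.
have : 1 - v <= 1 by lra.
have : 0 <= j%:R :> R by [].
nra.
Qed.

End weights.

Section kernel_bounds.
Context {R : realType} {d : measure_display} {T : measurableType d}.
Variable nu : probability T R.
Variable Q : probability (@traj d T) R.
Hypothesis Qiid : iid_law nu Q.
Variables near near2 : T -> T -> bool.
Hypothesis mnear : measurable_fun setT (fun p : T * T => near p.1 p.2).
Hypothesis mnear2 : measurable_fun setT (fun p : T * T => near2 p.1 p.2).
Hypothesis near_sym : forall x y, near x y = near y x.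
Hypothesis near2_sym : forall x y, near2 x y = near2 y x.
Hypothesis near_near2 : forall x y z, near x z -> near y z -> near2 x y.
Variable A : set T.
Hypothesis mA : measurable A.
Hypothesis nuA : nu A = 1%E.
Variables t l b1 b2 : R.
Hypothesis t_gt0 : 0 < t.
Hypothesis l_ge0 : 0 <= l.
Hypothesis b1_ge0 : 0 <= b1.
Hypothesis b2_ge0 : 0 <= b2.
Local Notation q := (near_pr nu near).
Local Notation u := (near_pr2 nu near).
Local Notation a := (both_far nu near).
Local Notation J := (pair_int nu).
Hypothesis q_le : forall x, q x <= b1.
Hypothesis q_ge : forall x, A x -> l <= q x.
Hypothesis near2_le : forall x, near_pr nu near2 x <= b2.
Hypothesis ring_ge : forall x y, A x -> A y -> ring2 near near2 x y ->
  q x + l <= u x y \/ q y + l <= u x y.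
Hypothesis tb1 : t * b1 ^+ 2 <= 1.

Lemma nuX_A : (nu \x nu)%E (~` (A `*` A)) = 0%E.
Proof.
have mAA : measurable (A `*` A) by exact: measurableX.
have e1 : (nu \x nu)%E (A `*` A) = 1%E.
  transitivity (nu A * nu A)%E; last by rewrite nuA mule1.
  exact: product_measure1E.
have e2 : (nu \x nu)%E setT = 1%E.
  rewrite -setXTT; transitivity (nu setT * nu setT)%E; first exact: product_measure1E.
  by have := probability_setT nu => /= ->; rewrite mule1.
rewrite -setTD measureD//; last by rewrite /= e2 ltry.
by rewrite setTI [X in (X - _)%E]e2 [X in (_ - X)%E]e1 subee.
Qed.

(** The probability that a Poisson sample of mean size t avoids the neighbourhood of
x. *)
Definition expq (x : T) : R := expR (- (t * q x)).

Lemma measurable_expq : measurable_fun setT expq.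
Proof.
apply: measurableT_comp => //; apply: measurableT_comp => //.
by apply: measurable_funM => //; exact: measurable_near_pr.
Qed.

Lemma expq_ge0 x : 0 <= expq x. Proof. exact: expR_ge0. Qed.
Lemma expq_le1 x : expq x <= 1.
Proof. by rewrite -expR0 ler_expR oppr_le0 mulr_ge0 ?near_pr_ge0// ltW. Qed.

Definition mexp : R := fine (\int[nu]_x (expq x)%:E)%E.

Lemma mexpE : (\int[nu]_x (expq x)%:E = mexp%:E)%E.
Proof.
rewrite /mexp fineK// ge0_fin_numE; last first.
  by apply: integral_ge0 => x _; rewrite lee_fin expq_ge0.
apply: (@le_lt_trans _ _ (\int[nu]_x 1%:E)%E); last by rewrite integral_prob_cst ltry.
apply: ge0_le_integral => //.
- by move=> x _; rewrite lee_fin expq_ge0.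
- by apply/measurable_EFinP; exact: measurable_expq.
- by move=> x _; rewrite lee_fin expq_le1.
Qed.

Lemma mexp_ge0 : 0 <= mexp.
Proof. by rewrite fine_ge0// integral_ge0// => x _; rewrite lee_fin expq_ge0. Qed.

Lemma integral_A (f : T -> R) (c : R) : measurable_fun setT f -> (forall x, 0 <= f x) ->
  0 <= c -> (forall x, A x -> f x <= c) -> (\int[nu]_x (f x)%:E <= c%:E)%E.
Proof.
move=> mf f0 c0 h; have nuC : nu (~` A) = 0%E.
  by rewrite probability_setC// nuA subee.
rewrite (ge0_negligible_integral (N := ~` A))//; last 3 first.
- exact: measurableC.
- exact/measurable_EFinP.
- by move=> x _; rewrite lee_fin.
rewrite setTD setCK; apply: (@le_trans _ _ (\int[nu]_(x in A) c%:E)%E).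
  apply: ge0_le_integral => //.
  - by move=> p _; rewrite lee_fin.
  - by apply/measurable_EFinP; exact: measurable_funTS.
by rewrite integral_cst//; have := nuA => /= ->; rewrite mule1.
Qed.

Lemma mexp_le : mexp <= expR (- (t * l)).
Proof.
rewrite -lee_fin -mexpE; apply: integral_A.
- exact: measurable_expq.
- exact: expq_ge0.
- exact: expR_ge0.
- by move=> x Ax; rewrite ler_expR lerN2 ler_wpM2l ?(ltW t_gt0)// q_ge.
Qed.

Lemma kern_expx : kern (fun x _ => expq x).
Proof. by apply: kern_fst; [exact: measurable_expq|exact: expq_ge0]. Qed.
Lemma kern_expy : kern (fun _ y => expq y).
Proof. by apply: kern_snd; [exact: measurable_expq|exact: expq_ge0]. Qed.

Lemma J_iter c : kern c -> J c = (\int[nu]_x \int[nu]_y (c x y)%:E)%E.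
Proof.
move=> [mc c0]; rewrite /pair_int (fubini_tonelli1 (fun p => (c p.1 p.2)%:E))//.
- exact/measurable_EFinP.
- by move=> p; rewrite lee_fin.
Qed.

Lemma J_iter2 c : kern c -> J c = (\int[nu]_y \int[nu]_x (c x y)%:E)%E.
Proof.
move=> [mc c0]; rewrite J_iter// (fubini_tonelli (fun p => (c p.1 p.2)%:E))//.
- exact/measurable_EFinP.
- by move=> p; rewrite lee_fin.
Qed.

Lemma J_prod (f g : T -> R) : measurable_fun setT f -> measurable_fun setT g ->
  (forall x, 0 <= f x) -> (forall x, 0 <= g x) ->
  J (fun x y => f x * g y) = ((\int[nu]_x (f x)%:E) * (\int[nu]_y (g y)%:E))%E.
Proof.
move=> mf mg f0 g0; rewrite J_iter; last first.
  by apply: kernM; [exact: kern_fst|exact: kern_snd].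
under eq_integral => x _.
  under eq_integral do rewrite EFinM.
  rewrite ge0_integralZl//; last 3 first.
  - exact/measurable_EFinP.
  - by move=> y _; rewrite lee_fin.
  - by rewrite lee_fin.
  over.
rewrite ge0_integralZr//.
- exact/measurable_EFinP.
- by move=> y _; rewrite lee_fin.
- by apply: integral_ge0 => y _; rewrite lee_fin.
Qed.

Lemma int_bool (b : T -> T -> bool) x : measurable_fun setT (fun p : T * T => b p.1 p.2) ->
  (\int[nu]_y ((b x y)%:R)%:E = (near_pr nu b x)%:E)%E.
Proof.
move=> mb; have mS : measurable [set y | b x y] by exact: mset_near.
rewrite /near_pr -prE//; have := integral_indic nu measurableT mS; rewrite setIT => <-.
apply: eq_integral => y _; rewrite indicE; congr ((nat_of_bool _)%:R%:E).
by apply/idP/idP => [h|/set_mem//]; rewrite mem_set.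
Qed.

Lemma J_expx_bool (b : T -> T -> bool) c : measurable_fun setT (fun p : T * T => b p.1 p.2) ->
  0 <= c -> (forall x, near_pr nu b x <= c) ->
  (J (fun x y => (expq x * (b x y)%:R)%R) <= (c * mexp)%:E)%E.
Proof.
move=> mb c0 h; rewrite J_iter; last by apply: kernM; [exact: kern_expx|exact: kern_bool].
rewrite EFinM -mexpE -ge0_integralZl//; last 2 first.
- by apply/measurable_EFinP; exact: measurable_expq.
- by move=> x _; rewrite lee_fin expq_ge0.
have mbx x : measurable_fun setT (fun y => ((b x y)%:R : R)%:E).
  apply/measurable_EFinP; apply: measurable_natb.
  by apply: (measurable_near mb) => //; exact: measurable_cst.
apply: ge0_le_integral => //.
- by move=> x _; apply: integral_ge0 => y _; rewrite lee_fin mulr_ge0 ?expq_ge0.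
- have [mk _] := kernM kern_expx (kern_bool (R := R) mb).
  have := @measurable_fun_fubini_tonelli_F _ _ _ _ _ nu
    (fun p : T * T => (expq p.1 * (b p.1 p.2)%:R)%:E).
  apply; first exact/measurable_EFinP.
  by move=> p; rewrite lee_fin mulr_ge0 ?expq_ge0.
- by apply: measurable_funeM; apply/measurable_EFinP; exact: measurable_expq.
move=> x _; under eq_integral do rewrite EFinM.
rewrite ge0_integralZl//; last by rewrite lee_fin expq_ge0.
by rewrite int_bool// -!EFinM lee_fin mulrC ler_wpM2r ?expq_ge0.
Qed.

Lemma J_expy_near2 : (J (fun x y => (expq y * (near2 x y)%:R)%R) <= (b2 * mexp)%:E)%E.
Proof.
rewrite J_iter2; last by apply: kernM; [exact: kern_expy|exact: kern_bool].
apply: le_trans (J_expx_bool mnear2 b2_ge0 near2_le).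
rewrite J_iter; last by apply: kernM; [exact: kern_expx|exact: kern_bool].
rewrite le_eqVlt; apply/orP; left; apply/eqP; apply: eq_integral => x _.
by apply: eq_integral => y _; rewrite near2_sym.
Qed.

Let e1 : R := expR 1.
Let e1_ge0 : 0 <= e1. Proof. exact: expR_ge0. Qed.

Let tqq_le1 x y : t * (q x * q y) <= 1.
Proof.
apply: le_trans tb1; rewrite ler_wpM2l ?(ltW t_gt0)// expr2.
by apply: ler_pM; rewrite ?near_pr_ge0.
Qed.

Let tqq_ge0 x y : 0 <= t * (q x * q y).
Proof. by rewrite !mulr_ge0 ?near_pr_ge0 ?(ltW t_gt0). Qed.

Lemma exp_both_far x y : expR (- (t * (1 - a x y))) =
  expR (t * (q x * q y)) * (expq x * expq y).
Proof. by rewrite /expq -!expRD /both_far; congr expR; ring. Qed.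

Lemma exp_both_far_le x y : expR (- (t * (1 - a x y))) <= e1 * (expq x * expq y).
Proof.
by rewrite exp_both_far ler_wpM2r ?mulr_ge0 ?expq_ge0// ler_expR.
Qed.

(** Since t (1 - both_far x y) = t q(x) + t q(y) - t q(x) q(y) and the last term w
is in [0, 1], where exp w is at most 1 + e w. *)
Lemma exp_both_far_le2 x y : expR (- (t * (1 - a x y))) <=
  (1 + e1 * (t * b1 ^+ 2)) * (expq x * expq y).
Proof.
rewrite exp_both_far ler_wpM2r ?mulr_ge0 ?expq_ge0//.
set w := t * (q x * q y).
have w1 : w <= 1 := tqq_le1 x y.
have w0 : 0 <= w := tqq_ge0 x y.
have wb : w <= t * b1 ^+ 2.
  rewrite ler_wpM2l ?(ltW t_gt0)// expr2.
  by apply: ler_pM; rewrite ?near_pr_ge0.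
have h : expR w - 1 <= w * expR w.
  have := expR_ge1Dx (- w); rewrite -(ler_pM2r (expR_gt0 w)) -expRD addNr expR0.
  lra.
have he : expR w <= e1 by rewrite ler_expR.
have : w * expR w <= (t * b1 ^+ 2) * e1 by apply: ler_pM => //; exact: expR_ge0.
lra.
Qed.

(** Poisson-type bound on the mean of errk over the sample size: each isolated pair
contributes a product of two values of expq, or one such value times exp (- t l) for
near pairs. *)
Definition err_kernel (C : R) (x y : T) : R :=
  C * (e1 * t ^+ 2 * expR (- (t * l)) * (expq x * (near x y)%:R)
   + e1 * (2 * b1 * t ^+ 2 + b1 ^+ 2 * t ^+ 3 + t) * (expq x * expq y)
   + 2 * t ^+ 2 * expR (- (t * l)) * (expq x * (near2 x y)%:R + expq y * (near2 x y)%:R)).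

Lemma kern_err_kernel C : 0 <= C -> kern (err_kernel C).
Proof.
move=> C0; have t0 := ltW t_gt0; have el0 : 0 <= expR (- (t * l)) := expR_ge0 _.
apply: kernM; first exact: kern_cst.
have kn := kern_bool (R := R) mnear; have kn2 := kern_bool (R := R) mnear2.
apply: kernD; [apply: kernD|]; apply: kernM.
- by apply: kern_cst; rewrite !mulr_ge0// exprn_ge0.
- by apply: kernM => //; exact: kern_expx.
- by apply: kern_cst; rewrite mulr_ge0// !addr_ge0// ?mulr_ge0 ?exprn_ge0.
- by apply: kernM; [exact: kern_expx|exact: kern_expy].
- by apply: kern_cst; rewrite !mulr_ge0// exprn_ge0.
- by apply: kernD; apply: kernM => //; [exact: kern_expx|exact: kern_expy].
Qed.

(** With t mexp the mean count, the relative error is exp (- t l) times a polynomial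
in t b1 and t b2. *)
Definition err_bound (C : R) : R :=
  C * (t * mexp) * expR (- (t * l)) * (e1 * (t * b1) + e1 * (1 + t * b1) ^+ 2 + 4 * (t * b2)).

Lemma J_err_kernel C : 0 <= C -> (J (err_kernel C) <= (err_bound C)%:E)%E.
Proof.
move=> C0; have t0 := ltW t_gt0; have el0 : 0 <= expR (- (t * l)) := expR_ge0 _.
have kn := kern_bool (R := R) mnear; have kn2 := kern_bool (R := R) mnear2.
have k1 : kern (fun x y => expq x * (near x y)%:R) by apply: kernM => //; exact: kern_expx.
have k2 : kern (fun x y => expq x * expq y) by apply: kernM; [exact: kern_expx|exact: kern_expy].
have k3 : kern (fun x y => expq x * (near2 x y)%:R) by apply: kernM => //; exact: kern_expx.
have k4 : kern (fun x y => expq y * (near2 x y)%:R) by apply: kernM => //; exact: kern_expy.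
pose c1 := e1 * t ^+ 2 * expR (- (t * l)).
pose c2 := e1 * (2 * b1 * t ^+ 2 + b1 ^+ 2 * t ^+ 3 + t).
pose c3 := 2 * t ^+ 2 * expR (- (t * l)).
have c10 : 0 <= c1 by rewrite !mulr_ge0// exprn_ge0.
have c20 : 0 <= c2 by rewrite mulr_ge0// !addr_ge0// ?mulr_ge0 ?exprn_ge0.
have c30 : 0 <= c3 by rewrite !mulr_ge0// exprn_ge0.
have k34 := kernD k3 k4.
have kc1 := kernM (kern_cst c10) k1.
have kc2 := kernM (kern_cst c20) k2.
have kc3 := kernM (kern_cst c30) k34.
have kc12 := kernD kc1 kc2.
rewrite /err_kernel (JZ nu C0 (kernD kc12 kc3)) (JD nu kc12 kc3) (JD nu kc1 kc2).
rewrite (JZ nu c10 k1) (JZ nu c20 k2) (JZ nu c30 k34) (JD nu k3 k4).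
rewrite J_prod; [|exact: measurable_expq|exact: measurable_expq|exact: expq_ge0|exact: expq_ge0].
rewrite mexpE.
apply: (@le_trans _ _ (C%:E * (c1%:E * (b1 * mexp)%:E + c2%:E * (mexp%:E * mexp%:E)
    + c3%:E * ((b2 * mexp)%:E + (b2 * mexp)%:E)))%E).
  apply: lee_wpmul2l; first by rewrite lee_fin.
  apply: leeD; last first.
    apply: lee_wpmul2l; first by rewrite lee_fin.
    by apply: leeD; [exact: J_expx_bool|exact: J_expy_near2].
  rewrite leeD2r//; apply: lee_wpmul2l; first by rewrite lee_fin.
  exact: J_expx_bool.
rewrite lee_fin /err_bound -!mulrA ler_wpM2l//.
rewrite /c1 /c2 /c3.
have m0 := mexp_ge0; have ml := mexp_le.
move: (expR (- (t * l))) mexp m0 ml el0 => E m m0 ml E0.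
have h : e1 * (2 * b1 * t ^+ 2 + b1 ^+ 2 * t ^+ 3 + t) * (m * m) <=
   e1 * t * m * E * (1 + t * b1) ^+ 2.
  have -> : e1 * (2 * b1 * t ^+ 2 + b1 ^+ 2 * t ^+ 3 + t) * (m * m) =
     (e1 * t * m * (1 + t * b1) ^+ 2) * m by ring.
  have -> : e1 * t * m * E * (1 + t * b1) ^+ 2 = (e1 * t * m * (1 + t * b1) ^+ 2) * E by ring.
  by rewrite ler_wpM2l// !mulr_ge0// addr_ge0// mulr_ge0.
lra.
Qed.

Variables (p : nat -> R) (C : R).
Hypothesis p0 : forall k, 0 <= p k.
Hypothesis C_ge0 : 0 <= C.
Hypothesis mix_ffw : forall j v, (j <= 3)%N -> 0 <= v <= 1 ->
  (mix p (fun k => (ffw j v k)%:E) <= (C * (t ^+ j * expR (- (t * (1 - v)))))%:E)%E.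

(** The geometric hypothesis ring_ge turns the probability of the union into one
value of expq and a factor exp (- t l). *)
Lemma exp_ring x y : A x -> A y -> (ring2 near near2 x y)%:R * expR (- (t * u x y)) <=
  expR (- (t * l)) * (expq x * (near2 x y)%:R + expq y * (near2 x y)%:R).
Proof.
move=> Ax Ay; have t0 := ltW t_gt0.
have el0 : 0 <= expR (- (t * l)) := expR_ge0 _.
case: (boolP (ring2 near near2 x y)) => rxy; last first.
  by rewrite mul0r mulr_ge0// addr_ge0// mulr_ge0// expq_ge0.
have /andP[_ ->] := rxy; rewrite mul1r !mulr1 mulrDr.
have [h|h] := ring_ge Ax Ay rxy.
  apply: (@le_trans _ _ (expR (- (t * l)) * expq x)); last first.
    by rewrite lerDl; apply: mulr_ge0; [exact: el0|exact: expq_ge0].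
  by rewrite /expq -expRD ler_expR; nra.
apply: (@le_trans _ _ (expR (- (t * l)) * expq y)); last first.
  by rewrite lerDr; apply: mulr_ge0; [exact: el0|exact: expq_ge0].
by rewrite /expq -expRD ler_expR; nra.
Qed.

Lemma errkE k x y : errk nu near near2 k x y =
  ((near x y)%:R + (q x + q y)) * ffw 2 (a x y) k +
  (2 * (ring2 near near2 x y)%:R * ffw 2 (1 - u x y) k +
   (q x * q y * ffw 3 (a x y) k + ffw 1 (a x y) k)).
Proof.
have e2 : (k - 2)%N = k.-2 by exact: subn2.
have e3 : (k - 3)%N = k.-1.-2 by lia.
rewrite /errk /ffw e2 e3 subn1 ffactn1.
move: (nat_of_bool (near x y))%:R (nat_of_bool (ring2 near near2 x y))%:R => nr r.
move: (k ^_ 2)%:R (k ^_ 3)%:R (k%:R) => k2 k3 k1.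
move: (a x y ^+ k.-2) (a x y ^+ k.-1.-2) (a x y ^+ k.-1) => A2 A3 A1.
move: ((1 - u x y) ^+ k.-2) (q x) (q y) => U2 qx qy.
ring.
Qed.

Lemma mix_errk_pointwise x y : A x -> A y ->
  (mix p (fun k => (errk nu near near2 k x y)%:E) <= (err_kernel C x y)%:E)%E.
Proof.
move=> Ax Ay; have t0 := ltW t_gt0.
have a01 : 0 <= a x y <= 1 by rewrite both_far_ge0//= both_far_le1.
have u01 : 0 <= 1 - u x y <= 1.
  by rewrite subr_ge0 near_pr2_le1//= gerBl near_pr2_ge0.
have qx0 : 0 <= q x := near_pr_ge0 nu near x; have qy0 : 0 <= q y := near_pr_ge0 nu near y.
have /andP[a0 _] := a01; have /andP[u0 _] := u01.
have hr := exp_ring Ax Ay.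
have hn : (near x y)%:R * (expq x * expq y) <= expR (- (t * l)) * (expq x * (near x y)%:R).
  have -> : (near x y)%:R * (expq x * expq y) = (expq x * (near x y)%:R) * expq y.
    by rewrite mulrCA mulrA.
  rewrite mulrC; apply: ler_wpM2r; first by apply: mulr_ge0 => //; exact: expq_ge0.
  by rewrite ler_expR lerN2 ler_wpM2l// q_ge.
have r0 : 0 <= (ring2 near near2 x y)%:R :> R by exact: ler0n.
have nr0 : 0 <= (near x y)%:R :> R by exact: ler0n.
have fE k := errkE k x y.
rewrite /err_kernel.
move: (nat_of_bool (near x y))%:R (nat_of_bool (ring2 near near2 x y))%:R
  (nat_of_bool (near2 x y))%:R hr hn r0 nr0 fE => nr r n2 hr hn r0 nr0 fE.
have f0 j v k : 0 <= v -> (0 <= (ffw j v k)%:E :> \bar R)%E.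
  by move=> v0; rewrite lee_fin ffw_ge0.
have qq0 : 0 <= q x * q y by exact: mulr_ge0.
have s0 : 0 <= nr + (q x + q y) by rewrite !addr_ge0.
have r20 : 0 <= 2 * r by rewrite mulr_ge0.
rewrite (_ : mix p _ = mix p (fun k =>
   (nr + (q x + q y))%:E * (ffw 2 (a x y) k)%:E + ((2 * r)%:E * (ffw 2 (1 - u x y) k)%:E
   + ((q x * q y)%:E * (ffw 3 (a x y) k)%:E + (ffw 1 (a x y) k)%:E)))%E); last first.
  congr (mix p _); apply/funext => k.
  by rewrite fE !EFinD !EFinM.
have M0 c j v : 0 <= c -> 0 <= v -> forall k, (0 <= c%:E * (ffw j v k)%:E)%E.
  by move=> c0 v0 k; rewrite mule_ge0 ?lee_fin ?ffw_ge0.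
rewrite mixD//; last 2 first.
- exact: M0.
- by move=> k; rewrite !adde_ge0 ?M0// f0.
rewrite mixD//; last 2 first.
- exact: M0.
- by move=> k; rewrite !adde_ge0 ?M0// f0.
rewrite mixD//; last 2 first.
- exact: M0.
- by move=> k; exact: f0.
rewrite !mixZ//; try by move=> k; exact: f0.
apply: (@le_trans _ _ ((nr + (q x + q y))%:E * (C * (t ^+ 2 * expR (- (t * (1 - a x y)))))%:E +
  ((2 * r)%:E * (C * (t ^+ 2 * expR (- (t * (1 - (1 - u x y))))))%:E +
   ((q x * q y)%:E * (C * (t ^+ 3 * expR (- (t * (1 - a x y)))))%:E +
    (C * (t ^+ 1 * expR (- (t * (1 - a x y)))))%:E)))%E).
  by repeat apply: leeD; try (apply: lee_wpmul2l; rewrite ?lee_fin//); exact: mix_ffw.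
rewrite -!EFinM -!EFinD lee_fin subKr expr1.
have ha := exp_both_far_le x y.
have x0 := expq_ge0 x; have y0 := expq_ge0 y.
move: (expR (- (t * (1 - a x y)))) (expR (- (t * u x y))) (expR (- (t * l))) hr ha hn
  (expR_ge0 (- (t * (1 - a x y)))) => Ea Eu El hr ha hn Ea0.
have -> : (nr + (q x + q y)) * (C * (t ^+ 2 * Ea)) +
  (2 * r * (C * (t ^+ 2 * Eu)) + (q x * q y * (C * (t ^+ 3 * Ea)) + C * (t * Ea))) =
  C * ((nr * t ^+ 2 + ((q x + q y) * t ^+ 2 + q x * q y * t ^+ 3 + t)) * Ea
       + 2 * t ^+ 2 * (r * Eu)) by ring.
rewrite ler_wpM2l//; apply: lerD; last first.
  by rewrite -[leRHS]mulrA ler_wpM2l// mulr_ge0// exprn_ge0.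
set g := (q x + q y) * t ^+ 2 + q x * q y * t ^+ 3 + t.
have g0 : 0 <= g by rewrite !addr_ge0// !mulr_ge0// ?exprn_ge0// addr_ge0.
have gb : g <= 2 * b1 * t ^+ 2 + b1 ^+ 2 * t ^+ 3 + t.
  rewrite lerD2r; apply: lerD; rewrite ler_wpM2r ?exprn_ge0//.
    by rewrite mulrDl mul1r lerD.
  by rewrite expr2 ler_pM.
apply: (@le_trans _ _ ((nr * t ^+ 2 + g) * (e1 * (expq x * expq y)))).
  by rewrite ler_wpM2l// addr_ge0// mulr_ge0// exprn_ge0.
rewrite mulrDl; apply: lerD.
  have -> : nr * t ^+ 2 * (e1 * (expq x * expq y)) =
    e1 * t ^+ 2 * (nr * (expq x * expq y)) by ring.
  by rewrite -[leRHS]mulrA ler_wpM2l// mulr_ge0// exprn_ge0.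
by rewrite mulrA [g * e1]mulrC ler_wpM2r ?mulr_ge0// ler_wpM2l.
Qed.

Lemma mix_J_errk : (mix p (fun k => J (errk nu near near2 k)) <= (err_bound C)%:E)%E.
Proof.
apply: le_trans (J_err_kernel C_ge0).
have kE k : kern (errk nu near near2 k) by exact: kern_errk.
have mE k : measurable_fun setT (fun z : T * T => ((p k)%:E * (errk nu near near2 k z.1 z.2)%:E)%E).
  by apply: measurable_funeM; apply/measurable_EFinP; case: (kE k).
have E0 k (z : T * T) : (0 <= (p k)%:E * (errk nu near near2 k z.1 z.2)%:E)%E.
  by rewrite mule_ge0 ?lee_fin//; case: (kE k).
have -> : mix p (fun k => J (errk nu near near2 k)) =
  (\int[nu \x nu]_z \sum_(k <oo) ((p k)%:E * (errk nu near near2 k z.1 z.2)%:E))%E.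
  rewrite integral_nneseries//; apply: eq_eseriesr => k _.
  rewrite ge0_integralZl ?lee_fin//.
  - by apply/measurable_EFinP; case: (kE k).
  - by move=> z _; rewrite lee_fin; case: (kE k).
have mAA : measurable (A `*` A) by exact: measurableX.
have [mK K0] := kern_err_kernel C_ge0.
have mS : measurable_fun setT (fun z : T * T =>
    \sum_(k <oo) ((p k)%:E * (errk nu near near2 k z.1 z.2)%:E))%E.
  exact: ge0_emeasurable_sum.
have S0 (z : T * T) : (0 <= \sum_(k <oo) ((p k)%:E * (errk nu near near2 k z.1 z.2)%:E))%E.
  exact: nneseries_ge0.
rewrite /pair_int (ge0_negligible_integral (N := ~` (A `*` A)))//; last 2 first.
- exact: measurableC.
- exact: nuX_A.
rewrite [leRHS](ge0_negligible_integral (N := ~` (A `*` A)))//; last 4 first.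
- exact: measurableC.
- exact/measurable_EFinP.
- by move=> z _; rewrite lee_fin.
- exact: nuX_A.
rewrite setTD setCK; apply: ge0_le_integral => //.
- exact: measurable_funTS.
- by apply/measurable_EFinP; exact: measurable_funTS.
- by move=> [x y] [/= Ax Ay]; exact: mix_errk_pointwise.
Qed.

End kernel_bounds.

(** * Mean of the count, and fluctuation of the mean over the sample size *)

Section mix_integral.
Context {R : realType} {d : measure_display} {S : measurableType d}.

Lemma mix_integral (m : {measure set S -> \bar R}) (p : nat -> R) (F : nat -> S -> R) :
  (forall k, 0 <= p k) -> (forall k, measurable_fun setT (F k)) ->
  (forall k x, 0 <= F k x) ->
  mix p (fun k => (\int[m]_x (F k x)%:E)%E) =
  (\int[m]_x mix p (fun k => (F k x)%:E))%E.
Proof.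
move=> p0 mF F0; rewrite /mix integral_nneseries//; last 2 first.
- by move=> k; apply: measurable_funeM; exact/measurable_EFinP.
- by move=> k x _; rewrite mule_ge0 ?lee_fin.
apply: eq_eseriesr => k _; rewrite ge0_integralZl ?lee_fin//.
- exact/measurable_EFinP.
- by move=> x _; rewrite lee_fin.
Qed.
End mix_integral.

Section mean_bounds.
Context {R : realType} {d : measure_display} {T : measurableType d}.
Variable nu : probability T R.
Variable Q : probability (@traj d T) R.
Hypothesis Qiid : iid_law nu Q.
Variable near : T -> T -> bool.
Hypothesis mnear : measurable_fun setT (fun p : T * T => near p.1 p.2).
Hypothesis near_sym : forall x y, near x y = near y x.
Variable A : set T.
Hypothesis mA : measurable A.
Hypothesis nuA : nu A = 1%E.
Variables t l b1 : R.
Hypothesis t_gt0 : 0 < t.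
Hypothesis b1_ge0 : 0 <= b1.
Local Notation q := (near_pr nu near).
Local Notation a := (both_far nu near).
Hypothesis q_le : forall x, q x <= b1.
Hypothesis q_ge : forall x, A x -> l <= q x.
Hypothesis l_ge0 : 0 <= l.
Hypothesis tb1 : t * b1 ^+ 2 <= 1.
Local Notation lam := (count_mean Q near).
Local Notation m := (mexp nu near t).

Let q0 x : 0 <= q x. Proof. exact: near_pr_ge0. Qed.
Let q1 x : q x <= 1. Proof. exact: near_pr_le1. Qed.
Let cq0 x : 0 <= 1 - q x. Proof. by rewrite subr_ge0. Qed.
Let mq : measurable_fun setT q. Proof. exact: measurable_near_pr. Qed.
Let mcq n : measurable_fun setT (fun x => (1 - q x) ^+ n).
Proof. by apply: measurable_funX; exact: measurable_funB. Qed.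
Let pmf0 k : 0 <= poisson_pmf t k. Proof. exact: poisson_pmf_ge0. Qed.

Let lamE k : (lam k)%:E = (\int[nu]_x (ffw 1 (1 - q x) k)%:E)%E.
Proof.
rewrite (count_meanE Qiid mnear) -ge0_integralZl ?lee_fin//.
- by apply: eq_integral => x _; rewrite /ffw ffactn1 subn1 EFinM.
- exact/measurable_EFinP.
- by move=> x _; rewrite lee_fin exprn_ge0.
Qed.

Lemma poisson_mean : mix (poisson_pmf t) (fun k => (lam k)%:E) = (t * m)%:E.
Proof.
under [X in mix _ X]eq_fun do rewrite lamE.
rewrite mix_integral//; last 2 first.
- by move=> k; apply: measurable_funM => //; exact: mcq.
- by move=> k x; exact: ffw_ge0.
under eq_integral do rewrite mix_poisson// subKr expr1 EFinM.
rewrite ge0_integralZl ?lee_fin ?(ltW t_gt0)//.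
- by rewrite EFinM -(mexpE _ mnear).
by apply/measurable_EFinP; exact: measurable_expq.
Qed.

(** The square of the conditional mean is an integral over pairs of n^2
both_far^(n-1), and n^2 = n (n - 1) + n; its Poisson mean exceeds the square of the
mean by the correlation term of exp_both_far_le2 and by a diagonal term. *)
Lemma poisson_mean_square : (mix (poisson_pmf t) (fun k => (lam k ^+ 2)%:E) <=
  ((t * m) ^+ 2 + t * m * expR (- (t * l)) * (expR 1 * (t * b1) ^+ 2 + 1 + expR 1))%:E)%E.
Proof.
have t0 := ltW t_gt0.
pose G k x y := ffw 2 (a x y) k + ffw 1 (a x y) k.
have a0 x y : 0 <= a x y by exact: both_far_ge0.
have kG k : kern (G k).
  have kX n : kern (fun x y => a x y ^+ n) by apply: kernX; exact: kern_both_far.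
  have kc (c : R) : 0 <= c -> kern (fun _ _ : T => c) by exact: kern_cst.
  by apply: kernD; apply: kernM; [exact: kc|exact: kX|exact: kc|exact: kX].
apply: (@le_trans _ _ (mix (poisson_pmf t) (fun k => pair_int nu (G k)))).
  apply: mix_le => // k; first by rewrite lee_fin sqr_ge0.
  rewrite expr2 EFinM lamE -J_prod//; last 4 first.
  - by apply: measurable_funM => //; exact: mcq.
  - by apply: measurable_funM => //; exact: mcq.
  - by move=> x; exact: ffw_ge0.
  - by move=> x; exact: ffw_ge0.
  apply: J_le => //.
    split => [|x y]; last by rewrite mulr_ge0 ?ffw_ge0.
    apply: measurable_funM; apply: measurable_funM => //.
      by apply: (measurableT_comp (mcq _)); exact: measurable_fst.
    by apply: (measurableT_comp (mcq _)); exact: measurable_snd.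
  move=> x y; rewrite /G /ffw !ffactn1 subn1.
  have -> : k%:R * (1 - q x) ^+ k.-1 * (k%:R * (1 - q y) ^+ k.-1) =
     k%:R * k%:R * a x y ^+ k.-1 by rewrite /both_far exprMn; ring.
  case: k => [|k]; first by rewrite ffact_small// !mul0r addr0.
  case: k => [|k]; first by rewrite ffact_small// mul0r add0r !mul1r.
  have -> : (k.+2 ^_ 2 = k.+2 * k.+1)%N by rewrite ffactnS ffactn1.
  rewrite subSS subn1 /= exprS natrM.
  have a1 : a x y <= 1 by exact: both_far_le1.
  have k0 : 0 <= k%:R :> R by [].
  rewrite -!natr1; move: (k%:R) k0 (a x y ^+ k) (exprn_ge0 k (a0 x y)) => z z0 w w0.
  have : 0 <= (z + 1 + 1) * (z + 1) * w * (1 - a x y).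
    have a2 : 0 <= 1 - a x y by rewrite subr_ge0.
    by apply: mulr_ge0 a2; rewrite !mulr_ge0// !addr_ge0.
  move: (a x y) => v; lra.
rewrite /pair_int mix_integral//; last 2 first.
- by move=> k; case: (kG k).
- by move=> k x; case: (kG k).
have kK : kern (fun x y => (t ^+ 2 + t) * (1 + expR 1 * (t * b1 ^+ 2)) *
    (expq nu near t x * expq nu near t y)).
  apply: kernM.
    by apply: kern_cst; rewrite mulr_ge0// addr_ge0// ?sqr_ge0// !mulr_ge0 ?sqr_ge0 ?expR_ge0.
  by apply: kernM; [exact: kern_expx|exact: kern_expy].
have mixG x y : mix (poisson_pmf t) (fun k => (G k x y)%:E) =
    ((t ^+ 2 + t) * expR (- (t * (1 - a x y))))%:E.
  rewrite (_ : mix _ _ = mix (poisson_pmf t) (fun k => (ffw 2 (a x y) k)%:E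
      + (ffw 1 (a x y) k)%:E)%E)//.
  rewrite mixD//; try by move=> k; rewrite lee_fin ffw_ge0.
  by rewrite !mix_poisson// -EFinD expr1 mulrDl.
apply: (@le_trans _ _ (pair_int nu (fun x y => (t ^+ 2 + t) * (1 + expR 1 * (t * b1 ^+ 2)) *
    (expq nu near t x * expq nu near t y))%R)).
  apply: ge0_le_integral => //.
  - by move=> z _; rewrite mixG lee_fin mulr_ge0 ?expR_ge0// addr_ge0// sqr_ge0.
  - apply: ge0_emeasurable_sum => k; last first.
      by move=> _; apply: measurable_funeM; apply/measurable_EFinP; case: (kG k).
    by move=> z _ _; case: (kG k) => _ G0; rewrite mule_ge0 ?lee_fin.
  - by apply/measurable_EFinP; case: kK.
  move=> [x y] _ /=; rewrite mixG lee_fin -mulrA ler_wpM2l ?addr_ge0 ?sqr_ge0//.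
  exact: exp_both_far_le2.
rewrite JZ; last 2 first.
- by rewrite mulr_ge0// addr_ge0// ?sqr_ge0// !mulr_ge0 ?sqr_ge0 ?expR_ge0.
- by apply: kernM; [exact: kern_expx|exact: kern_expy].
rewrite J_prod//; [|exact: measurable_expq|exact: measurable_expq|exact: expq_ge0|exact: expq_ge0].
rewrite (mexpE _ mnear t_gt0) -!EFinM lee_fin.
have m0 : 0 <= m := mexp_ge0 nu near t.
have ml : m <= expR (- (t * l)) by exact: (mexp_le mnear mA nuA t_gt0).
have e0 : 0 <= expR 1 :> R := expR_ge0 _.
move: (expR (- (t * l))) ml => E mE; move: m m0 mE => M M0 mE; move: (expR 1) e0 => e e0.
have -> : (t ^+ 2 + t) * (1 + e * (t * b1 ^+ 2)) * (M * M) =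
  (t * M) ^+ 2 + t * M * M * (e * (t * b1) ^+ 2 + 1 + e * (t * b1 ^+ 2)) by ring.
rewrite lerD2l.
have w0 : 0 <= t * b1 ^+ 2 by rewrite mulr_ge0// sqr_ge0.
have ew : e * (t * b1 ^+ 2) <= e by rewrite ler_piMr.
have ew0 : 0 <= e * (t * b1 ^+ 2) by rewrite mulr_ge0.
have v0 : 0 <= e * (t * b1) ^+ 2 by rewrite mulr_ge0// sqr_ge0.
apply: ler_pM.
- by rewrite !mulr_ge0.
- by lra.
- by rewrite ler_wpM2l// mulr_ge0.
- by lra.
Qed.

End mean_bounds.

Section binomial_mean.
Context {R : realType} {d : measure_display} {T : measurableType d}.
Variable nu : probability T R.
Variable Q : probability (@traj d T) R.
Hypothesis Qiid : iid_law nu Q.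
Variable near : T -> T -> bool.
Hypothesis mnear : measurable_fun setT (fun p : T * T => near p.1 p.2).
Variable b1 : R.
Hypothesis b1_le : 2 * b1 <= 1.
Local Notation q := (near_pr nu near).
Hypothesis q_le : forall x, q x <= b1.
Variable n : nat.
Hypothesis n_gt0 : (0 < n)%N.
Local Notation lam := (count_mean Q near).
Local Notation m := (mexp nu near n%:R).

Let n0 : 0 < n%:R :> R. Proof. by rewrite ltr0n. Qed.
Let q0 x : 0 <= q x. Proof. exact: near_pr_ge0. Qed.
Let b0 : 0 <= b1. Proof. exact: le_trans (q0 point) (q_le point). Qed.
Let mq : measurable_fun setT q. Proof. exact: measurable_near_pr. Qed.

Lemma pow_le_exp x : (1 - q x) ^+ n.-1 <= (1 + 2 * b1) * expq nu near n%:R x.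
Proof.
have qx := q_le x; have qx0 := q0 x.
apply: (@le_trans _ _ (expR (- q x) ^+ n.-1)).
  have h1 : 0 <= 1 - q x by rewrite subr_ge0 near_pr_le1.
  by rewrite lerXn2r// ?nnegrE ?expR_ge0//; exact: expR_ge1Dx.
rewrite -expRM_natl /expq.
have -> : - (n%:R * q x) = n.-1%:R * - q x + - q x.
  by rewrite -{1}(prednK n_gt0) -natr1; ring.
rewrite expRD mulrCA -[leLHS]mulr1 ler_wpM2l ?expR_ge0//.
move: (expR (- q x)) (expR_ge1Dx (- q x)) => E h.
move: (q x) qx qx0 h => y y1 y0 h.
have b1' := b1_le.
have h1 : (1 + 2 * y) * (1 - y) <= (1 + 2 * b1) * E.
  by apply: ler_pM; [lra|lra|lra|].
have h2 : 0 <= y * (1 - 2 * y) by apply: mulr_ge0; lra.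
lra.
Qed.

(** By 1 - q >= exp (- q / (1 - q)) >= exp (- q - 2 q^2). *)
Lemma exp_le_pow x : (1 - 2 * n%:R * b1 ^+ 2) * expq nu near n%:R x <= (1 - q x) ^+ n.-1.
Proof.
have qx := q_le x; have qx0 := q0 x.
have b1' := b1_le; have p0 : 0 < 1 - q x by move: (q x) qx qx0 => y; lra.
apply: (@le_trans _ _ ((1 - q x) ^+ n)); last first.
  by rewrite -{1}(prednK n_gt0) exprS ler_piMl ?exprn_ge0//; lra.
apply: (@le_trans _ _ (expR (- (q x + 2 * q x ^+ 2)) ^+ n)); last first.
  rewrite lerXn2r// ?nnegrE ?expR_ge0 ?(ltW p0)//.
  have h := expR_ge1Dx (q x / (1 - q x)).
  have e : 1 + q x / (1 - q x) = (1 - q x)^-1 by field; rewrite gt_eqF.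
  rewrite e in h.
  have h2 : expR (- (q x / (1 - q x))) <= 1 - q x.
    by rewrite expRN -[leRHS]invrK lef_pV2// ?posrE ?expR_gt0 ?invr_gt0.
  apply: le_trans h2; rewrite ler_expR lerN2 ler_pdivrMr//.
  have : 0 <= q x ^+ 2 * (1 - 2 * q x) by rewrite mulr_ge0 ?sqr_ge0//; lra.
  by rewrite -subr_ge0; lra.
rewrite -expRM_natl mulrN mulrDr opprD expRD mulrC ler_wpM2l ?expR_ge0//.
have := expR_ge1Dx (- (n%:R * (2 * q x ^+ 2))).
have : n%:R * q x ^+ 2 <= n%:R * b1 ^+ 2 by rewrite ler_wpM2l ?(ltW n0)// lerXn2r// nnegrE.
lra.
Qed.

Lemma binomial_mean :
  `|lam n - n%:R * m| <= n%:R * m * (2 * b1 + 2 * (n%:R * b1 ^+ 2)).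
Proof.
have mc : measurable_fun setT (fun x => (1 - q x) ^+ n.-1).
  by apply: measurable_funX; exact: measurable_funB.
have c0 x : 0 <= (1 - q x) ^+ n.-1 by rewrite exprn_ge0// subr_ge0 near_pr_le1.
have ex0 x : 0 <= expq nu near n%:R x := expq_ge0 nu near n%:R x.
have mex : measurable_fun setT (expq nu near n%:R) by exact: measurable_expq.
have nn : 0 <= 2 * n%:R * b1 ^+ 2 by rewrite mulr_ge0 ?sqr_ge0.
have m0 : 0 <= m := mexp_ge0 nu near n%:R.
have up : lam n <= n%:R * ((1 + 2 * b1) * m).
  rewrite -lee_fin (count_meanE Qiid mnear) EFinM lee_wpmul2l ?lee_fin//.
  rewrite EFinM -(mexpE _ mnear n0) -ge0_integralZl//; last 3 first.
  - exact/measurable_EFinP.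
  - by move=> x _; rewrite lee_fin.
  - by rewrite lee_fin addr_ge0// mulr_ge0.
  apply: ge0_le_integral => //.
  - by move=> x _; rewrite lee_fin.
  - exact/measurable_EFinP.
  - by apply: measurable_funeM; exact/measurable_EFinP.
  by move=> x _; rewrite -EFinM lee_fin pow_le_exp.
have lo : n%:R * m <= lam n + 2 * n%:R * b1 ^+ 2 * (n%:R * m).
  rewrite -lee_fin EFinD (count_meanE Qiid mnear) EFinM.
  have -> : (2 * n%:R * b1 ^+ 2 * (n%:R * m))%:E = (n%:R%:E * (2 * n%:R * b1 ^+ 2 * m)%:E)%E.
    by rewrite -EFinM; congr (_%:E); ring.
  rewrite -ge0_muleDr ?lee_fin ?mulr_ge0//; last first.
    by apply: integral_ge0 => x _; rewrite lee_fin.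
  rewrite lee_wpmul2l ?lee_fin// EFinM -(mexpE _ mnear n0) -ge0_integralZl//; last 2 first.
  - exact/measurable_EFinP.
  - by move=> x _; rewrite lee_fin.
  rewrite -ge0_integralD//; last 4 first.
  - by move=> x _; rewrite lee_fin.
  - exact/measurable_EFinP.
  - by move=> x _; rewrite -EFinM lee_fin mulr_ge0.
  - by apply: measurable_funeM; exact/measurable_EFinP.
  apply: ge0_le_integral => //.
  - by move=> x _; rewrite lee_fin.
  - exact/measurable_EFinP.
  - apply: emeasurable_funD; first exact/measurable_EFinP.
    by apply: measurable_funeM; exact/measurable_EFinP.
  move=> x _; rewrite -EFinM -EFinD lee_fin; have := exp_le_pow x.
  lra.
have nm0 : 0 <= n%:R * m by rewrite mulr_ge0.
have b20 : 0 <= n%:R * m * b1 by rewrite mulr_ge0.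
have b30 : 0 <= n%:R * m * (n%:R * b1 ^+ 2) by rewrite mulr_ge0// mulr_ge0// sqr_ge0.
rewrite ler_norml; apply/andP; split; lra.
Qed.

End binomial_mean.

(** * Euclidean norm and interior cones *)

Section euclid.
Context {R : realType} {d : nat}.
Implicit Types u v x y : 'rV[R]_d.

Definition dot u v : R := \sum_(i < d) u 0 i * v 0 i.
Definition enorm v : R := Num.sqrt (dot v v).

Lemma edistE x y : Defs.edist x y = enorm (x - y).
Proof.
rewrite /Defs.edist /enorm /dot; congr Num.sqrt; apply: eq_bigr => i _.
by rewrite !mxE expr2.
Qed.

Lemma dot_ge0 v : 0 <= dot v v.
Proof. by apply: sumr_ge0 => i _; rewrite -expr2 sqr_ge0. Qed.

Lemma dotC u v : dot u v = dot v u.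
Proof. by apply: eq_bigr => i _; rewrite mulrC. Qed.

Lemma dotDl u v w : dot (u + v) w = dot u w + dot v w.
Proof. by rewrite /dot -big_split; apply: eq_bigr => i _; rewrite !mxE mulrDl. Qed.

Lemma dotZl (a : R) u w : dot (a *: u) w = a * dot u w.
Proof. by rewrite /dot mulr_sumr; apply: eq_bigr => i _; rewrite !mxE mulrA. Qed.

Lemma dotDr u v w : dot w (u + v) = dot w u + dot w v.
Proof. by rewrite dotC dotDl !(dotC w). Qed.

Lemma dotZr (a : R) u w : dot w (a *: u) = a * dot w u.
Proof. by rewrite dotC dotZl dotC. Qed.

Lemma enorm_ge0 v : 0 <= enorm v. Proof. exact: sqrtr_ge0. Qed.

Lemma enorm2 v : enorm v ^+ 2 = dot v v.
Proof. by rewrite sqr_sqrtr// dot_ge0. Qed.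

Lemma enormZ (a : R) v : enorm (a *: v) = `|a| * enorm v.
Proof. by rewrite /enorm dotZl dotZr mulrA -expr2 sqrtrM ?sqr_ge0// sqrtr_sqr. Qed.

Lemma enormN v : enorm (- v) = enorm v.
Proof. by rewrite -scaleN1r enormZ normrN1 mul1r. Qed.

Lemma enorm0_eq0 v : enorm v = 0 -> v = 0.
Proof.
move=> v0; have /eqP : dot v v = 0 by rewrite -enorm2 v0 expr0n.
rewrite psumr_eq0 => [/allP h|i _]; last by rewrite -expr2 sqr_ge0.
apply/rowP => i; rewrite mxE; have := h i; rewrite mem_index_enum => /(_ isT).
by rewrite -expr2 sqrf_eq0 => /eqP.
Qed.

(** Cauchy-Schwarz, from the sign of the square of (enorm v) u - (enorm u) v. *)
Lemma dot_le u v : dot u v <= enorm u * enorm v.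
Proof.
have h s t : 0 <= s ^+ 2 * dot u u - 2 * (s * t) * dot u v + t ^+ 2 * dot v v.
  have := dot_ge0 (s *: u + (- t) *: v).
  rewrite dotDl !dotDr !dotZl !dotZr [dot v u]dotC.
  by move=> /le_trans; apply; rewrite le_eqVlt; apply/orP; left; apply/eqP; ring.
have dot0 w : dot w 0 = 0 by rewrite /dot big1// => i _; rewrite mxE mulr0.
have [/enorm0_eq0 ->|u0] := eqVneq (enorm u) 0.
  by rewrite dotC dot0 mulr_ge0 ?enorm_ge0.
have [/enorm0_eq0 ->|v0] := eqVneq (enorm v) 0.
  by rewrite dot0 mulr_ge0 ?enorm_ge0.
have up : 0 < enorm u by rewrite lt_neqAle eq_sym u0 enorm_ge0.
have vp : 0 < enorm v by rewrite lt_neqAle eq_sym v0 enorm_ge0.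
have := h (enorm v) (enorm u); rewrite -!enorm2.
have -> : enorm v ^+ 2 * enorm u ^+ 2 - 2 * (enorm v * enorm u) * dot u v +
   enorm u ^+ 2 * enorm v ^+ 2 = 2 * (enorm u * enorm v) * (enorm u * enorm v - dot u v).
  by ring.
by rewrite pmulr_rge0 ?subr_ge0// !mulr_gt0.
Qed.

Lemma enormD u v : enorm (u + v) <= enorm u + enorm v.
Proof.
rewrite -(@ler_pXn2r _ 2)// ?nnegrE ?addr_ge0 ?enorm_ge0//.
rewrite enorm2 sqrrD !enorm2 dotDl !dotDr [dot v u]dotC.
have := dot_le u v; lra.
Qed.

Lemma edist_triangle x y z : Defs.edist x y <= Defs.edist x z + Defs.edist z y.
Proof. by rewrite !edistE -[x - y](subrKA z) enormD. Qed.

Lemma edistC x y : Defs.edist x y = Defs.edist y x.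
Proof. by rewrite !edistE -enormN opprB. Qed.

Lemma coord_le_enorm v i : `|v 0 i| <= enorm v.
Proof.
rewrite -sqrtr_sqr ler_wsqrtr// expr2 /dot (bigD1 i)//= lerDl.
by apply: sumr_ge0 => j _; rewrite -expr2 sqr_ge0.
Qed.

Lemma enorm_le v (c : R) : (forall i, `|v 0 i| <= c) -> enorm v <= d%:R * c.
Proof.
move=> h; have h2 (i : 'I_d) : 0 <= c by exact: le_trans (normr_ge0 _) (h i).
have [c0|c0] := leP 0 c; last first.
  have [e|d0] := posnP d; last by have := h2 (Ordinal d0); rewrite leNgt c0.
  have -> : d%:R = 0 :> R by rewrite e.
  by rewrite mul0r /enorm /dot big1 ?sqrtr0// => i; have := h2 i; rewrite leNgt c0.
rewrite -(@ler_pXn2r _ 2)// ?nnegrE ?mulr_ge0 ?enorm_ge0//.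
rewrite enorm2 /dot; apply: (@le_trans _ _ (\sum_(i < d) c ^+ 2)).
  apply: ler_sum => i _; rewrite -expr2 -real_normK ?num_real//.
  by rewrite lerXn2r// nnegrE.
rewrite sumr_const card_ord -[leLHS]mulr_natl exprMn ler_wpM2r ?sqr_ge0//.
by rewrite -natrX ler_nat; case: (d) => // n; rewrite expnS leq_pmulr// expn_gt0.
Qed.

Lemma rv_ballP x (e : R) y : 0 < e ->
  (ball x e y <-> forall j, `|x 0 j - y 0 j| < e).
Proof.
move=> e0; split => [[_ h] j|h]; first exact: h.
by split => // i j; rewrite (ord1 i); exact: h.
Qed.

Lemma enorm_rot (Q : 'M[R]_d) v : Q *m Q^T = 1%:M -> enorm (v *m Q) = enorm v.
Proof.
have dE w : dot w w = (w *m w^T) 0 0.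
  by rewrite mxE; apply: eq_bigr => i _; rewrite mxE.
by move=> QQ; rewrite /enorm !dE trmx_mul mulmxA -(mulmxA v) QQ mulmx1.
Qed.

End euclid.

Section cone.
Context {R : realType} {d : nat}.
Implicit Types x y : 'rV[R]_d.

(** A thick cone with axis u, of size e, fits in A at every point of A near x.
The axis need not be a unit vector; at an interior point one may take u = 0. *)
Definition cone (A : set 'rV[R]_d) (x : 'rV[R]_d) (e : R) : Prop :=
  exists2 u, enorm u <= 1 & forall y, A y -> ball x e y ->
    forall b s, enorm b <= 1 -> 0 < s <= e -> A (y + s *: (u + e *: b)).

Lemma cone_shrink A x y e e' : 0 < e' <= e -> ball x (e - e') y -> cone A x e -> cone A y e'.
Proof.
move=> /andP[e'0 e'e] xy [u u1 h]; exists u => // z Az yz b s b1 /andP[s0 se'].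
have e0 : 0 < e by exact: lt_le_trans e'e.
have -> : u + e' *: b = u + e *: ((e' / e) *: b) by rewrite scalerA mulrC divfK// gt_eqF.
apply: h => //.
- by have := ball_triangle xy yz; rewrite subrK.
- rewrite enormZ ger0_norm ?divr_ge0 ?(ltW e'0) ?(ltW e0)//.
  by apply: mulr_ile1; rewrite ?enorm_ge0 ?divr_ge0 ?(ltW e'0) ?(ltW e0)// ler_pdivrMr ?mul1r.
- by rewrite s0 (le_trans se').
Qed.

(** A cone of size e at x is a cone of size e / 2 at each point within e / 2 of x;
compactness makes the size uniform. *)
Lemma uniform_cone A : compact A -> (forall x, A x -> exists2 e, 0 < e & cone A x e) ->
  exists2 e, 0 < e <= 1 & forall x, A x -> cone A x e.
Proof.
move=> /compact_near_coveringP cA hA.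
have : \forall e \near 0^'+, A `<=` (fun x => cone A x e).
  apply: (cA _ (0^'+) (fun e x => cone A x e)) => x Ax.
  have [e e0 c] := hA x Ax.
  near=> y e' => /=.
  have e'1 : e' <= e / 2 by near: e'; exact/nbhs_right_le/divr_gt0.
  apply: (@cone_shrink A x y e) c.
    apply/andP; split; first by near: e'; exact: nbhs_right_gt.
    by apply: (le_trans e'1); rewrite ler_pdivrMr// ler_peMr ?(ltW e0)// ler1n.
  apply: (@le_ball _ _ x (e / 2)); first by lra.
  by near: y; apply: nbhsx_ballx; rewrite divr_gt0.
move=> H; near (0 : R)^'+ => e; exists e; last first.
  by move=> x Ax; move: x Ax; near: e.
apply/andP; split; first by near: e; exact: nbhs_right_gt.
by near: e; exact: nbhs_right_le.
Unshelve. all: by end_near. Qed.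

(** The ball of radius r e / 2 at x + (r / 2) u, hence a smaller one, is in the
cone. *)
Lemma cone_ball A e x r : cone A x e -> 0 < e <= 1 -> A x -> 0 < r < e ->
  exists z, forall w, Defs.edist z w <= r * e / 4 -> A w /\ Defs.edist x w <= r.
Proof.
move=> [u u1 h] /andP[e0 e1] Ax /andP[r0 re].
exists (x + (r / 2) *: u) => w zw.
have xw : w - x = (r / 2) *: (u + e *: ((r / 2 * e)^-1 *: (w - (x + (r / 2) *: u)))).
  rewrite scalerDr 2!scalerA mulfV ?scale1r; last by rewrite gt_eqF// mulr_gt0// divr_gt0.
  by apply/rowP => i; rewrite !mxE; ring.
have r2 : 0 < r / 2 * e by rewrite mulr_gt0// divr_gt0.
have b1 : enorm ((r / 2 * e)^-1 *: (w - (x + (r / 2) *: u))) <= 1.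
  rewrite enormZ gtr0_norm ?invr_gt0// mulrC ler_pdivrMr// mul1r -edistE edistC.
  by apply: (le_trans zw); nra.
split.
  rewrite -[w](subrK x) addrC xw; apply: h => //; first exact: ballxx.
  by apply/andP; split; nra.
rewrite edistC edistE xw enormZ gtr0_norm ?divr_gt0//.
apply: (@le_trans _ _ (r / 2 * (1 + e))).
  rewrite ler_wpM2l ?divr_ge0 ?(ltW r0)//; apply: (le_trans (enormD _ _)).
  by apply: lerD => //; rewrite enormZ gtr0_norm// ler_piMr// ltW.
by nra.
Qed.

(** Let v = (y - x) / |y - x|, and say that v has a nonnegative product with the
axis u of the cone; otherwise exchange x and y. Moving from y by (r / 2) (u + (e /
2) v), and then inside a ball of radius r e / 4, never comes closer to x than y is,
so it stays out of the ball of radius r at x. *)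
Lemma cone_escape A e x y r : cone A x e -> 0 < e <= 1 -> A x -> A y ->
  0 < r -> 2 * r < e -> r < Defs.edist x y <= 2 * r ->
  exists z, (forall w, Defs.edist z w <= r * e / 4 ->
      [/\ A w, Defs.edist y w <= r & r < Defs.edist x w]) \/
    (forall w, Defs.edist z w <= r * e / 4 ->
      [/\ A w, Defs.edist x w <= r & r < Defs.edist y w]).
Proof.
move=> [u u1 h] /andP[e0 e1] Ax Ay r0 re /andP[rxy xy2r].
have main a b : A a -> A b -> ball x e b -> r < Defs.edist a b -> 0 <= dot (b - a) u ->
    exists z, forall w, Defs.edist z w <= r * e / 4 ->
      [/\ A w, Defs.edist b w <= r & r < Defs.edist a w].
  move=> Aa Ab xb rab duv.
  set D := Defs.edist a b in rab; have D0 : 0 < D by exact: lt_trans rab.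
  have [v v1 bav] : exists2 v, enorm v = 1 & b - a = D *: v.
    exists (D^-1 *: (b - a)); last by rewrite scalerA mulfV ?scale1r// gt_eqF.
    by rewrite enormZ gtr0_norm ?invr_gt0// -edistE edistC mulVf// gt_eqF.
  have s0 : 0 < r / 2 by rewrite divr_gt0.
  exists (b + (r / 2) *: (u + (e / 2) *: v)) => w zw.
  pose c := (r * e / 4)^-1 *: (w - (b + (r / 2) *: (u + (e / 2) *: v))).
  have re4 : 0 < r * e / 4 by rewrite divr_gt0// mulr_gt0.
  have c1 : enorm c <= 1.
    by rewrite enormZ gtr0_norm ?invr_gt0// mulrC ler_pdivrMr// mul1r -edistE edistC.
  have wE : w = b + (r / 2) *: (u + e *: (2^-1 *: (v + c))).
    have cE : w - (b + (r / 2) *: (u + (e / 2) *: v)) = (r * e / 4) *: c.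
      by rewrite /c [RHS]scalerA mulfV ?scale1r// gt_eqF.
    rewrite -[LHS](subrK (b + (r / 2) *: (u + (e / 2) *: v))) cE; move: (c) (v) => c' v'.
    by apply/rowP => i; rewrite !mxE; field.
  have b1 : enorm (2^-1 *: (v + c)) <= 1.
    rewrite enormZ ger0_norm// mulrC ler_pdivrMr// mul1r.
    by apply: (le_trans (enormD _ _)); rewrite v1; lra.
  have wb : Defs.edist b w <= r.
    rewrite edistC edistE {1}wE addrC addKr enormZ gtr0_norm//.
    apply: (@le_trans _ _ (r / 2 * (1 + e))).
      rewrite ler_wpM2l ?(ltW s0)//; apply: (le_trans (enormD _ _)).
      by apply: lerD => //; rewrite enormZ gtr0_norm// ler_piMr// ltW.
    by nra.
  split => //.
    by rewrite wE; apply: h => //; apply/andP; split => //; nra.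
  rewrite edistC edistE.
  have dv : dot (w - a) v <= enorm (w - a) by have := dot_le (w - a) v; rewrite v1 mulr1.
  apply: lt_le_trans dv.
  have -> : w - a = (b - a) + (r / 2) *: (u + e *: (2^-1 *: (v + c))).
    by rewrite {1}wE addrAC.
  move: (c) c1 => c' c1'.
  rewrite bav dotDl !dotZl dotDl !dotZl dotDl.
  have vv : dot v v = 1 by rewrite -enorm2 v1 expr1n.
  have uv : 0 <= dot u v.
    by rewrite -(pmulr_rge0 _ D0) dotC -dotZl -bav.
  have cv : -1 <= dot c' v.
    rewrite lerNl -[- dot c' v]mulN1r -dotZl; apply: le_trans (dot_le _ _) _.
    by rewrite scaleN1r enormN v1 mulr1.
  rewrite vv mulr1; apply: (lt_le_trans rab); rewrite lerDl.
  rewrite mulr_ge0 ?(ltW s0)// addr_ge0// mulr_ge0 ?(ltW e0)// mulr_ge0//; lra.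
have [uv|uv] := leP 0 (dot (y - x) u).
  have [|z hz] := main x y Ax Ay _ rxy uv; last by exists z; left.
  apply/(rv_ballP _ _ e0) => j; have := coord_le_enorm (x - y) j; rewrite !mxE -edistE => H.
  exact: le_lt_trans H (le_lt_trans xy2r re).
have [||z hz] := main y x Ay Ax (ballxx _ e0).
- by rewrite edistC.
- by rewrite -opprB -scaleN1r dotZl mulN1r oppr_ge0 ltW.
- by exists z; right.
Qed.

End cone.

(** * Lipschitz bound for differentiable functions, and graphs *)

Lemma mean_value_bound (R : realType) (f df : R -> R) (a M : R) : 0 <= a ->
  (forall s, 0 <= s <= a -> is_derive s 1 f (df s) /\ `|df s| <= M) ->
  `|f a - f 0| <= M * a.
Proof.
move=> a0 h; have [|c|c] := MVT_segment a0 (f := f) (df := df).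
- by move=> s; rewrite in_itv/= => /andP[/ltW ? /ltW ?]; apply: (h s _).1; apply/andP.
- by apply: derivable_within_continuous => t; rewrite in_itv/= => /h[[]].
rewrite in_itv/= subr0 => /h[_ hc] ->.
by rewrite normrM (ger0_norm a0) ler_wpM2r.
Qed.

Section C1_lipschitz.
Context {R : realType} {n : nat}.
Variable g : 'rV[R]_n -> R.

(** The partial derivative is the ordinary derivative along the line. *)
Lemma is_derive_line (w e : 'rV[R]_n) (s : R) : derivable g (w + s *: e) e ->
  is_derive s 1 (fun t => g (w + t *: e)) ('D_e g (w + s *: e)).
Proof.
have E : (fun h : R => h^-1 *: (((fun t => g (w + t *: e)) \o shift s) (h *: 1) -
      g (w + s *: e))) =
    (fun h : R => h^-1 *: ((g \o shift (w + s *: e)) (h *: e) - g (w + s *: e))).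
  apply/funext => h /=; congr (_ *: (g _ - _)).
  by rewrite [h *: 1]mulr1 scalerDl addrCA.
by move=> dg; apply: DeriveDef; rewrite /derivable /derive E.
Qed.

Variables (v0 : 'rV[R]_n) (e M : R).
Hypothesis gM : forall x, ball v0 e x -> forall i,
  derivable g x (delta_mx 0 i) /\ `|'D_(delta_mx 0 i) g x| <= M.

Lemma line_bound w i (a : R) : 0 <= a ->
  (forall s, 0 <= s <= a -> ball v0 e (w + s *: delta_mx 0 i)) ->
  `|g (w + a *: delta_mx 0 i) - g w| <= M * a.
Proof.
move=> a0 h; pose ei : 'rV[R]_n := delta_mx 0 i.
have := @mean_value_bound R (fun t => g (w + t *: ei)) (fun t => 'D_ei g (w + t *: ei)) a M a0.
rewrite scale0r addr0; apply => s /h/gM/(_ i)[d1 d2]; split; last exact: d2.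
exact: is_derive_line.
Qed.

Let hyb (v v' : 'rV[R]_n) (m : nat) : 'rV[R]_n :=
  \row_j (if (j < m)%N then v' 0 j else v 0 j).

(** Change the coordinates one at a time; the intermediate points stay in the ball,
which is a cube. *)
Lemma lipschitz_of_partials : 0 < e -> 0 <= M -> forall v v' (c : R),
  ball v0 e v -> ball v0 e v' -> (forall j, `|v 0 j - v' 0 j| <= c) ->
  `|g v - g v'| <= n%:R * M * c.
Proof.
move=> e0 M0 v v' c Bv Bv' vc.
have hB m : ball v0 e (hyb v v' m).
  apply/(rv_ballP _ _ e0) => j; rewrite mxE; case: ifP => _.
    by move/(rv_ballP _ _ e0) : Bv'; exact.
  by move/(rv_ballP _ _ e0) : Bv; exact.
have step (i : 'I_n) : `|g (hyb v v' i.+1) - g (hyb v v' i)| <= M * c.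
  pose ei : 'rV[R]_n := delta_mx 0 i.
  have E : hyb v v' i.+1 = hyb v v' i + (v' 0 i - v 0 i) *: ei.
    apply/rowP => j; rewrite !mxE eqxx /= ltnS leq_eqVlt.
    have [->|ji] := eqVneq j i; first by rewrite eqxx ltnn mulr1 addrC subrK.
    by rewrite -val_eqE /= in ji; rewrite (negbTE ji) mulr0 addr0.
  apply: (@le_trans _ _ (M * `|v' 0 i - v 0 i|)); last by rewrite ler_wpM2l// distrC.
  (* every point between the two hybrids agrees with them off the coordinate i *)
  have between (w : 'rV[R]_n) (x y : R) s : w 0 i = x -> x <= y ->
      (forall j, ball (v0 0 j) e (w 0 j)) -> ball (v0 0 i) e y -> 0 <= s <= y - x ->
      ball v0 e (w + s *: ei).
    move=> wx xy wB yB /andP[s0 sxy]; apply/(rv_ballP _ _ e0) => j; rewrite !mxE eqxx /=.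
    have := wB j; rewrite -ball_normE /=; have [->|_] := eqVneq j i; last by rewrite mulr0 addr0.
    rewrite mulr1 wx; move: yB; rewrite -ball_normE /= !ltr_norml => /andP[? ?] /andP[? ?].
    by apply/andP; split; lra.
  have cB m j : ball (v0 0 j) e (hyb v v' m 0 j) by case: (hB m) => _; exact.
  have hi : hyb v v' i 0 i = v 0 i by rewrite mxE ltnn.
  have hi1 : hyb v v' i.+1 0 i = v' 0 i by rewrite mxE ltnSn.
  have [vv|vv] := leP (v 0 i) (v' 0 i).
    rewrite E (@ger0_norm _ (v' 0 i - v 0 i)) ?subr_ge0//; apply: line_bound.
      by rewrite subr_ge0.
    move=> s; apply: (between _ (v 0 i) (v' 0 i)) => //.
    by rewrite -hi1.
  have E' : hyb v v' i = hyb v v' i.+1 + (v 0 i - v' 0 i) *: ei.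
    by rewrite E -addrA -scalerDl [_ - _ + _]addrC addrA subrK subrr scale0r addr0.
  rewrite distrC [X in g X - _]E' (@ltr0_norm _ (v' 0 i - v 0 i)) ?subr_lt0// opprB; apply: line_bound.
    by rewrite subr_ge0 ltW.
  move=> s; apply: (between _ (v' 0 i) (v 0 i)) => //; first exact: ltW.
  by rewrite -hi.
have h0 : hyb v v' 0 = v by apply/rowP => j; rewrite mxE.
have hn : hyb v v' n = v' by apply/rowP => j; rewrite mxE ltn_ord.
have := telescope_sumr (fun m => g (hyb v v' m)) (leq0n n).
rewrite distrC hn h0 => <-; rewrite big_mkord; apply: le_trans (ler_norm_sum _ _ _) _.
apply: (@le_trans _ _ (\sum_(i < n) M * c)); first by apply: ler_sum => i _; exact: step.
by rewrite sumr_const card_ord -[leLHS]mulr_natl mulrA.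
Qed.

End C1_lipschitz.

Lemma C1_lipschitz (R : realType) n (V : set 'rV[R]_n) (g : 'rV[R]_n -> R) v0 :
  open V -> V v0 -> C1_on V g ->
  exists e L : R, [/\ 0 < e, 0 <= L, ball v0 e `<=` V &
    forall v v' (c : R), ball v0 e v -> ball v0 e v' ->
      (forall j, `|v 0 j - v' 0 j| <= c) -> `|g v - g v'| <= L * c].
Proof.
move=> oV Vv0 C1.
pose M : R := \sum_(i < n) (`|'D_(delta_mx 0 i) g v0| + 1).
have M0 : 0 <= M by apply: sumr_ge0 => i _; rewrite addr_ge0.
have H : \forall x \near v0, V x /\ forall i : 'I_n, `|'D_(delta_mx 0 i) g x| <= M.
  have H1 : \forall x \near v0, V x by exact: open_nbhs_nbhs.
  have H2 : \forall x \near v0, forall i : 'I_n, `|'D_(delta_mx 0 i) g x| <= M.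
    apply: (@filter_forall _ _ (fun (i : 'I_n) x => `|'D_(delta_mx 0 i) g x| <= M) (nbhs v0)).
    move=> i; have [_ ci] := C1 i v0 Vv0.
    have ci1 := cvgr_dist_le _ _ ci 1 ltr01; near=> x.
    have h : `|'D_(delta_mx 0 i) g v0 - 'D_(delta_mx 0 i) g x| <= 1 by near: x; exact: ci1.
    apply: (@le_trans _ _ (`|'D_(delta_mx 0 i) g v0| + 1)).
      rewrite -[X in `|X|](subrKC ('D_(delta_mx 0 i) g v0)).
      by rewrite (le_trans (ler_normD _ _))// lerD2l distrC.
    rewrite /M (bigD1 i)//= lerDl; apply: sumr_ge0 => j _; exact: addr_ge0.
  by near=> x; split; near: x.
move/nbhs_ballP : H => [e /= e0 He]; exists e, (n%:R * M).
split => //; first by rewrite mulr_ge0.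
  by move=> x /He[].
move=> v v' c Bv Bv'; apply: (@lipschitz_of_partials _ _ g v0 e M) => //.
move=> x /He[Vx hx] i; split => //; exact: (C1 i x Vx).1.
Unshelve. all: by end_near. Qed.

Section graph_side.
Context {R : realType} {n : nat}.
Implicit Types (A : set 'rV[R]_n.+1) (w x : 'rV[R]_n.+1) (v : 'rV[R]_n).

(** On the path, the points of A are the points of its interior, so they form an
open and closed part of a connected set. *)
Lemma path_interior A (c : R -> 'rV[R]_n.+1) : A = closure A° ->
  {within `[0, 1], continuous c} -> (forall t, 0 <= t <= 1 -> ~ boundary A (c t)) ->
  A° (c 0) -> A° (c 1).
Proof.
move=> Areg cc nb c0.
have Acl : closed A by rewrite Areg; exact: closed_closure.
have conn := connected_continuous_connected (@segment_connected R 0 1) cc.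
have in01 (t : R) : `[0, 1]%classic t -> 0 <= t <= 1 by rewrite /= in_itv.
have EE : [set c x | x in `[0, 1]] `&` A° = [set c x | x in `[0, 1]] `&` A.
  apply/seteqP; split => [x [? /interior_subset]//|x [[t tI <-] Ac]].
  split; first by exists t.
  apply: contrapT => nA; apply: (nb t); first exact: in01.
  by split => //; exact: subset_closure.
have h (t : R) : 0 <= t <= 1 -> [set c x | x in `[0, 1]] (c t).
  by move=> tI; exists t => //=; rewrite in_itv.
have E : [set c x | x in `[0, 1]] `&` A° = [set c x | x in `[0, 1]].
  apply: conn.
  - by exists (c 0); split => //; apply: h; rewrite lexx ler01.
  - by exists A° => //; exact: open_interior.
  - by exists A.
have : [set c x | x in `[0, 1]] (c 1) by apply: h; rewrite ler01 lexx.
by rewrite -E => -[].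
Qed.

Definition base w : 'rV[R]_n := \row_j w 0 (widen_ord (leqnSn n) j).
Definition height w : R := w 0 ord_max.
(** The point of the graph of a constant: coordinates v, then a; graph_point phi v
is lift_point v (phi v). *)
Definition lift_point v (a : R) : 'rV[R]_n.+1 :=
  \row_i if insub (val i) is Some j then v 0 j else a.

Lemma lift_point_widen v a j : lift_point v a 0 (widen_ord (leqnSn n) j) = v 0 j.
Proof. by rewrite mxE /= insubT//= => h; congr (v 0 _); apply: val_inj. Qed.

Lemma lift_point_max v a : lift_point v a 0 ord_max = a.
Proof. by rewrite mxE insubF//= ltnn. Qed.

Lemma ord_base (P : 'I_n.+1 -> Prop) :
  (forall j : 'I_n, P (widen_ord (leqnSn n) j)) -> P ord_max -> forall i, P i.
Proof.
move=> h1 h2 i; have := ltn_ord i; rewrite ltnS leq_eqVlt => /orP[/eqP e|lt].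
  by rewrite (_ : i = ord_max)//; apply: val_inj.
by rewrite (_ : i = widen_ord (leqnSn n) (Ordinal lt))//; apply: val_inj.
Qed.

Lemma base_lift v a : base (lift_point v a) = v.
Proof. by apply/rowP => j; rewrite mxE lift_point_widen. Qed.

Lemma height_lift v a : height (lift_point v a) = a.
Proof. exact: lift_point_max. Qed.

Lemma lift_base w : lift_point (base w) (height w) = w.
Proof.
apply/rowP; apply: ord_base => [j|].
  by rewrite lift_point_widen mxE.
by rewrite lift_point_max.
Qed.

Lemma lift_point_le v a v' a' (c : R) : (forall j, `|v 0 j - v' 0 j| <= c) -> `|a - a'| <= c ->
  enorm (lift_point v a - lift_point v' a') <= n.+1%:R * c.
Proof.
move=> hv ha; apply: enorm_le; apply: ord_base => [j|].
  by rewrite mxE [X in _ + X]mxE !lift_point_widen.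
by rewrite mxE [X in _ + X]mxE !lift_point_max.
Qed.

Lemma base_coord_le w w' j : `|base w 0 j - base w' 0 j| <= enorm (w - w').
Proof.
have := coord_le_enorm (w - w') (widen_ord (leqnSn n) j).
by rewrite mxE [X in _ + X]mxE ![base _ _ _]mxE.
Qed.

Lemma height_le w w' : `|height w - height w'| <= enorm (w - w').
Proof. by have := coord_le_enorm (w - w') ord_max; rewrite mxE [X in _ + X]mxE. Qed.

End graph_side.

(** * Interior cones of sets with a smooth boundary *)

Lemma conv_lt (R : realType) (t a b k : R) : 0 <= t <= 1 -> `|a| < k -> `|b| < k ->
  `|(1 - t) * a + t * b| < k.
Proof.
move=> /andP[t0 t1] ak bk; have t1' : 0 <= 1 - t by rewrite subr_ge0.
pose M := Num.max `|a| `|b|.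
have aM : `|a| <= M by rewrite le_max lexx.
have bM : `|b| <= M by rewrite le_max lexx orbT.
apply: (@le_lt_trans _ _ M); last by rewrite gt_max ak.
apply: (le_trans (ler_normD _ _)); rewrite !normrM (ger0_norm t1') (ger0_norm t0).
have h1 : (1 - t) * `|a| <= (1 - t) * M by rewrite ler_wpM2l.
have h2 : t * `|b| <= t * M by rewrite ler_wpM2l.
lra.
Qed.

Lemma lipschitz_path (R : realType) n (c : R -> 'rV[R]_n) (C : R) : 0 < C ->
  (forall t s, 0 <= t <= 1 -> 0 <= s <= 1 -> enorm (c t - c s) <= C * `|t - s|) ->
  {within `[0, 1], continuous c}.
Proof.
move=> C0 h; apply/subspace_continuousP => t tI.
have t01 : 0 <= t <= 1 by move: tI; rewrite /= in_itv.
apply/cvg_ballP => e e0; near=> s.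
have s01 : 0 <= s <= 1.
  have : `[0, 1]%classic s by near: s; exact: withinT.
  by rewrite /= in_itv.
have st : ball t (e / C) s.
  near: s; apply: cvg_within; apply: nbhsx_ballx; exact: divr_gt0.
apply/(rv_ballP _ _ e0) => j.
have := coord_le_enorm (c t - c s) j; rewrite mxE [X in _ + X]mxE => /le_lt_trans; apply.
apply: le_lt_trans (h t s t01 s01) _.
by move: st; rewrite -ball_normE /= ltr_pdivlMr// mulrC.
Unshelve. all: by end_near. Qed.

Section boundary_point.
Context {R : realType} {n : nat}.
Variables (A : set 'rV[R]_n.+1) (p : 'rV[R]_n.+1) (U : set 'rV[R]_n.+1)
  (Q : 'M[R]_n.+1) (V : set 'rV[R]_n) (phi : 'rV[R]_n -> R).
Hypothesis Areg : A = closure A°.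
Hypothesis pb : boundary A p.
Hypothesis QQ : Q *m Q^T = 1%:M.
Hypothesis graphE :
  (fun y => y *m Q) @` (boundary A `&` U) = (fun v => lift_point v (phi v)) @` V.
Implicit Types x y : 'rV[R]_n.+1.

Let bs x := base (x *m Q).
(** Signed height above the graph that describes the boundary near p. *)
Let T x := height (x *m Q) - phi (bs x).

Variables (e0 L rho k : R).
Hypothesis L_ge0 : 0 <= L.
Hypothesis e0V : ball (bs p) e0 `<=` V.
Hypothesis lip : forall v v' (c : R), ball (bs p) e0 v -> ball (bs p) e0 v' ->
  (forall j, `|v 0 j - v' 0 j| <= c) -> `|phi v - phi v'| <= L * c.
Hypothesis rhoU : ball p rho `<=` U.
Hypothesis rho_gt0 : 0 < rho.
Hypothesis k_gt0 : 0 < k.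
Hypothesis k_e0 : k <= e0.
Hypothesis k_rho : n.+1%:R * ((1 + L) * k) < rho.

Let K x := ball (bs p) k (bs x) /\ `|T x| < k.

Let Q'Q : Q^T *m Q = 1%:M. Proof. exact: mulmx1C. Qed.

Let enQ x y : enorm (x *m Q - y *m Q) = enorm (x - y).
Proof. by rewrite -mulmxBl enorm_rot. Qed.

Let pU : U p. Proof. by apply: rhoU; exact: ballxx. Qed.

Let Tp : T p = 0.
Proof.
have : [set y *m Q | y in boundary A `&` U] (p *m Q) by exists p.
rewrite graphE => -[v Vv E].
by rewrite /T /bs -E base_lift height_lift subrr.
Qed.

Let ballk v : ball (bs p) k v -> ball (bs p) e0 v.
Proof. exact: le_ball. Qed.

Let K_U x : K x -> U x.
Proof.
move=> [Bx Tx]; apply: rhoU; apply/(rv_ballP _ _ rho_gt0) => j.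
have H : enorm (p - x) <= n.+1%:R * ((1 + L) * k).
  rewrite -enQ -(lift_base (p *m Q)) -(lift_base (x *m Q)).
  have bk i : `|bs p 0 i - bs x 0 i| <= k.
    by move/(rv_ballP _ _ k_gt0) : Bx => /(_ i)/ltW.
  apply: lift_point_le => [i|].
    by apply: (le_trans (bk i)); rewrite ler_peMl ?(ltW k_gt0)// lerDl.
  have h1 := lip (ballk (ballxx _ k_gt0)) (ballk Bx) bk.
  have -> : height (p *m Q) - height (x *m Q) = T p - T x + (phi (bs p) - phi (bs x)).
    by rewrite /T; ring.
  rewrite Tp sub0r; apply: (le_trans (ler_normD _ _)); rewrite normrN mulrDl mul1r.
  by apply: lerD => //; exact: ltW.
have := coord_le_enorm (p - x) j; rewrite mxE [X in _ + X]mxE => /le_lt_trans; apply.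
exact: le_lt_trans H k_rho.
Qed.

Let boundaryK x : K x -> boundary A x <-> T x = 0.
Proof.
move=> Kx; have Ux := K_U Kx; split => [bx|T0].
  have : [set y *m Q | y in boundary A `&` U] (x *m Q) by exists x.
  rewrite graphE => -[v Vv E].
  by rewrite /T /bs -E base_lift height_lift subrr.
have : [set lift_point v (phi v) | v in V] (x *m Q).
  exists (bs x); first by apply: e0V; apply: ballk; case: Kx.
  by rewrite -[RHS]lift_base; congr lift_point; apply/esym/eqP; rewrite -subr_eq0 -/(T x) T0.
rewrite -graphE => -[y [by_ _] E].
by rewrite -[x]mulmx1 -QQ mulmxA -E -mulmxA QQ mulmx1.
Qed.

Let nearK x c : enorm (x - p) <= c -> (1 + L) * c < k -> K x.
Proof.
move=> xc ck; have c0 : 0 <= c by exact: le_trans (enorm_ge0 _) xc.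
have ck1 : c < k by apply: le_lt_trans ck; rewrite ler_peMl// lerDl.
have xc' : enorm (p *m Q - x *m Q) <= c by rewrite enQ -enormN opprB.
have bc j : `|bs p 0 j - bs x 0 j| <= c by exact: le_trans (base_coord_le _ _ _) xc'.
have Bx : ball (bs p) k (bs x).
  by apply/(rv_ballP _ _ k_gt0) => j; exact: le_lt_trans (bc j) ck1.
split => //.
have -> : T x = - (height (p *m Q) - height (x *m Q)) + (phi (bs p) - phi (bs x)).
  by have := Tp; rewrite /T; lra.
apply: le_lt_trans ck; apply: (le_trans (ler_normD _ _)); rewrite normrN mulrDl mul1r.
apply: lerD; first exact: le_trans (height_le _ _) xc'.
by apply: lip => //; apply: ballk => //; exact: ballxx.
Qed.

(** Two points of the cylinder strictly on the same side s of the graph are joined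
by a path whose height above the graph keeps that sign, so which does not meet the
boundary. *)
Let same_side s x y : `|s| = 1 -> K x -> K y -> 0 < s * T x -> 0 < s * T y ->
  A° x -> A° y.
Proof.
move=> s1 [Bx Tx] [By Ty] sx sy Ax.
pose vt (t : R) := (1 - t) *: bs x + t *: bs y.
have vtE t j : vt t 0 j = (1 - t) * bs x 0 j + t * bs y 0 j.
  by rewrite /vt mxE [X in X + _]mxE [X in _ + X]mxE.
pose ht (t : R) := (1 - t) * T x + t * T y.
pose c (t : R) := lift_point (vt t) (phi (vt t) + ht t) *m Q^T.
have cQ t : c t *m Q = lift_point (vt t) (phi (vt t) + ht t).
  by rewrite -mulmxA Q'Q mulmx1.
have Tc t : T (c t) = ht t by rewrite /T /bs cQ base_lift height_lift addrC addKr.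
have cE t z : vt t = bs z -> ht t = T z -> c t = z.
  move=> e1 e2; rewrite -[RHS]mulmx1 -QQ mulmxA; congr (_ *m _).
  rewrite -[RHS]lift_base e1 e2; congr lift_point; rewrite /T -/(bs z).
  by rewrite addrC subrK.
have c0 : c 0 = x by apply: cE; rewrite /vt /ht subr0 ?scale0r ?scale1r ?mul0r ?mul1r addr0.
have c1 : c 1 = y by apply: cE; rewrite /vt /ht subrr ?scale0r ?scale1r ?mul0r ?mul1r add0r.
have Bt t : 0 <= t <= 1 -> ball (bs p) k (vt t).
  move=> tI; apply/(rv_ballP _ _ k_gt0) => j.
  move/(rv_ballP _ _ k_gt0) : Bx => /(_ j) h1; move/(rv_ballP _ _ k_gt0) : By => /(_ j) h2.
  by have := conv_lt tI h1 h2; rewrite vtE; congr (`|_| < k); ring.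
have Tt t : 0 <= t <= 1 -> `|ht t| < k.
  by move=> tI; exact: conv_lt.
have st t : 0 <= t <= 1 -> 0 < s * ht t.
  move=> /andP[t0 t1]; have -> : s * ht t = (1 - t) * (s * T x) + t * (s * T y).
    by rewrite /ht; ring.
  move: (s * T x) (s * T y) sx sy => a b a0 b0; have [->|tn] := eqVneq t 0.
    by rewrite subr0 mul1r mul0r addr0.
  have tb : 0 < t * b by rewrite mulr_gt0// lt_neqAle eq_sym tn.
  by rewrite ltr_wpDl// mulr_ge0 ?subr_ge0// ltW.
have Kt t : 0 <= t <= 1 -> K (c t).
  by move=> tI; split; [rewrite /bs cQ base_lift; exact: Bt|rewrite Tc; exact: Tt].
rewrite -c1; apply: (path_interior Areg).
- apply: (@lipschitz_path _ _ _ (n.+1%:R * ((1 + L) * (2 * k) + 2 * k + 1))).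
    by rewrite mulr_gt0// ltr_wpDl// ?addr_ge0 ?mulr_ge0 ?addr_ge0 ?(ltW k_gt0).
  move=> t u tI uI; rewrite -enQ !cQ -mulrA.
  have bxy j : `|bs x 0 j - bs y 0 j| <= 2 * k.
    move/(rv_ballP _ _ k_gt0) : Bx => /(_ j); move/(rv_ballP _ _ k_gt0) : By => /(_ j).
    rewrite !ltr_norml ler_norml => /andP[? ?] /andP[? ?]; apply/andP; split; lra.
  have vtu j : `|vt t 0 j - vt u 0 j| <= 2 * k * `|t - u|.
    rewrite !vtE (_ : _ - _ = - (bs x 0 j - bs y 0 j) * (t - u)); last by ring.
    by rewrite normrM normrN ler_wpM2r.
  have htu : `|ht t - ht u| <= 2 * k * `|t - u|.
    rewrite /ht (_ : _ - _ = - (T x - T y) * (t - u)); last by ring.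
    rewrite normrM normrN ler_wpM2r//; apply: (le_trans (ler_normB _ _)); lra.
  have ptu := lip (ballk (Bt t tI)) (ballk (Bt u uI)) vtu.
  have tu0 : 0 <= `|t - u| by [].
  have ktu : 0 <= k * `|t - u| by rewrite mulr_ge0// ltW.
  have Lk : 0 <= L * (k * `|t - u|) by rewrite mulr_ge0.
  apply: lift_point_le => [j|].
    apply: (le_trans (vtu j)); move: (`|t - u|) tu0 ktu Lk => z; lra.
  have -> : phi (vt t) + ht t - (phi (vt u) + ht u) =
     (phi (vt t) - phi (vt u)) + (ht t - ht u) by ring.
  apply: (le_trans (ler_normD _ _)); apply: le_trans (lerD ptu htu) _.
  by move: (`|t - u|) tu0 ktu Lk => z; lra.
- move=> t tI /(boundaryK (Kt t tI)); rewrite Tc => h0.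
  by have := st t tI; rewrite h0 mulr0 ltxx.
- by rewrite c0.
Qed.

Let sgnT x : K x -> ~ boundary A x -> exists2 s : R, `|s| = 1 & 0 < s * T x.
Proof.
move=> Kx nb; have T0 : T x != 0 by apply/eqP => /(boundaryK Kx).
exists (Num.sg (T x)); first by rewrite normr_sg T0.
by rewrite -normrEsg normr_gt0.
Qed.

Let A_closed : closed A. Proof. by rewrite Areg; exact: closed_closure. Qed.

Let bA x : boundary A x -> A x.
Proof. by move=> [cx _]; move: cx; rewrite -(closure_id A).1. Qed.

Let nbA x : A x -> ~ boundary A x -> A° x.
Proof.
move=> Ax nb; apply: contrapT => nA; apply: nb; split => //.
exact: subset_closure.
Qed.

Let Ab x : A° x -> ~ boundary A x. Proof. by move=> Ax [_]. Qed.

(** A lies on exactly one side of the graph: on one side because p is a limit of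
interior points, and not on both because p is not interior. *)
Let exact_side : exists2 s : R, `|s| = 1 &
  (forall x, K x -> 0 < s * T x -> A x) /\ (forall x, K x -> A x -> 0 <= s * T x).
Proof.
have L1 : 0 < 1 + L by rewrite ltr_wpDr.
have N0 : 0 < n.+1%:R :> R by [].
pose c := k / (2 * (1 + L) * n.+1%:R).
have c0 : 0 < c by rewrite divr_gt0// !mulr_gt0.
have nK x : ball p c x -> K x.
  move=> px; apply: (@nearK x (n.+1%:R * c)).
    rewrite -enormN opprB; apply: enorm_le => i; rewrite mxE [X in _ + X]mxE.
    by move/(rv_ballP _ _ c0) : px => /(_ i)/ltW.
  rewrite (_ : _ * _ = k / 2); last first.
    rewrite /c; move: (n.+1%:R) (N0) => N N1.
    by field; rewrite !(gt_eqF L1, gt_eqF N1).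
  by rewrite ltr_pdivrMr// ltr_pMr// ltr1n.
have [q [Aq pq]] : exists q, A° q /\ ball p c q.
  have : closure A° p by rewrite -Areg; exact: bA.
  by move=> /(_ _ (nbhsx_ballx p c c0))[q []]; exists q.
have [s s1 sq] := sgnT (nK q pq) (Ab Aq).
have up x : K x -> 0 < s * T x -> A° x by move=> Kx sx; exact: same_side s1 (nK q pq) Kx sq sx Aq.
exists s => //; split => [x Kx sx|x Kx Ax]; first by apply: interior_subset; exact: up.
rewrite leNgt; apply/negP => sx.
have dn y : K y -> 0 < - s * T y -> A° y.
  move=> Ky sy; apply: (@same_side (- s) x y) => //; rewrite ?normrN ?mulNr ?oppr_gt0//.
  by apply: nbA => // /(boundaryK Kx) T0; move: sx; rewrite T0 mulr0 ltxx.
have [_] := pb; apply; apply/nbhs_ballP; exists c => //= y /nK Ky.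
have [/bA//|nb] := pselect (boundary A y).
have [s' s'1 sy] := sgnT Ky nb.
have s2 : s' = s \/ s' = - s.
  have : s' ^+ 2 = s ^+ 2 by rewrite -(real_normK (num_real s')) -(real_normK (num_real s)) s1 s'1.
  by move/eqP; rewrite eqf_sqr => /orP[/eqP ->|/eqP ->]; [left|right].
apply: interior_subset; case: s2 => E; rewrite E in sy; [exact: up|exact: dn].
Qed.

(** In the rotated coordinates the axis is the last basis vector, on the side of A:
along it the height over the graph grows at unit speed, whereas a horizontal
displacement of size e changes it by at most L e. *)
Lemma boundary_point_cone : exists2 e, 0 < e & cone A p e.
Proof.
have [s s1 [up dn]] := exact_side.
have L1 : 0 < 1 + L by rewrite ltr_wpDr.
have N0 : 0 < n.+3%:R :> R by [].
(* with this e the points involved stay in the cylinder K, and e (1 + L) < 1 *)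
pose m := Num.min 1 k.
have m0 : 0 < m by rewrite lt_min ltr01.
pose e := m / (2 * (1 + L) * n.+3%:R).
have e0' : 0 < e by rewrite divr_gt0// !mulr_gt0.
have eE : (1 + L) * (n.+3%:R * e) = m / 2.
  rewrite /e; move: (n.+3%:R) (N0) => N N1.
  by field; rewrite !(gt_eqF L1, gt_eqF N1).
have ek : (1 + L) * (n.+3%:R * e) < k.
  rewrite eE; apply: (@lt_le_trans _ _ m); last by rewrite ge_min lexx orbT.
  by rewrite ltr_pdivrMr// ltr_pMr// ltr1n.
have e1 : (1 + L) * e < 1.
  apply: (@le_lt_trans _ _ (m / 2)).
    by rewrite -eE ler_wpM2l ?(ltW L1)// ler_peMl ?(ltW e0')// ler1n.
  have : m <= 1 by rewrite ge_min lexx.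
  lra.
pose u : 'rV[R]_n.+1 := s *: (lift_point 0 1 *m Q^T).
have uQ : u *m Q = s *: lift_point 0 1 by rewrite -scalemxAl -mulmxA Q'Q mulmx1.
have u1 : enorm u <= 1.
  rewrite -(enorm_rot _ QQ) uQ enormZ s1 mul1r /enorm /dot (bigD1 ord_max)//= big1 ?addr0.
    by rewrite lift_point_max mulr1 sqrtr1.
  apply: ord_base => [j _|]; last by rewrite eqxx.
  by rewrite lift_point_widen mxE mul0r.
exists e => //; exists u => // y Ay py b t b1 /andP[t0 te].
have yp : enorm (y - p) <= n.+1%:R * e.
  rewrite -enormN opprB; apply: enorm_le => i; rewrite mxE [X in _ + X]mxE.
  by move/(rv_ballP _ _ e0') : py => /(_ i)/ltW.
have e11 : e <= 1 by move: e1; rewrite mulrDl mul1r => /ltW; apply: le_trans; rewrite lerDl mulr_ge0// ltW.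
have n3 : n.+3%:R * e = n.+1%:R * e + 2 * e by rewrite -mulrDl -natrD addn2.
have Ky : K y.
  apply: (@nearK y (n.+1%:R * e)) => //; apply: le_lt_trans ek.
  by rewrite ler_wpM2l ?(ltW L1)// n3 lerDl mulr_ge0// ltW.
pose z := y + t *: (u + e *: b).
have bz : enorm (u + e *: b) <= 2.
  apply: (le_trans (enormD _ _)); rewrite (enormZ e b) (gtr0_norm e0').
  have : e * enorm b <= 1 by apply: mulr_ile1 => //; rewrite ?enorm_ge0// ltW.
  lra.
have Kz : K z.
  apply: (@nearK z (n.+3%:R * e)) => //.
  have -> : z - p = (y - p) + t *: (u + e *: b) by rewrite /z addrAC.
  rewrite n3; apply: (le_trans (enormD _ _)); apply: lerD => //.
  by rewrite enormZ (gtr0_norm t0) mulrC; apply: ler_pM => //; rewrite ?enorm_ge0// ltW.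
apply: up => //.
have zQ : z *m Q = y *m Q + t *: (s *: lift_point 0 1 + e *: (b *m Q)).
  by rewrite /z mulmxDl -scalemxAl mulmxDl uQ -scalemxAl.
have zc i : (z *m Q) 0 i =
    (y *m Q) 0 i + t * (s * lift_point 0 1 0 i + e * (b *m Q) 0 i).
  by rewrite zQ; move: (y *m Q) (b *m Q) (lift_point 0 1) => yq bq lp; rewrite !mxE.
have bQ : enorm (b *m Q) <= 1 by rewrite enorm_rot.
have te0 : 0 <= t * e by rewrite mulr_ge0// ltW.
have bzy j : `|bs z 0 j - bs y 0 j| <= t * e.
  have bE x : bs x 0 j = (x *m Q) 0 (widen_ord (leqnSn n) j) by rewrite /bs mxE.
  have z0 : (0 : 'rV[R]_n) 0 j = 0 by rewrite mxE.
  rewrite !bE zc lift_point_widen z0 mulr0 add0r addrAC subrr add0r mulrA normrM.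
  rewrite (ger0_norm te0) ler_piMr//.
  exact: le_trans (coord_le_enorm _ _) bQ.
have Bz := ballk Kz.1; have By := ballk Ky.1.
have lz := lip Bz By bzy.
have hz : height (z *m Q) = height (y *m Q) + t * (s + e * height (b *m Q)).
  by rewrite /height zc lift_point_max mulr1.
have Tz : s * T z = s * T y + t * (s * s + e * (s * height (b *m Q))) -
    s * (phi (bs z) - phi (bs y)) by rewrite /T hz; ring.
have ss : s * s = 1 by rewrite -expr2 -(real_normK (num_real s)) s1 expr1n.
have h1 : `|s * height (b *m Q)| <= 1.
  by rewrite normrM s1 mul1r; apply: le_trans (coord_le_enorm _ _) bQ.
have h2 : `|s * (phi (bs z) - phi (bs y))| <= L * (t * e) by rewrite normrM s1 mul1r.
rewrite Tz ss; have Ty := dn y Ky Ay.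
move: h1 h2; rewrite !ler_norml => /andP[h1 _] /andP[_ h2].
have h3 : - e <= e * (s * height (b *m Q)) by have := ler_wpM2l (ltW e0') h1; rewrite mulrN1.
have h4 : 0 < t * (1 - (1 + L) * e) by rewrite mulr_gt0// subr_gt0.
have h5 : t * (1 - e) <= t * (1 + e * (s * height (b *m Q))).
  by rewrite ler_wpM2l ?(ltW t0)// lerD2l.
lra.
Qed.

End boundary_point.

(** The first derivatives, continuous near p, make the boundary a Lipschitz
graph. *)
Lemma C2_boundary_cone (R : realType) n (A : set 'rV[R]_n.+1) : A = closure A° ->
  C2_boundary A -> forall p, boundary A p -> exists2 e, 0 < e & cone A p e.
Proof.
move=> Areg C2 p pb; have [U [Q [V [phi [nU [QQ _] oV [C1 _] gE]]]]] := C2 p pb.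
have gE' : (fun y => y *m Q) @` (boundary A `&` U) =
    (fun v => lift_point v (phi v)) @` V by exact: gE.
have Vp : V (base (p *m Q)).
  have : [set y *m Q | y in boundary A `&` U] (p *m Q).
    by exists p => //; split => //; exact: nbhs_singleton.
  by rewrite gE' => -[v Vv <-]; rewrite base_lift.
have [e0 [L [e00 L0 e0V lip]]] := C1_lipschitz oV Vp C1.
move/nbhs_ballP : nU => [rho /= rho0 rhoU].
have L1 : 0 < 1 + L by rewrite ltr_wpDr.
have N0 : 0 < n.+1%:R :> R by [].
pose k := Num.min e0 (rho / (2 * (n.+1%:R * (1 + L)))).
have k0 : 0 < k by rewrite lt_min e00 divr_gt0// !mulr_gt0.
apply: (@boundary_point_cone R n A p U Q V phi Areg pb QQ gE' e0 L rho k) => //.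
  by rewrite ge_min lexx.
have : k <= rho / (2 * (n.+1%:R * (1 + L))) by rewrite ge_min lexx orbT.
rewrite ler_pdivlMr ?mulr_gt0// => h.
have : 0 < n.+1%:R * ((1 + L) * k) by rewrite !mulr_gt0.
by move: (n.+1%:R) h => N h; lra.
Qed.

(** Each coordinate moves towards the middle of the interval. *)
Lemma unit_cube_cone (R : realType) n (p : 'rV[R]_n) : (0 < n)%N -> unit_cube p ->
  exists2 e, 0 < e & cone (@unit_cube R n) p e.
Proof.
move=> n_gt0 cp.
have N0 : 0 < n%:R :> R by rewrite ltr0n.
have N1 : 1 <= n%:R :> R by rewrite ler1n.
pose e : R := (8 * n%:R)^-1.
have e0 : 0 < e by rewrite invr_gt0 mulr_gt0.
pose u : 'rV[R]_n := \row_i (if 2 * p 0 i <= 1 then n%:R^-1 else - n%:R^-1).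
exists e => //; exists u.
  apply: le_trans (enorm_le (c := n%:R^-1) _) _; last by rewrite divff// gt_eqF.
  move=> i; rewrite mxE; case: ifP => _; rewrite ?normrN gtr0_norm// invr_gt0//.
move=> y cy py b s b1 /andP[s0 se] i.
have bi : `|b 0 i| <= 1 by exact: le_trans (coord_le_enorm b i) b1.
move/(rv_ballP _ _ e0) : py => /(_ i).
rewrite !mxE; have := cy i; have := cp i.
have nE : n%:R^-1 = 8 * e by rewrite /e; field; rewrite gt_eqF.
move: bi; rewrite ler_norml ltr_norml nE => /andP[b1' b2'] /andP[p0 p1] /andP[y0 y1] /andP[h1 h2].
have e1 : 8 * e <= 1 by rewrite -nE invf_le1.
have e12 : 8 * (s * e) <= e by rewrite mulrA ler_piMl ?(ltW e0)//; lra.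
have se0 : 0 <= s * e by rewrite mulr_ge0// ltW.
have sb1 : s * e * b 0 i <= s * e by rewrite ler_piMr.
have sb2 : - (s * e) <= s * e * b 0 i.
  by have := ler_wpM2l se0 b1'; rewrite mulrN1.
case: ifP => [ph|/negbT].
  rewrite mulrDr mulrCA [s * (e * _)]mulrA; move: (s * e * _) sb1 sb2 => z sb1 sb2.
  by move: (s * e) e12 se0 sb1 sb2 => w *; apply/andP; split; lra.
rewrite -ltNge mulrDr mulrN mulrCA [s * (e * _)]mulrA; move: (s * e * _) sb1 sb2 => z sb1 sb2 ph.
by move: (s * e) e12 se0 sb1 sb2 => w *; apply/andP; split; lra.
Qed.

Lemma uniform_cone_of_shape (R : realType) n (A : set 'rV[R]_n.+1) :
  compact A -> A = closure A° -> C2_boundary A \/ A = unit_cube ->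
  exists2 e, 0 < e <= 1 & forall x, A x -> cone A x e.
Proof.
move=> cA Areg [C2|Acube]; apply: uniform_cone => // x Ax; last first.
  by rewrite Acube in Ax *; exact: unit_cube_cone.
have [bx|nb] := pselect (boundary A x); first exact: C2_boundary_cone bx.
have : A° x.
  by apply: contrapT => nA; apply: nb; split => //; exact: subset_closure.
move=> /nbhs_ballP[e /= e0 He]; pose c := Num.min 1 (e / 2).
have c0 : 0 < c by rewrite lt_min ltr01 divr_gt0.
have c1 : c <= 1 by rewrite ge_min lexx.
have ce : c <= e / 2 by rewrite ge_min lexx orbT.
exists c => //; exists 0.
  by rewrite -[0](scale0r 0) enormZ normr0 mul0r.
move=> y Ay /(rv_ballP _ _ c0) xy b s b1 /andP[s0 sc]; apply: He.
apply/(rv_ballP _ _ e0) => i; rewrite !mxE add0r.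
have bi := le_trans (coord_le_enorm b i) b1.
have sb : `|s * (c * b 0 i)| <= c.
  rewrite !normrM (gtr0_norm s0) (gtr0_norm c0); rewrite -[leRHS]mul1r; apply: ler_pM => //.
  - exact: ltW.
  - by rewrite mulr_ge0// ltW.
  - exact: le_trans sc c1.
  - by rewrite ler_piMr// ltW.
rewrite opprD addrA; apply: (le_lt_trans (ler_normB _ _)).
apply: (@lt_le_trans _ _ (c + c)); last by lra.
exact: ltr_leD.
Qed.

Lemma support_cone (R : realType) d (A : set 'rV[R]_d) : (0 < d)%N ->
  compact A -> A = closure A° -> C2_boundary A \/ (d = 2%N /\ A = unit_cube) ->
  exists2 e, 0 < e <= 1 & forall x, A x -> cone A x e.
Proof.
case: d A => // n A _ cA Areg [C2|[_ E]]; apply: uniform_cone_of_shape => //.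
  by left.
by right.
Qed.

(** * Probability of balls *)

Section euclidean_balls.
Context {R : realType} {d : nat}.
Implicit Types x y : 'rV[R]_d.

Definition within_dist (r : R) x y : bool := Defs.edist x y <= r.

Lemma within_distC r x y : within_dist r x y = within_dist r y x.
Proof. by rewrite /within_dist edistC. Qed.

Lemma measurable_edist :
  measurable_fun setT (fun p : 'rV[R]_d * 'rV[R]_d => Defs.edist p.1 p.2).
Proof.
apply: measurableT_comp.
  apply: continuous_measurable_fun => x; exact: sqrt_continuous.
apply: measurable_sum => i; apply: measurable_funX; apply: measurable_funB.
  by apply: (measurableT_comp (measurable_rV_coord i)); exact: measurable_fst.
by apply: (measurableT_comp (measurable_rV_coord i)); exact: measurable_snd.
Qed.

Lemma measurable_within_dist r :
  measurable_fun setT (fun p : 'rV[R]_d * 'rV[R]_d => within_dist r p.1 p.2).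
Proof. by apply: measurable_fun_ler; [exact: measurable_edist|exact: measurable_cst]. Qed.

Lemma measurable_eball r x : measurable (eball x r).
Proof. exact: (mset_near (measurable_within_dist r)). Qed.

Lemma lebesgue_cube x (r : R) : 0 <= r ->
  lebesgue_rV d [set y : 'rV[R]_d | forall i, `[x 0 i - r, x 0 i + r]%classic (y 0 i)] =
  ((2 * r) ^+ d)%:E.
Proof.
move=> r0; transitivity (\prod_(i < d) lebesgue_measure (`[x 0 i - r, x 0 i + r]%classic)%R)%E.
  by apply: (@lebesgue_rV_box R d (fun i => `[x 0 i - r, x 0 i + r]%classic)).
rewrite (eq_bigr (fun=> (2 * r)%:E)); last first.
  move=> i _; rewrite lebesgue_measure_itv /= lte_fin.
  have [->|rn] := eqVneq r 0; first by rewrite subr0 addr0 ltxx mulr0.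
  have rp : 0 < r by rewrite lt_neqAle eq_sym rn.
  by rewrite ifT; [rewrite -EFinB; congr (_%:E); ring|lra].
by rewrite prodEFin prodr_const card_ord.
Qed.

Lemma measurable_cube x (r : R) :
  measurable [set y : 'rV[R]_d | forall i, `[x 0 i - r, x 0 i + r]%classic (y 0 i)].
Proof.
rewrite (_ : mkset _ = \bigcap_(i in [set: 'I_d])
    (fun v : 'rV[R]_d => v 0 i) @^-1` `[x 0 i - r, x 0 i + r]%classic).
  apply: fin_bigcap_measurable => //= i _.
  by rewrite -[X in measurable X]setTI; apply: measurable_rV_coord.
by apply/seteqP; split => [v h i _|v h i]; [exact: h|exact: (h i)].
Qed.

Lemma lebesgue_eball_le x (r : R) : 0 <= r ->
  (lebesgue_rV d (eball x r) <= ((2 * r) ^+ d)%:E)%E.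
Proof.
move=> r0; rewrite -(lebesgue_cube x r0); apply: le_measure; rewrite ?inE.
- exact: measurable_eball.
- exact: measurable_cube.
move=> y xy i; rewrite /= in_itv /=; move: xy; rewrite /eball /= edistE => xy.
have := le_trans (coord_le_enorm (x - y) i) xy; rewrite mxE [X in _ + X]mxE ler_norml.
by move=> /andP[? ?]; apply/andP; split; lra.
Qed.

Lemma lebesgue_eball_ge x (r : R) : (0 < d)%N -> 0 <= r ->
  (((2 * (r / d%:R)) ^+ d)%:E <= lebesgue_rV d (eball x r))%E.
Proof.
move=> d0 r0; have d1 : 0 < d%:R :> R by rewrite ltr0n.
rewrite -(lebesgue_cube x) ?divr_ge0//; apply: le_measure; rewrite ?inE.
- exact: measurable_cube.
- exact: measurable_eball.
move=> y xy; rewrite /eball /= edistE.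
rewrite (_ : r = d%:R * (r / d%:R)); last by rewrite mulrC divfK// gt_eqF.
apply: enorm_le => i; move: (xy i); rewrite /= in_itv /= => /andP[? ?].
by rewrite mxE [X in _ + X]mxE ler_norml; apply/andP; split; lra.
Qed.

End euclidean_balls.

Section density_bounds.
Context {R : realType} {d : nat}.
Hypothesis d_gt0 : (0 < d)%N.
Variables (A : set 'rV[R]_d) (f : 'rV[R]_d -> R) (nu : probability 'rV[R]_d R).
Hypothesis A_compact : compact A.
Hypothesis A_cone : exists2 e, 0 < e <= 1 & forall x, A x -> cone A x e.
Hypothesis f_density : prob_density f.
Hypothesis f_zero : forall x, ~ A x -> f x = 0.
Hypothesis f_continuous : {within A, continuous f}.
Hypothesis f_inf : 0 < inf (f @` A).
Hypothesis nuE : forall B, measurable B ->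
  nu B = (\int[@lebesgue_rV R d]_(x in B) (f x)%:E)%E.
Implicit Types x y : 'rV[R]_d.
Local Notation nb := (@within_dist R d).
Local Notation mu := (@lebesgue_rV R d).

Let mf : measurable_fun setT f. Proof. by case: f_density. Qed.
Let f0 x : 0 <= f x. Proof. by case: f_density. Qed.

Lemma density_ge x : A x -> inf (f @` A) <= f x.
Proof.
by move=> Ax; apply: ge_inf; [exists 0 => _ [y _ <-]|exists x].
Qed.

(** The density is at least its infimum on A, and zero elsewhere; this makes A
measurable. *)
Lemma density_support : A = [set x | f x != 0].
Proof.
apply/seteqP; split => [x Ax|x /= fx]; last first.
  by apply: contrapT => /f_zero f0'; rewrite f0' eqxx in fx.
by rewrite /= gt_eqF// (lt_le_trans f_inf)// density_ge.
Qed.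

Lemma measurable_support : measurable A.
Proof.
rewrite density_support (_ : [set x | _] = f @^-1` (~` [set 0])); last first.
  by apply/seteqP; split => x /= /eqP.
by rewrite -[X in measurable X]setTI; apply: mf => //; exact: measurableC.
Qed.

Lemma density_bounded : exists2 M, 0 < M & forall x, f x <= M.
Proof.
have /compact_bounded[M [_ hM]] := continuous_compact f_continuous A_compact.
have M1 : M < `|M| + 1 by rewrite (le_lt_trans (ler_norm _))// ltrDl.
have h1 := hM (`|M| + 1) M1.
exists (`|M| + 1) => [|x]; first by rewrite ltr_wpDl.
have [Ax|/f_zero ->] := pselect (A x); last by rewrite addr_ge0.
by rewrite -[f x]ger0_norm//; apply: h1; exists x.
Qed.

Lemma support_prob1 : nu A = 1%E.
Proof.
rewrite (nuE measurable_support); case: f_density => _ _ <-.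
rewrite [LHS]integral_mkcond; apply: eq_integral => x _; rewrite /patch.
by case: ifPn => // /negP nA; rewrite f_zero// => Ax; apply: nA; rewrite inE.
Qed.

Lemma ball_prob_le M r x : (forall x, f x <= M) -> 0 <= r ->
  near_pr nu (nb r) x <= M * (2 * r) ^+ d.
Proof.
move=> hM r0; have M0 : 0 <= M by exact: le_trans (f0 0) (hM 0).
rewrite -lee_fin -prE; last exact: measurable_eball.
rewrite nuE; last exact: measurable_eball.
apply: (@le_trans _ _ (\int[mu]_(y in eball x r) M%:E)%E).
  apply: ge0_le_integral => //.
  - exact: measurable_eball.
  - by move=> y _; rewrite lee_fin.
  - by apply/measurable_EFinP; exact: measurable_funTS.
  - by move=> y _; rewrite lee_fin.
rewrite integral_cst; last exact: measurable_eball.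
by rewrite EFinM lee_wpmul2l ?lee_fin//; exact: lebesgue_eball_le.
Qed.

Lemma ball_prob_ge z rho : 0 <= rho -> eball z rho `<=` A ->
  inf (f @` A) * (2 * (rho / d%:R)) ^+ d <= pr nu (eball z rho).
Proof.
move=> r0 zA; rewrite -lee_fin -prE; last exact: measurable_eball.
rewrite nuE; last exact: measurable_eball.
apply: (@le_trans _ _ (\int[mu]_(y in eball z rho) (inf (f @` A))%:E)%E); last first.
  apply: ge0_le_integral => //.
  - exact: measurable_eball.
  - by move=> y _; rewrite lee_fin ltW.
  - by apply/measurable_EFinP; exact: measurable_funTS.
  - by move=> y /zA Ay; rewrite lee_fin density_ge.
rewrite integral_cst; last exact: measurable_eball.
by rewrite EFinM lee_wpmul2l ?lee_fin ?(ltW f_inf)//; exact: lebesgue_eball_ge.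
Qed.

(** A ball of radius r e / 4 inside A has probability at least c r^d, and cone_ball
and cone_escape provide one where it is needed. *)
Lemma ball_bounds : exists c C r1 : R, [/\ 0 < c, 0 < C, 0 < r1,
    forall r, 0 < r -> forall x, near_pr nu (nb r) x <= C * r ^+ d &
    forall r, 0 < r < r1 ->
      (forall x, A x -> c * r ^+ d <= near_pr nu (nb r) x) /\
      (forall x y, A x -> A y -> ring2 (nb r) (nb (2 * r)) x y ->
        near_pr nu (nb r) x + c * r ^+ d <= near_pr2 nu (nb r) x y \/
        near_pr nu (nb r) y + c * r ^+ d <= near_pr2 nu (nb r) x y)].
Proof.
have [M M0 hM] := density_bounded; have [e e01 hc] := A_cone.
have /andP[e0 e1] := e01; have d1 : 0 < d%:R :> R by rewrite ltr0n.
pose c := inf (f @` A) * (2 * (e / 4 / d%:R)) ^+ d.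
exists c, (M * 2 ^+ d), (e / 2); split.
- by rewrite mulr_gt0// exprn_gt0// mulr_gt0// !divr_gt0.
- by rewrite mulr_gt0// exprn_gt0.
- exact: divr_gt0.
- by move=> r r0 x; rewrite -mulrA -exprMn; apply: ball_prob_le => //; exact: ltW.
move=> r /andP[r0 re]; have rho0 : 0 <= r * e / 4 by rewrite divr_ge0// mulr_ge0// ltW.
have small z : eball z (r * e / 4) `<=` A -> c * r ^+ d <= pr nu (eball z (r * e / 4)).
  move=> /(ball_prob_ge rho0); rewrite (_ : _ * _ ^+ d = c * r ^+ d)//.
  by rewrite /c -[RHS]mulrA -exprMn; congr (_ * _ ^+ _); ring.
have disj x y z : (forall w, eball z (r * e / 4) w -> nb r y w && ~~ nb r x w) ->
    near_pr nu (nb r) x + pr nu (eball z (r * e / 4)) <= near_pr2 nu (nb r) x y.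
  move=> h; have m1 : measurable (eball x r) by exact: measurable_eball.
  have m2 : measurable (eball z (r * e / 4)) by exact: measurable_eball.
  rewrite -lee_fin EFinD -!prE//; last exact: (mset_near2 (measurable_within_dist r)).
  rewrite -measureU//; last first.
    apply/seteqP; split => // w [w1 /h/andP[_]]; rewrite /within_dist.
    by move: w1; rewrite /= /within_dist => ->.
  apply: le_measure; rewrite ?inE; [exact: measurableU|
    exact: (mset_near2 (measurable_within_dist r))|].
  by move=> w /= [->//|/h/andP[->]]; rewrite orbT.
split => [x Ax|x y Ax Ay].
  have [|z hz] := cone_ball (hc x Ax) e01 Ax (r := r); first by rewrite r0; lra.
  apply: (le_trans (small z _)) => [w /hz[]//|].
  apply: pr_le; [exact: measurable_eball|exact: measurable_eball|].
  by move=> w /hz[].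
rewrite /ring2 /within_dist -ltNge => rxy.
have [|z [hz|hz]] := cone_escape (hc x Ax) e01 Ax Ay r0 _ rxy; first by lra.
- left; apply: le_trans (disj x y z _); last first.
    by move=> w /hz[_ h1 h2]; rewrite /within_dist h1 -ltNge.
  by rewrite lerD2l; apply: small => w /hz[].
- right; rewrite (_ : near_pr2 _ _ x y = near_pr2 nu (nb r) y x); last first.
    by rewrite /near_pr2; congr (pr nu _); apply/seteqP; split => w /=; rewrite orbC.
  apply: le_trans (disj y x z _); last first.
    by move=> w /hz[_ h1 h2]; rewrite /within_dist h1 -ltNge.
  by rewrite lerD2l; apply: small => w /hz[].
Qed.

(** The Radon-Nikodym derivative of nu agrees with f almost everywhere. *)
Lemma integral_density (h : 'rV[R]_d -> R) : measurable_fun setT h -> (forall x, 0 <= h x) ->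
  (\int[nu]_x (h x)%:E = \int[mu]_(x in A) (h x * f x)%:E)%E.
Proof.
move=> mh h0.
have numu : nu `<< mu.
  apply/null_content_dominatesP => B mB muB; rewrite nuE//.
  apply: null_set_integral => //.
  by apply/measurable_EFinP; exact: measurable_funTS.
pose g := Radon_Nikodym_SigmaFinite.f nu mu.
have g0 x : (0 <= g x)%E by exact: Radon_Nikodym_SigmaFinite.f_ge0.
have ig : mu.-integrable setT g by exact: Radon_Nikodym_SigmaFinite.f_integrable.
have mg := measurable_int _ ig.
have mfE : measurable_fun setT (fun x => (f x)%:E) by exact/measurable_EFinP.
have mhE : measurable_fun setT (fun x => (h x)%:E) by exact/measurable_EFinP.
have gf : ae_eq mu setT g (fun x => (f x)%:E).
  apply: integral_ae_eq => // B _ mB.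
  by rewrite -nuE// -Radon_Nikodym_SigmaFinite.f_integral.
rewrite -(@Radon_Nikodym_SigmaFinite.change_of_variables _ _ _ nu mu numu)//.
transitivity (\int[mu]_x (h x * f x)%:E)%E.
  apply: ae_eq_integral => //.
  - exact: emeasurable_funM.
  - by apply/measurable_EFinP; exact: measurable_funM.
  - by apply: filterS gf => x H _; rewrite EFinM -H.
rewrite [RHS]integral_mkcond; apply: eq_integral => x _; rewrite /patch.
by case: ifPn => // /negP nA; rewrite f_zero ?mulr0// => Ax; apply: nA; rewrite inE.
Qed.

End density_bounds.

(** * Isolated vertices as a count over the sample *)

Section isolated_points.
Context {R : realType} {d : nat}.
Implicit Types (pts : nat -> 'rV[R]_d) (r : R).
Local Notation nb := (@within_dist R d).

Lemma within_dist0 (x y : 'rV[R]_d) : nb 0 x y = (x == y).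
Proof.
rewrite /within_dist edistE; apply/idP/eqP => [h|->].
  by apply/eqP; rewrite -subr_eq0; apply/eqP/enorm0_eq0/eqP; rewrite eq_le h enorm_ge0.
by rewrite subrr -[0](scale0r 0) enormZ normr0 mul0r.
Qed.

(** A sample is a set of points, so coinciding points must be counted once: at their
first occurrence. *)
Definition first_isolated r n pts (i : nat) : bool :=
  all (fun j => ~~ nb 0 (pts i) (pts j)) (iota 0 i) &&
  all (fun j => nb 0 (pts i) (pts j) || ~~ nb r (pts i) (pts j)) (iota 0 n).

(** The set of sample points is enumerated without repetition by first
occurrences. *)
Lemma num_isolatedE r n pts :
  num_isolated [fset pts (val i) | i in 'I_n]%fset r =
  (\sum_(0 <= i < n) first_isolated r n pts i)%N.
Proof.
set V := [fset _ | _ in _]%fset.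
have VP x : reflect (exists2 j, (j < n)%N & x = pts j) (x \in V).
  apply: (iffP (imfsetP _ _ _ _)) => [[j _ ->]|[j jn ->]]; first by exists (val j) => //; exact: ltn_ord.
  by exists (Ordinal jn).
pose s := [seq pts i | i <- [seq i <- iota 0 n | first_isolated r n pts i]].
have us : uniq s.
  rewrite map_inj_in_uniq ?filter_uniq ?iota_uniq// => i j.
  rewrite !mem_filter !mem_iota !add0n /= => /andP[/andP[fi _] _] /andP[/andP[fj _] _] E.
  have [ij|ji|//] := ltngtP i j.
    by move/allP : fj => /(_ i); rewrite mem_iota ij within_dist0 E eqxx => /(_ isT).
  by move/allP : fi => /(_ j); rewrite mem_iota ji within_dist0 E eqxx => /(_ isT).
transitivity (size s); last first.
  rewrite size_map size_filter -sum1_count big_mkcond /= /index_iota subn0.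
  by apply: eq_bigr => i _; case: first_isolated.
rewrite /num_isolated; apply/perm_size/uniq_perm => // x.
rewrite !inE /=; apply/andP/mapP => [[/VP[j0 j0n ->] /forallP h]|[i]]; last first.
  rewrite mem_filter mem_iota add0n /= => /andP[/andP[_ /allP hi] iN] ->.
  have iV : pts i \in V by apply/VP; exists i.
  split=> //; apply/forallP => y; have /VP[j jn yj] := valP y.
  have := hi j; rewrite mem_iota add0n /= jn => /(_ isT).
  rewrite /rgg_edge /= iV (valP y) /= yj within_dist0.
  by rewrite /within_dist; case: eqP => //= _.
have ex : exists i, (i < n)%N && (pts i == pts j0) by exists j0; rewrite j0n /=.
case: (ex_minnP ex) => i /andP[iN /eqP E] mini.
exists i => //; rewrite mem_filter mem_iota add0n /= iN andbT; apply/andP; split.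
  apply/allP => j; rewrite mem_iota add0n /= => ji; rewrite within_dist0; apply/eqP => ij.
  have := mini j; rewrite (ltn_trans ji iN) -ij E eqxx => /(_ isT).
  by rewrite leqNgt ji.
apply/allP => j; rewrite mem_iota add0n /= => jn.
have jV : pts j \in V by apply/VP; exists j.
have j0V : pts j0 \in V by apply/VP; exists j0.
have := h [` jV]%fset; rewrite /rgg_edge /= j0V jV /= within_dist0 E.
by rewrite /within_dist; case: eqP.
Qed.

Lemma measurable_first_isolated r n i :
  measurable_fun setT (fun w : @traj _ 'rV[R]_d => first_isolated r n w i).
Proof.
have mb c j : measurable_fun setT (fun w : @traj _ 'rV[R]_d => nb c (w i) (w j)).
  by apply: (measurable_near (measurable_within_dist c)); exact: measurable_coord.
apply: measurable_and; apply: measurable_all => j; first exact: measurable_neg.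
by apply: measurable_or => //; exact: measurable_neg.
Qed.

Definition first_isolated_count r n pts : nat :=
  (\sum_(0 <= i < n) first_isolated r n pts i)%N.

Lemma measurable_first_isolated_count r n :
  measurable_fun setT (first_isolated_count r n : @traj _ 'rV[R]_d -> nat).
Proof.
apply: measurable_sumn => i.
by apply: (measurableT_comp (f := nat_of_bool)) => //; exact: measurable_first_isolated.
Qed.

Lemma first_isolated_count_le r n pts : (first_isolated_count r n pts <= n)%N.
Proof.
apply: (@leq_trans (\sum_(0 <= i < n) 1)).
  by apply: leq_sum => i _; exact: leq_b1.
by rewrite sum_nat_const_nat subn0 muln1.
Qed.

Lemma first_isolated_distinct r n pts :
  (forall i j, (i < n)%N -> (j < n)%N -> i != j -> ~~ nb 0 (pts i) (pts j)) ->
  first_isolated_count r n pts = isocount (nb r) n pts.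
Proof.
move=> dist; apply: eq_big_nat => i /andP[_ iN]; congr (nat_of_bool _).
have h1 : all (fun j => ~~ nb 0 (pts i) (pts j)) (iota 0 i).
  apply/allP => j; rewrite mem_iota add0n /= => ji.
  by apply: dist => //; [exact: ltn_trans iN|rewrite neq_ltn ji orbT].
rewrite /first_isolated h1 /=; apply: eq_in_all => j; rewrite mem_iota add0n /= => jn.
have [->|ji] := eqVneq j i; first by rewrite within_dist0 eqxx.
by rewrite (negbTE (dist i j _ _ _))// eq_sym.
Qed.

End isolated_points.

Section distinct_points.
Context {R : realType} {d : nat}.
Variables (nu : probability 'rV[R]_d R) (Q : probability (@traj _ 'rV[R]_d) R).
Hypothesis Qiid : iid_law nu Q.
Local Notation nb := (@within_dist R d).
Hypothesis no_atom : forall x, near_pr nu (nb 0) x = 0.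

(** Given the point of index j, the point of index i has no atom there. *)
Lemma coincide_null i j : i != j ->
  Q [set w | nb 0 (w i) (w j)] = 0%E.
Proof.
move=> ij; have m0 := @measurable_within_dist R d 0.
have me : measurable_fun setT (fun w : @traj _ 'rV[R]_d => nb 0 (w i) (w j)).
  by apply: (measurable_near m0); exact: measurable_coord.
have mset : measurable [set w : @traj _ 'rV[R]_d | nb 0 (w i) (w j)] by exact: measurable_bset.
have := integral_indic Q measurableT mset; rewrite setIT => <-.
apply/eqP; rewrite eq_le integral_ge0 ?andbT//.
have kb := kern_bool (R := R) m0.
have -> : (\int[Q]_w (\1_[set w : @traj _ 'rV[R]_d | nb 0 (w i) (w j)] w)%:E =
    \int[Q]_w ((nb 0 (w i) (w j))%:R)%:E)%E.
  apply: eq_integral => w _; rewrite indicE; congr ((nat_of_bool _)%:R%:E).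
  by apply/idP/idP => [/set_mem//|h]; rewrite mem_set.
apply: (le_trans (two_point Qiid (a := i) (b := j) (N := 0) (e := fun w => nb 0 (w i) (w j))
   (G := nb 0) (E := fun _ _ _ _ => true) (c := fun x y => (nb 0 x y)%:R) ij me _ _ _ _ _)) => //.
- move=> _ _ _; rewrite (_ : [set _ | true] = setT)//.
  by apply/seteqP; split.
- by case: kb.
- by move=> x y ->; rewrite big_nil.
have := @J_iter _ _ _ nu _ kb; rewrite /pair_int => ->.
rewrite integral0_eq// => x _; rewrite int_bool//.
by rewrite no_atom.
Qed.

(** Almost surely the sample points are distinct, and then each occurrence is the
first one. *)
Lemma first_isolated_count_ae r n (h : nat -> R) : (forall k, 0 <= h k) ->
  (\int[Q]_w (h (first_isolated_count r n w))%:E = \int[Q]_w (h (isocount (nb r) n w))%:E)%E.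
Proof.
move=> h0; apply: ge0_ae_eq_integral => //.
- apply/measurable_EFinP; apply: (measurableT_comp (f := h)) => //.
  exact: measurable_first_isolated_count.
- apply/measurable_EFinP; apply: (measurableT_comp (f := h)) => //.
  exact: (measurable_isocount (measurable_within_dist r)).
- by move=> w _; rewrite lee_fin.
- by move=> w _; rewrite lee_fin.
have ae2 : \forall w \ae Q, forall i j : nat, i != j -> ~~ nb 0 (w i) (w j).
  apply: ae_foralln => i; apply: ae_foralln => j.
  have [->|ij] := eqVneq i j; first by apply: aeW.
  exists [set w : @traj _ 'rV[R]_d | nb 0 (w i) (w j)]; split.
  - apply: measurable_bset; apply: (measurable_near (@measurable_within_dist R d 0)).
      exact: measurable_coord.
    exact: measurable_coord.
  - exact: coincide_null.
  - by move=> w /= nn; apply/negPn/negP => nb0; apply: nn.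
case: ae2 => B [mB QB sub]; exists B; split => // w /= nn; apply: sub => /= hw.
apply: nn => _; congr (h _)%:E.
by apply: first_isolated_distinct => i j _ _; exact: hw.
Qed.

End distinct_points.

(** * The binomial and Poisson samples *)

(** Reduces independence of functions of a bounded count to that of events. *)
Lemma integral_bounded_count {d} {T : measurableType d} {R : realType}
    (m : {measure set T -> \bar R}) (D : set T) (c : T -> nat) (k : nat) (h : nat -> R) :
  measurable D -> measurable_fun setT c -> (forall w, (c w <= k)%N) -> (forall j, 0 <= h j) ->
  (\int[m]_(w in D) (h (c w))%:E = \sum_(j < k.+1) (h j)%:E * m (c @^-1` [set (j : nat)] `&` D))%E.
Proof.
move=> mD mc ck h0.
have mS j : measurable (c @^-1` [set j]) by rewrite -[X in measurable X]setTI; exact: mc.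
transitivity (\int[m]_(w in D) \sum_(j < k.+1) (h j)%:E * (\1_(c @^-1` [set (j : nat)]) w)%:E)%E.
  apply: eq_integral => w _; have ck1 : (c w < k.+1)%N by rewrite ltnS.
  rewrite (bigD1 (Ordinal ck1))//= indicE mem_set// mule1 big1 ?adde0// => j jc.
  rewrite indicE memNset ?mule0// => /= cj; move: jc; rewrite -val_eqE /= cj eqxx.
  by [].
rewrite ge0_integral_sum//; last 2 first.
- move=> j; apply: measurable_funeM; apply: measurable_funTS.
  by apply/measurable_EFinP; exact: measurable_indic.
- by move=> j w _; rewrite mule_ge0 ?lee_fin.
apply: eq_bigr => j _; rewrite ge0_integralZl//.
- by rewrite integral_indic.
- by apply: measurable_funTS; apply/measurable_EFinP; exact: measurable_indic.
- by rewrite lee_fin.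
Qed.

Section sample_law.
Context {R : realType} {d : nat} {dOm : measure_display} {Om : measurableType dOm}.
Variables (P : probability Om R) (X : nat -> {RV P >-> 'rV[R]_d}) (f : 'rV[R]_d -> R).
Hypothesis X_iid : iid_with_density P X f.
Local Notation nb := (@within_dist R d).

Definition point_law : probability 'rV[R]_d R := distribution P (X 0%N).

Definition trajectory (w : Om) : @traj _ 'rV[R]_d := fun i => X i w.

Lemma measurable_trajectory : measurable_fun setT trajectory.
Proof. by apply: measurable_traj => i; exact: measurable_funPT. Qed.

Definition trajectory_mfun : {mfun Om >-> @traj _ 'rV[R]_d} :=
  mfun_Sub (mem_set measurable_trajectory).

Definition trajectory_law : probability (@traj _ 'rV[R]_d) R := distribution P trajectory_mfun.

Lemma point_lawE B : measurable B ->
  point_law B = (\int[@lebesgue_rV R d]_(x in B) (f x)%:E)%E.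
Proof. by move=> mB; case: X_iid => _ /(_ 0%N B mB). Qed.

Lemma trajectory_law_iid : iid_law point_law trajectory_law.
Proof.
move=> n E mE; case: X_iid => indep dens.
have := indep [fset i in iota 0 n]%fset (fun i => X i @^-1` E i).
have -> : \bigcap_(i in [set` [fset i in iota 0 n]%fset]) (X i @^-1` E i) =
    trajectory @^-1` cyl n E.
  apply/seteqP; split => [w h i iN|w h i /=].
    by apply: (h i); rewrite /= !inE mem_iota.
  by rewrite !inE mem_iota /= => iN; exact: h.
have -> : (\prod_(i <- [fset i in iota 0 n]%fset) P (X i @^-1` E i) =
    \prod_(0 <= i < n) point_law (E i))%E.
  rewrite (perm_big (index_iota 0 n)) /=; last first.
    apply: uniq_perm; [exact: fset_uniq|exact: iota_uniq|].
    by move=> i; rewrite !inE /index_iota subn0.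
  by apply: eq_bigr => i _; rewrite dens// point_lawE.
by apply=> i _; exists (E i) => //; rewrite setTI.
Qed.

Lemma trajectory_integral (F : @traj _ 'rV[R]_d -> \bar R) : measurable_fun setT F ->
  (forall w, (0 <= F w)%E) ->
  (\int[P]_w F (trajectory w) = \int[trajectory_law]_w F w)%E.
Proof. by move=> mF F0; rewrite [RHS]ge0_integral_pushforward. Qed.

Lemma sample_count r n w :
  num_isolated (sample X n w) r = first_isolated_count r n (trajectory w).
Proof. exact: num_isolatedE. Qed.

Hypothesis no_atom : forall x, near_pr point_law (nb 0) x = 0.

Let mcount (h : nat -> R) r n :
  measurable_fun setT (fun w : @traj _ 'rV[R]_d => (h (first_isolated_count r n w))%:E).
Proof.
apply/measurable_EFinP; apply: (measurableT_comp (f := h)) => //.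
exact: measurable_first_isolated_count.
Qed.

Lemma measurable_binomial_count r n :
  measurable_fun setT (fun w => num_isolated (sample X n w) r).
Proof.
rewrite (_ : (fun w => _) = first_isolated_count r n \o trajectory); last first.
  by apply/funext => w; exact: sample_count.
by apply: measurableT_comp; [exact: measurable_first_isolated_count|
  exact: measurable_trajectory].
Qed.

Lemma binomial_count_law r n (h : nat -> R) : (forall k, 0 <= h k) ->
  (\int[P]_w (h (num_isolated (sample X n w) r))%:E =
   mix (point_weight n) (fun k => \int[trajectory_law]_w (h (isocount (nb r) k w))%:E))%E.
Proof.
move=> h0; rewrite mix_point; last first.
  by move=> k; apply: integral_ge0 => w _; rewrite lee_fin.
rewrite -(first_isolated_count_ae trajectory_law_iid no_atom)// -trajectory_integral//.
  by apply: eq_integral => w _; rewrite sample_count.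
by move=> w; rewrite lee_fin.
Qed.

Section poisson.
Variable Z : R -> {RV P >-> nat}.
Hypothesis Z_poisson : unit_poisson_process P Z.
Hypothesis XZ_indep : independent_families P X Z.
Variable t : R.
Hypothesis t_gt0 : 0 < t.

Let mZ k : measurable (Z t @^-1` [set k]).
Proof. by rewrite -[X in measurable X]setTI; exact: (measurable_funPT (Z t)). Qed.

Lemma poisson_count_pmf k : P (Z t @^-1` [set k]) = (poisson_pmf t k)%:E.
Proof.
case: Z_poisson => Z0 _ _ inc _; have := inc 0 t k (lexx _) t_gt0.
rewrite subr0 => <-; congr (P _); apply/seteqP; split => w /=; rewrite Z0 subn0//.
Qed.

(** Events on the whole sequence X belong to the sigma-algebra generated by the
family, since cylinders do. *)
Lemma trajectory_indep (C : set (@traj _ 'rV[R]_d)) k : measurable C ->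
  (P (trajectory @^-1` C `&` Z t @^-1` [set k]) =
   trajectory_law C * P (Z t @^-1` [set k]))%E.
Proof.
move=> mC; apply: XZ_indep; last first.
  apply: sub_sigma_algebra; exists t => //; exists [set k] => //.
  by rewrite setTI.
pose G := [set C | sigma_of_family setT (fun i => X i : Om -> _) (trajectory @^-1` C)].
suff : measurable `<=` G by exact.
apply: smallest_sub.
  split; rewrite /G /=.
  - by rewrite preimage_set0; exact: sigma_algebra0.
  - move=> B GB; rewrite setTD preimage_setC -setTD; exact: sigma_algebraCD.
  - by move=> F GF; rewrite preimage_bigcup; exact: sigma_algebra_bigcup.
move=> _ [n [E [mE ->]]]; rewrite /G /=.
have -> : trajectory @^-1` cyl n E = \bigcap_i (if (i < n)%N then X i @^-1` E i else setT).
  apply/seteqP; split => [w h i _|w h i iN]; first by case: ifPn => // /h.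
  by have := h i I; rewrite iN.
apply: (@bigcapT_measurable _ (g_sigma_algebraType
  (\bigcup_(i in setT) sigma_of (X i : Om -> _)))) => i.
case: ifPn => _; last exact: measurableT.
apply: sub_sigma_algebra; exists i => //; exists (E i); first exact: mE.
by rewrite setTI.
Qed.

Lemma measurable_poisson_count r :
  measurable_fun setT (fun w => num_isolated (sample X (Z t w) w) r).
Proof.
move=> _ B _; rewrite setTI.
have -> : (fun w => num_isolated (sample X (Z t w) w) r) @^-1` B =
   \bigcup_k (Z t @^-1` [set k] `&` ((fun w => num_isolated (sample X k w) r) @^-1` B)).
  apply/seteqP; split => [w Bw|w [k _ [/= <-]]//].
  by exists (Z t w).
apply: bigcupT_measurable => k; apply: measurableI => //.
by rewrite -[X in measurable X]setTI; exact: measurable_binomial_count.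
Qed.

(** Split according to the value k of Z t, which is independent of the sample. *)
Lemma poisson_count_law r (h : nat -> R) : (forall k, 0 <= h k) ->
  (\int[P]_w (h (num_isolated (sample X (Z t w) w) r))%:E =
   mix (poisson_pmf t) (fun k => \int[trajectory_law]_w (h (isocount (nb r) k w))%:E))%E.
Proof.
move=> h0.
have mW : measurable_fun setT (fun w => (h (num_isolated (sample X (Z t w) w) r))%:E).
  apply/measurable_EFinP; apply: (measurableT_comp (f := h)) => //.
  exact: measurable_poisson_count.
have UT : \bigcup_k (Z t @^-1` [set k]) = setT.
  by apply/seteqP; split => // w _; exists (Z t w).
rewrite -UT ge0_integral_bigcup//; last 3 first.
- by rewrite UT.
- by move=> w _; rewrite lee_fin.
- by apply/trivIsetP => i j _ _ ij; apply/seteqP; split => // w /= [-> /eqP]; rewrite (negbTE ij).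
apply: eq_eseriesr => k _.
rewrite -(first_isolated_count_ae trajectory_law_iid no_atom)//.
transitivity (\int[P]_(w in Z t @^-1` [set k]) (h (first_isolated_count r k (trajectory w)))%:E)%E.
  apply: eq_integral => w; rewrite inE /= => Zk; rewrite Zk.
  by rewrite sample_count.
have mc := @measurable_first_isolated_count R d r k.
rewrite (@integral_bounded_count _ _ _ P _ (fun w => first_isolated_count r k (trajectory w)) k)//;
  last 2 first.
- by apply: (measurableT_comp mc); exact: measurable_trajectory.
- by move=> w; exact: first_isolated_count_le.
rewrite (@integral_bounded_count _ _ _ trajectory_law _ (first_isolated_count r k) k)//; last first.
  by move=> w; exact: first_isolated_count_le.
rewrite ge0_sume_distrr; last first.
  by move=> j _; rewrite mule_ge0// lee_fin.
apply: eq_bigr => j _; rewrite setIT muleCA; congr (_ * _)%E.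
rewrite -poisson_count_pmf muleC -trajectory_indep//.
by rewrite -[X in measurable X]setTI; exact: mc.
Qed.

End poisson.
End sample_law.

(** * From the bounds to Kolmogorov distances *)

Lemma square_le_exp (R : realType) (c : R) : 0 < c ->
  exists2 K : R, 0 < K & forall s, 0 <= s -> (1 + s) ^+ 2 <= K * expR (c * s).
Proof.
move=> c0; have k0 : 0 < 1 + 2 / c by rewrite ltr_wpDr// divr_ge0// ltW.
exists ((1 + 2 / c) ^+ 2) => [|s s0]; first by rewrite exprn_gt0.
have -> : expR (c * s) = expR (c * s / 2) ^+ 2.
  by rewrite -expRM_natl; congr expR; field.
rewrite -exprMn lerXn2r// ?nnegrE ?addr_ge0// ?mulr_ge0 ?expR_ge0 ?(ltW k0)//.
apply: (@le_trans _ _ ((1 + 2 / c) * (1 + c * s / 2))); last first.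
  by rewrite ler_wpM2l ?(ltW k0)// expR_ge1Dx.
have -> : (1 + 2 / c) * (1 + c * s / 2) = 1 + s + (2 / c + c * s / 2).
  by field; rewrite gt_eqF.
by rewrite lerDl addr_ge0// divr_ge0// ?mulr_ge0// ltW.
Qed.

Definition clt_const {R : realType} (D : R) : R :=
  mills_bound * (1 + D) + 10 + 16 * D.

Lemma clt_const_gt0 (R : realType) (D : R) : 0 <= D -> 0 < clt_const D.
Proof.
move=> D0; have m0 : 0 <= mills_bound :> R.
  by apply: le_trans ler01 _; exact: mills_bound_ge1.
have h1 : 0 <= mills_bound * (1 + D) by rewrite mulr_ge0// addr_ge0.
rewrite /clt_const; lra.
Qed.

(** With h^2 lam = 1, each term on the left is at most a constant times h or e. *)
Lemma clt_bound_le (R : realType) (D lam e alpha sigma h : R) :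
  0 <= D -> 0 < lam -> 0 <= e <= 1 -> 0 <= alpha -> 0 <= sigma ->
  alpha <= D * lam * e ^+ 2 -> sigma ^+ 2 <= D * lam * e ^+ 2 ->
  0 <= mills_bound :> R -> h = (Num.sqrt lam)^-1 ->
  h * mills_bound * (1 + sigma) +
  h ^+ 2 * (6 * Num.sqrt (lam + alpha + sigma ^+ 2) + 6 * alpha + 4 * sigma) <=
  clt_const D * (e + h).
Proof.
move=> D0 lam0 /andP[e0 e1] al0 s0 al sl m0 hE.
have h0 : 0 < h by rewrite hE invr_gt0 sqrtr_gt0.
have hl : h ^+ 2 * lam = 1.
  by rewrite hE exprVn sqr_sqrtr ?(ltW lam0)// mulVf// gt_eqF.
have e2 : e ^+ 2 <= e by rewrite expr2 ler_piMl.
have e20 : 0 <= e ^+ 2 by rewrite sqr_ge0.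
have h20 : 0 <= h ^+ 2 by rewrite sqr_ge0.
have hal : h ^+ 2 * alpha <= D * e ^+ 2.
  apply: (le_trans (ler_wpM2l h20 al)).
  have -> : h ^+ 2 * (D * lam * e ^+ 2) = (h ^+ 2 * lam) * (D * e ^+ 2) by ring.
  by rewrite hl mul1r.
have hs2 : h ^+ 2 * sigma ^+ 2 <= D * e ^+ 2.
  apply: (le_trans (ler_wpM2l h20 sl)).
  have -> : h ^+ 2 * (D * lam * e ^+ 2) = (h ^+ 2 * lam) * (D * e ^+ 2) by ring.
  by rewrite hl mul1r.
have hs : h * sigma <= (1 + D) * e.
  rewrite -(@ler_pXn2r _ 2)// ?nnegrE ?mulr_ge0 ?addr_ge0 ?(ltW h0)//.
  rewrite !exprMn; apply: (le_trans hs2); rewrite ler_wpM2r//.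
  by have := sqr_ge0 D; rewrite sqrrD; lra.
have hr : h * Num.sqrt (lam + alpha + sigma ^+ 2) <= 1 + 2 * D.
  rewrite -(@ler_pXn2r _ 2)// ?nnegrE ?mulr_ge0 ?addr_ge0 ?mulr_ge0 ?(ltW h0) ?sqrtr_ge0//.
  rewrite exprMn sqr_sqrtr; last by rewrite !addr_ge0// ?sqr_ge0// ltW.
  rewrite !mulrDr hl.
  have : D * e ^+ 2 <= D by rewrite ler_piMr// (le_trans e2).
  by have := sqr_ge0 D; rewrite sqrrD exprMn; lra.
have hD : D * e ^+ 2 <= D * e by rewrite ler_wpM2l.
have hsm : mills_bound * (h * sigma) <= mills_bound * ((1 + D) * e) by rewrite ler_wpM2l.
have hhs : h * (h * sigma) <= h * (1 + D).
  rewrite ler_wpM2l ?(ltW h0)//; apply: (le_trans hs).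
  by rewrite ler_piMr// addr_ge0.
have hhr := ler_wpM2l (ltW h0) hr.
rewrite /clt_const.
set S := Num.sqrt _ in hr hhr *.
have -> : h * mills_bound * (1 + sigma) + h ^+ 2 * (6 * S + 6 * alpha + 4 * sigma) =
  mills_bound * h + mills_bound * (h * sigma) + (6 * (h * (h * S)) + 6 * (h ^+ 2 * alpha)
  + 4 * (h * (h * sigma))) by ring.
have Dh : 0 <= D * h by rewrite mulr_ge0// ltW.
have De : 0 <= D * e by rewrite mulr_ge0.
have mh : 0 <= mills_bound * (D * h) by rewrite mulr_ge0.
have me : 0 <= mills_bound * (D * e) by rewrite mulr_ge0.
have me' : 0 <= mills_bound * e by rewrite mulr_ge0.
move: (mills_bound) (h * (h * S)) (h ^+ 2 * alpha) (h * (h * sigma)) (h * sigma) hhr hal hhs hsm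
  hD mh me me' => m x1 x2 x3 x4; nra.
Qed.

Section summary.
Context {R : realType} {d' : measure_display} {Om' : measurableType d'}.
Variables (p : nat -> R) (Q : probability Om' R) (S : nat -> Om' -> nat).
Hypothesis p0 : forall k, 0 <= p k.
Hypothesis mS : forall k, measurable_fun setT (S k).
Variables (lam : nat -> R) (err : nat -> \bar R).
Hypothesis lam0 : forall k, 0 <= lam k.
Hypothesis err0 : forall k, (0 <= err k)%E.
Hypothesis S_stein : forall (g : nat -> R) (L : R) (k : nat),
  (forall j, 0 <= g j) -> (forall j, `|g j.+1 - g j| <= L) ->
  (\int[Q]_w ((S k w)%:R * g (S k w))%:E <=
     (lam k)%:E * \int[Q]_w (g (S k w).+1)%:E + L%:E * err k)%E /\
  ((lam k)%:E * \int[Q]_w (g (S k w).+1)%:E <=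
     \int[Q]_w ((S k w)%:R * g (S k w))%:E + L%:E * err k)%E.
Context {dOm : measure_display} {Om : measurableType dOm}.
Variables (P : probability Om R) (W : Om -> nat).
Hypothesis mW : measurable_fun setT W.
Hypothesis HW : forall h : nat -> R, (forall j, 0 <= h j) ->
  (\int[P]_w (h (W w))%:E)%E = mix p (fun k => (\int[Q]_w (h (S k w))%:E)%E).
Variables lambda D e : R.
Hypothesis lambda_gt0 : 0 < lambda.
Hypothesis D_gt0 : 0 < D.
Hypothesis e_gt0 : 0 < e.
Hypothesis e_le1 : e <= 1.
Hypothesis mix_lam : mix p (fun k => (lam k)%:E) = lambda%:E.
Hypothesis mix_lam2 : (mix p (fun k => (lam k ^+ 2)%:E) <=
  (lambda ^+ 2 + D * lambda * e ^+ 2)%:E)%E.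
Hypothesis mix_err : (mix p err <= (D * lambda * e ^+ 2)%:E)%E.

Let a : R := D * lambda * e ^+ 2.
Let a_gt0 : 0 < a. Proof. by rewrite !mulr_gt0// exprn_gt0. Qed.
Let s : R := Num.sqrt a.
Let s_gt0 : 0 < s. Proof. by rewrite sqrtr_gt0. Qed.
Let s2 : s ^+ 2 = a. Proof. by rewrite sqr_sqrtr// ltW. Qed.
Let mix_lam2' : (mix p (fun k => (lam k ^+ 2)%:E) <= (lambda ^+ 2 + s ^+ 2)%:E)%E.
Proof. by rewrite s2. Qed.

Lemma count_variance : exists2 v : R, 'V_P[Wr W] = v%:E &
  `|v - lambda| <= 2 * D * lambda * e ^+ 2.
Proof.
have [v vE hv] := mixture_variance p0 mS lam0 err0 S_stein mW HW lambda_gt0 mix_lam mix_lam2' mix_err.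
exists v => //; apply: (le_trans hv); rewrite s2 /a; lra.
Qed.

(** The bound of mixture_clt does not depend on z. *)
Lemma count_dK : `|dK_normal P (fun w => (Wr W w - lambda) / Num.sqrt lambda)| <=
  clt_const D * (e + (Num.sqrt lambda)^-1).
Proof.
have clt z := mixture_clt p0 mS lam0 err0 S_stein mW HW lambda_gt0 (ltW a_gt0) s_gt0
  mix_lam mix_lam2' mix_err z erefl.
have bound z : `|fine (pushforward P (fun w => (Wr W w - lambda) / Num.sqrt lambda)
    `]-oo, z]%classic) - fine (normal_prob 0 1 `]-oo, z]%classic)| <=
  clt_const D * (e + (Num.sqrt lambda)^-1).
  have := clt z; rewrite /pushforward.
  have -> : (fun w => (Wr W w - lambda) / Num.sqrt lambda) @^-1` `]-oo, z]%classic =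
      [set w | ((W w)%:R - lambda) / Num.sqrt lambda <= z].
    by apply/seteqP; split => w /=; rewrite in_itv.
  move/le_trans; apply; apply: clt_bound_le => //.
  - exact: ltW.
  - by rewrite (ltW e_gt0).
  - exact: ltW.
  - exact: ltW.
  - by rewrite s2.
  - by apply: le_trans ler01 _; exact: mills_bound_ge1.
rewrite /dK_normal /kolmogorov_dist ger0_norm.
  by apply: ge_sup => [|_ [z _ <-] //]; eexists; exists 0.
apply: le_trans (ub_le_sup _ _); last by exists 0.
- exact: normr_ge0.
- by eexists => _ [z _ <-]; exact: bound.
Qed.

End summary.

(** * Exponential decay of the errors *)

Section regime.
Context {R : realType} {d : nat}.
Variables (A : set 'rV[R]_d) (nu : probability 'rV[R]_d R) (c C r1 : R).
Hypothesis mA : measurable A.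
Hypothesis nuA : nu A = 1%E.
Local Notation nb := (@within_dist R d).
Hypothesis c_gt0 : 0 < c.
Hypothesis C_gt0 : 0 < C.
Hypothesis r1_gt0 : 0 < r1.
Hypothesis ball_le : forall r, 0 < r -> forall x, near_pr nu (nb r) x <= C * r ^+ d.
Hypothesis ball_ge : forall r, 0 < r < r1 -> forall x, A x -> c * r ^+ d <= near_pr nu (nb r) x.

Definition poisson_mean_at (t r : R) : R := t * mexp nu (nb r) t.
Local Notation I := poisson_mean_at.
(** The rate at which every error decays, as a function of s = t r^d: each error is
at most a constant times s^2 exp (- c s), hence a constant times this squared. *)
Definition decay (s : R) : R := expR (- (c / 4 * s)).

Lemma decay_gt0 s : 0 < decay s. Proof. exact: expR_gt0. Qed.

Lemma decay_le1 s : 0 <= s -> decay s <= 1.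
Proof. by move=> s0; rewrite -expR0 ler_expR oppr_le0 mulr_ge0// divr_ge0// ltW. Qed.

Lemma decay2 s : decay s ^+ 2 = expR (- (c / 2 * s)).
Proof. by rewrite -expRM_natl; congr expR; field. Qed.

Lemma poisson_mean_le t r : 0 < t -> 0 < r < r1 ->
  I t r <= t * expR (- (c * (t * r ^+ d))).
Proof.
move=> t0 rr; rewrite ler_wpM2l ?(ltW t0)//.
have -> : c * (t * r ^+ d) = t * (c * r ^+ d) by ring.
by apply: (mexp_le (measurable_within_dist r) mA nuA t0); exact: ball_ge.
Qed.

(** If the radius stayed large, the expected number of isolated points would be
bounded. *)
Lemma radius_lt t r : 0 < t -> 0 < r -> (c * (r1 / 2) ^+ d)^-1 < I t r -> r < r1.
Proof.
move=> t0 r0; apply: contraTT; rewrite -!leNgt => r1r.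
have r20 : 0 < r1 / 2 by rewrite divr_gt0.
have r2 : 0 < r1 / 2 < r1 by rewrite r20/= ltr_pdivrMr// ltr_pMr// ltr1n.
set k := c * (r1 / 2) ^+ d.
have k0 : 0 < k by rewrite mulr_gt0// exprn_gt0.
have mk : mexp nu (nb r) t <= expR (- (t * k)).
  apply: (mexp_le (measurable_within_dist r) mA nuA t0) => x Ax.
  apply: le_trans (ball_ge r2 Ax) _.
  apply: pr_le; [exact: measurable_eball|exact: measurable_eball|].
  move=> y; rewrite /= /within_dist => /le_trans; apply; apply: le_trans r1r.
  by case/andP: r2 => _ /ltW.
apply: (le_trans (ler_wpM2l (ltW t0) mk)).
rewrite expRN ler_pdivrMr ?expR_gt0// mulrC ler_pdivlMr//.
by have := expR_ge1Dx (t * k); lra.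
Qed.

(** I >= 1 and I <= t exp (- c s) give t >= exp (c s), so C r^d = C s / t and t (C
r^d)^2 = C^2 s^2 / t are exponentially small in s; for s large this makes them at
most 1/2. *)
Lemma regime : exists D s0 I0 : R, [/\ 0 < D, 0 <= s0 & forall t r, 0 < t -> 0 < r ->
  s0 <= t * r ^+ d -> I0 <= I t r ->
  [/\ 1 <= I t r, 0 < r < r1,
   2 * (C * r ^+ d) + 2 * (t * (C * r ^+ d) ^+ 2) <= D * decay (t * r ^+ d) ^+ 2 &
   2 * (D * decay (t * r ^+ d) ^+ 2) <= 1]].
Proof.
have [K K0 hK] := @square_le_exp R (c / 2) (divr_gt0 c_gt0 (ltr0Sn _ _)).
pose D := 2 * C * K + 2 * C ^+ 2 * K.
have D0 : 0 < D by rewrite addr_gt0// !mulr_gt0// exprn_gt0.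
(* by 1 + x <= exp x, the threshold 4 D / c gives 2 D exp (- c s / 2) <= 1 *)
exists D, (4 * D / c), (1 + (c * (r1 / 2) ^+ d)^-1); split => //.
  by rewrite divr_ge0 ?(ltW c_gt0)// mulr_ge0// ltW.
move=> t r t0 r0 s0 I0.
have r20 : 0 < r1 / 2 by rewrite divr_gt0.
have k0 : 0 < (c * (r1 / 2) ^+ d)^-1 by rewrite invr_gt0 mulr_gt0// exprn_gt0.
have I1 : 1 <= I t r by apply: le_trans I0; rewrite lerDl ltW.
have rr : 0 < r < r1.
  by rewrite r0 (radius_lt t0 r0)//; apply: lt_le_trans I0; rewrite ltrDr.
have sE : 0 < t * r ^+ d by rewrite mulr_gt0// exprn_gt0.
set s := t * r ^+ d in s0 sE *.
have s_ge0 := ltW sE.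
have te : expR (c * s) <= t.
  have := le_trans I1 (poisson_mean_le t0 rr); rewrite -/s expRN.
  by rewrite ler_pdivlMr ?expR_gt0// mul1r.
split => //.
- have rE : r ^+ d = s / t by rewrite /s mulrAC mulfV ?mul1r// gt_eqF.
  have s2 : s ^+ 2 <= (1 + s) ^+ 2 by rewrite lerXn2r// ?nnegrE ?addr_ge0// lerDr.
  have s1 : s <= (1 + s) ^+ 2 by rewrite sqrrD; have := sqr_ge0 s; lra.
  (* a bound by K exp (c s / 2) on the numerator is divided by t >= exp (c s) *)
  have div x : 0 <= x -> x <= (1 + s) ^+ 2 -> x / t <= K * decay s ^+ 2.
    move=> x0 xs; rewrite ler_pdivrMr// decay2; apply: (le_trans xs).
    apply: (le_trans (hK s s_ge0)); rewrite -[leRHS]mulrA ler_wpM2l ?(ltW K0)//.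
    apply: (@le_trans _ _ (expR (- (c / 2 * s)) * expR (c * s))).
      by rewrite -expRD ler_expR le_eqVlt; apply/orP; left; apply/eqP; field.
    by rewrite ler_wpM2l ?expR_ge0.
  have d1 := div s s_ge0 s1; have d2 := div (s ^+ 2) (sqr_ge0 s) s2.
  rewrite rE (_ : 2 * (C * (s / t)) + 2 * (t * (C * (s / t)) ^+ 2) =
      2 * C * (s / t) + 2 * C ^+ 2 * (s ^+ 2 / t)); last first.
    by field; rewrite gt_eqF.
  rewrite /D [leRHS]mulrDl; apply: lerD.
    by rewrite -[leRHS]mulrA ler_wpM2l// mulr_ge0// ltW.
  by rewrite -[leRHS]mulrA ler_wpM2l// mulr_ge0// sqr_ge0.
- rewrite decay2 expRN mulrA ler_pdivrMr ?expR_gt0// mul1r.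
  apply: le_trans (expR_ge1Dx _); move: s0; rewrite ler_pdivrMr// => h; lra.
Qed.

(** Polynomials in s are absorbed by exp (c s / 2). *)
Lemma poly_error : exists2 D : R, 0 < D & forall s, 0 <= s ->
  expR (- (c * s)) * (expR 1 * (C * s) + expR 1 * (1 + C * s) ^+ 2 + 4 * (C * 2 ^+ d * s))
    <= D * decay s ^+ 2 /\
  expR (- (c * s)) * (expR 1 * (C * s) ^+ 2 + 1 + expR 1) <= D * decay s ^+ 2.
Proof.
have [K K0 hK] := @square_le_exp R (c / 2) (divr_gt0 c_gt0 (ltr0Sn _ _)).
have e0 : 0 < expR 1 :> R := expR_gt0 _.
have C2 : 0 < C * 2 ^+ d by rewrite mulr_gt0// exprn_gt0.
pose K1 := expR 1 * C + expR 1 * (1 + C) ^+ 2 + 4 * (C * 2 ^+ d).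
pose K2 := expR 1 * C ^+ 2 + 1 + expR 1.
have C12 : 0 < (1 + C) ^+ 2 by rewrite exprn_gt0// addr_gt0.
have Csq : 0 < C ^+ 2 by rewrite exprn_gt0.
have K10 : 0 < K1 by apply: addr_gt0; [apply: addr_gt0|]; exact: mulr_gt0.
have K20 : 0 < K2 by apply: addr_gt0 e0; apply: addr_gt0 => //; exact: mulr_gt0.
exists ((K1 + K2) * K); first by rewrite mulr_gt0// addr_gt0.
move=> s s0.
have b1 : 1 <= (1 + s) ^+ 2 by rewrite sqrrD; have := sqr_ge0 s; lra.
have b2 : s <= (1 + s) ^+ 2 by rewrite sqrrD; have := sqr_ge0 s; lra.
have b3 : s ^+ 2 <= (1 + s) ^+ 2 by rewrite lerXn2r// ?nnegrE ?addr_ge0// lerDr.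
have b4 : (1 + C * s) ^+ 2 <= (1 + C) ^+ 2 * (1 + s) ^+ 2.
  rewrite -exprMn lerXn2r// ?nnegrE ?mulr_ge0 ?addr_ge0 ?mulr_ge0 ?(ltW C_gt0)//.
  by have := ltW C_gt0; nra.
have main L x : 0 <= L -> L <= K1 + K2 -> x <= L * (1 + s) ^+ 2 ->
    expR (- (c * s)) * x <= (K1 + K2) * K * decay s ^+ 2.
  move=> L0 LK xL; apply: (@le_trans _ _ (expR (- (c * s)) * (L * (K * expR (c / 2 * s))))).
    by rewrite ler_wpM2l ?expR_ge0//; apply: (le_trans xL); rewrite ler_wpM2l// hK.
  rewrite decay2 (_ : expR (- (c / 2 * s)) = expR (- (c * s)) * expR (c / 2 * s)); last first.
    by rewrite -expRD; congr expR; field.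
  rewrite (_ : _ * (L * _) = L * (K * (expR (- (c * s)) * expR (c / 2 * s)))); last by ring.
  rewrite -[leRHS]mulrA ler_wpM2r// mulr_ge0 ?(ltW K0)// mulr_ge0// expR_ge0.
split.
  apply: (main K1); [exact: ltW|by rewrite lerDl ltW|].
  have h1 : expR 1 * (C * s) <= expR 1 * C * (1 + s) ^+ 2.
    by rewrite -[leRHS]mulrA !ler_wpM2l// ltW.
  have h2 : expR 1 * (1 + C * s) ^+ 2 <= expR 1 * (1 + C) ^+ 2 * (1 + s) ^+ 2.
    by rewrite -[leRHS]mulrA ler_wpM2l// ltW.
  have h3 : 4 * (C * 2 ^+ d * s) <= 4 * (C * 2 ^+ d) * (1 + s) ^+ 2.
    by rewrite -[leRHS]mulrA ler_wpM2l// ler_wpM2l// ltW.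
  by rewrite /K1 [leRHS]mulrDl [X in _ <= X + _]mulrDl lerD// lerD.
apply: (main K2); [exact: ltW|by rewrite lerDr ltW|].
rewrite /K2 [leRHS]mulrDl [X in _ <= X + _]mulrDl exprMn; apply: lerD; [apply: lerD|].
- by rewrite -[leRHS]mulrA ler_wpM2l ?(ltW e0)// ler_wpM2l// ltW.
- by rewrite mul1r.
- by rewrite ler_peMr// ltW.
Qed.

End regime.

(** * Estimates at a given time *)

Section landau.
Context {R : realType} {T : Type}.
Variable F : filter_on T.

Lemma eqO_of_bound (g h : T -> R) (K : R) : 0 < K ->
  (\forall x \near F, `|g x| <= K * h x) -> g =O_F h.
Proof.
move=> K0 H; apply/eqO_exP; exists K => //; apply: filterS H => x /le_trans; apply.
by rewrite ler_wpM2l ?(ltW K0)// ler_norm.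
Qed.

Lemma eq_1plusO_of_bound (E : T -> \bar R) (I h : T -> R) (K : R) : 0 < K ->
  (\forall x \near F, exists v : R, [/\ E x = v%:E, 0 < I x & `|v - I x| <= K * I x * h x]) ->
  eq_1plusO F E I h.
Proof.
move=> K0 H; exists (fun x => fine (E x) / I x - 1).
  apply: (eqO_of_bound K0); apply: filterS H => x [v [-> I0 hv]] /=.
  have -> : v / I x - 1 = (v - I x) / I x by field; rewrite gt_eqF.
  rewrite normrM (gtr0_norm (x := (I x)^-1)) ?invr_gt0// ler_pdivrMr//.
  by rewrite mulrAC.
apply: filterS H => x [v [-> I0 _]] /=; congr (_%:E).
by field; rewrite gt_eqF.
Qed.

End landau.

Section at_time.
Context {R : realType} {d : nat} {dOm : measure_display} {Om : measurableType dOm}.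
Variables (A : set 'rV[R]_d) (f : 'rV[R]_d -> R).
Variables (P : probability Om R) (X : nat -> {RV P >-> 'rV[R]_d}).
Hypothesis X_iid : iid_with_density P X f.
Local Notation nb := (@within_dist R d).
Local Notation nu := (point_law X).
Local Notation Q := (trajectory_law X).
Hypothesis no_atom : forall x, near_pr nu (nb 0) x = 0.
Hypothesis mA : measurable A.
Hypothesis nuA : nu A = 1%E.
Variables c C r1 D1 D2 : R.
Hypothesis c_gt0 : 0 < c.
Hypothesis C_gt0 : 0 < C.
Hypothesis D1_gt0 : 0 < D1.
Hypothesis D2_gt0 : 0 < D2.
Hypothesis ball_le : forall r, 0 < r -> forall x, near_pr nu (nb r) x <= C * r ^+ d.
Hypothesis ball_ge : forall r, 0 < r < r1 ->
  (forall x, A x -> c * r ^+ d <= near_pr nu (nb r) x) /\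
  (forall x y, A x -> A y -> ring2 (nb r) (nb (2 * r)) x y ->
    near_pr nu (nb r) x + c * r ^+ d <= near_pr2 nu (nb r) x y \/
    near_pr nu (nb r) y + c * r ^+ d <= near_pr2 nu (nb r) x y).
Hypothesis poly_err : forall s, 0 <= s ->
  expR (- (c * s)) * (expR 1 * (C * s) + expR 1 * (1 + C * s) ^+ 2 + 4 * (C * 2 ^+ d * s))
    <= D2 * decay c s ^+ 2 /\
  expR (- (c * s)) * (expR 1 * (C * s) ^+ 2 + 1 + expR 1) <= D2 * decay c s ^+ 2.
Variables t r : R.
Hypothesis t_gt0 : 0 < t.
Hypothesis r_gt0 : 0 < r.
Hypothesis r_lt : r < r1.
Local Notation I := (poisson_mean_at nu t r).
Hypothesis I_ge1 : 1 <= I.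
Local Notation s := (t * r ^+ d).
Local Notation e := (decay c s).
Hypothesis radius_small :
  2 * (C * r ^+ d) + 2 * (t * (C * r ^+ d) ^+ 2) <= D1 * e ^+ 2.
Hypothesis error_small : 2 * (D1 * e ^+ 2) <= 1.

Let mnb := @measurable_within_dist R d r.
Let mnb2 := @measurable_within_dist R d (2 * r).
Let nbC := @within_distC R d r.
Let nb2C := @within_distC R d (2 * r).
Let I_gt0 : 0 < I. Proof. exact: lt_le_trans I_ge1. Qed.
Let s_ge0 : 0 <= s. Proof. by rewrite mulr_ge0 ?exprn_ge0// ltW. Qed.
Let rd_ge0 : 0 <= r ^+ d. Proof. by rewrite exprn_ge0// ltW. Qed.
Let Crd_ge0 : 0 <= C * r ^+ d. Proof. by rewrite mulr_ge0// ltW. Qed.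
Let e_gt0 : 0 < e. Proof. exact: decay_gt0. Qed.
Let e_le1 : e <= 1. Proof. exact: decay_le1. Qed.
Let e2_le : e ^+ 2 <= e. Proof. by rewrite expr2 ler_piMl// ltW. Qed.

Let nb_nb2 x y z : nb r x z -> nb r y z -> nb (2 * r) x y.
Proof.
rewrite /within_dist => xz yz; apply: (le_trans (edist_triangle _ _ z)).
by rewrite (edistC z) mulrDl mul1r lerD.
Qed.

Let tb1 : t * (C * r ^+ d) ^+ 2 <= 1.
Proof.
have h : 0 <= t * (C * r ^+ d) ^+ 2 by rewrite mulr_ge0 ?sqr_ge0// ltW.
have := radius_small; have := error_small; have := Crd_ge0; lra.
Qed.

Let rr : 0 < r < r1. Proof. by rewrite r_gt0. Qed.

Let err k := pair_int nu (errk nu (nb r) (nb (2 * r)) k).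

Let err_ge0 k : (0 <= err k)%E.
Proof. by apply: J_ge0; exact: kern_errk. Qed.

Let lam_ge0 k : 0 <= count_mean Q (nb r) k. Proof. exact: count_mean_ge0. Qed.

Let stein (g : nat -> R) (L : R) (k : nat) (g0 : forall j, 0 <= g j)
  (gL : forall j, `|g j.+1 - g j| <= L) :=
  stein_count (trajectory_law_iid X_iid) mnb mnb2 nbC nb_nb2 g0 gL k.

(** The bound err_bound at b1 = C r^d, b2 = C (2 r)^d and l = c r^d, in terms of
s. *)
Lemma mix_err_le (p : nat -> R) (w : R) : (forall k, 0 <= p k) -> 0 <= w ->
  (forall j v, (j <= 3)%N -> 0 <= v <= 1 ->
    (mix p (fun k => (ffw j v k)%:E) <= (w * (t ^+ j * expR (- (t * (1 - v)))))%:E)%E) ->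
  (mix p err <= (w * I * (D2 * e ^+ 2))%:E)%E.
Proof.
move=> p0 w0 hw.
have hl : 0 <= c * r ^+ d by rewrite mulr_ge0// ltW.
have hb2 : 0 <= C * (2 * r) ^+ d by rewrite mulr_ge0 ?exprn_ge0// ?mulr_ge0// ltW.
have r2 : 0 < 2 * r by rewrite mulr_gt0.
apply: (le_trans (mix_J_errk mnb mnb2 nb2C mA nuA t_gt0 hl Crd_ge0 hb2 (ball_le r_gt0)
  (ball_ge rr).1 (ball_le r2) (ball_ge rr).2 tb1 p0 w0 hw)).
have wI : 0 <= w * I := mulr_ge0 w0 (ltW I_gt0).
rewrite lee_fin /err_bound -/I -[leLHS]mulrA; apply: (ler_wpM2l wI).
have [h _] := poly_err s_ge0; apply: le_trans h; rewrite exprMn.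
rewrite (_ : t * (c * r ^+ d) = c * s); last by ring.
rewrite (_ : t * (C * r ^+ d) = C * s); last by ring.
by rewrite (_ : t * (C * (2 ^+ d * r ^+ d)) = C * 2 ^+ d * s)//; ring.
Qed.

Section poisson.
Variable Z : R -> {RV P >-> nat}.
Hypothesis Z_poisson : unit_poisson_process P Z.
Hypothesis XZ_indep : independent_families P X Z.
Let W w := num_isolated (sample X (Z t w) w) r.
Let pmf0 k : 0 <= poisson_pmf t k. Proof. exact: poisson_pmf_ge0. Qed.
Let mW : measurable_fun setT W. Proof. exact: measurable_poisson_count. Qed.
Let HW (h : nat -> R) (h0 : forall k, 0 <= h k) : (\int[P]_w (h (W w))%:E)%E =
    mix (poisson_pmf t) (fun k => (\int[Q]_w (h (isocount (nb r) k w))%:E)%E) :=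
  poisson_count_law X_iid no_atom Z_poisson XZ_indep t_gt0 r h0.
Let mean := poisson_mean (trajectory_law_iid X_iid) mnb t_gt0.

Let mix_err : (mix (poisson_pmf t) err <= (D2 * I * e ^+ 2)%:E)%E.
Proof.
have -> : D2 * I * e ^+ 2 = 1 * I * (D2 * e ^+ 2) by ring.
apply: mix_err_le => // j v _ /andP[v0 _].
by rewrite mix_poisson// mul1r.
Qed.

Let mean_square : (mix (poisson_pmf t) (fun k => (count_mean Q (nb r) k ^+ 2)%:E) <=
  (I ^+ 2 + D2 * I * e ^+ 2)%:E)%E.
Proof.
apply: (le_trans (poisson_mean_square (trajectory_law_iid X_iid) mnb mA nuA t_gt0 Crd_ge0
  (ball_le r_gt0) (ball_ge rr).1 tb1)).
rewrite lee_fin -/I lerD2l -mulrA.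
rewrite (_ : D2 * I * e ^+ 2 = I * (D2 * e ^+ 2)); last by ring.
rewrite ler_wpM2l ?(ltW I_gt0)//; have [_ h] := poly_err s_ge0; apply: le_trans h.
rewrite (_ : t * (c * r ^+ d) = c * s); last by ring.
by rewrite (_ : t * (C * r ^+ d) = C * s)//; ring.
Qed.

Let mS k := measurable_isocount mnb k.

Lemma poisson_at_expectation : ('E_P[Wr W] = I%:E)%E.
Proof. exact: (mixture_expectation stein HW mean). Qed.

Lemma poisson_at_variance : exists2 v : R, ('V_P[Wr W] = v%:E)%E &
  `|v - I| <= 2 * D2 * I * e ^+ 2.
Proof.
exact: (count_variance pmf0 mS lam_ge0 err_ge0 stein mW HW I_gt0 D2_gt0 e_gt0 mean
  mean_square mix_err).
Qed.

Lemma poisson_at_dK : `|dK_normal P (fun w => (Wr W w - I) / Num.sqrt I)| <=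
  clt_const D2 * (e + (Num.sqrt I)^-1).
Proof.
exact: (count_dK pmf0 mS lam_ge0 err_ge0 stein mW HW I_gt0 D2_gt0 e_gt0 e_le1 mean
  mean_square mix_err).
Qed.

End poisson.

Section binomial.
Variable n : nat.
Hypothesis tn : t = n%:R.
Let n_gt0 : (0 < n)%N. Proof. by move: t_gt0; rewrite tn ltr0n. Qed.
Let W w := num_isolated (sample X n w) r.
Local Notation lam := (count_mean Q (nb r) n).
Let pw0 k : 0 <= point_weight n k :> R. Proof. exact: ler0n. Qed.
Let mW : measurable_fun setT W. Proof. exact: measurable_binomial_count. Qed.
Let HW (h : nat -> R) (h0 : forall k, 0 <= h k) : (\int[P]_w (h (W w))%:E)%E =
    mix (point_weight n) (fun k => (\int[Q]_w (h (isocount (nb r) k w))%:E)%E) :=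
  binomial_count_law X_iid no_atom r n h0.
Let mean : mix (point_weight n) (fun k => (count_mean Q (nb r) k)%:E) = lam%:E.
Proof. by rewrite mix_point// => k; rewrite lee_fin. Qed.
Let D := 2 * expR 3 * D2.
Let D_gt0 : 0 < D. Proof. by rewrite !mulr_gt0// expR_gt0. Qed.

Lemma binomial_at_mean : `|lam - I| <= D1 * I * e ^+ 2.
Proof.
have b1 : 2 * (C * r ^+ d) <= 1.
  have h : 0 <= t * (C * r ^+ d) ^+ 2 by rewrite mulr_ge0 ?sqr_ge0// ltW.
  have := radius_small; have := error_small; have := Crd_ge0; lra.
have := binomial_mean (trajectory_law_iid X_iid) mnb b1 (ball_le r_gt0) n_gt0.
rewrite -tn -/I => h; apply: (le_trans h).
by rewrite [D1 * I]mulrC -[leRHS]mulrA ler_wpM2l// ltW.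
Qed.

Let lam_ge : I <= 2 * lam.
Proof.
have := binomial_at_mean; have := ler_wpM2l (ltW I_gt0) error_small.
rewrite ler_norml => h1 /andP[h2 _]; lra.
Qed.

Let lam_le : lam <= 2 * I.
Proof.
have := binomial_at_mean; have := ler_wpM2l (ltW I_gt0) error_small.
rewrite ler_norml => h1 /andP[_ h2]; have := I_gt0; lra.
Qed.

Let lam_gt0 : 0 < lam. Proof. by have := lam_ge; have := I_gt0; lra. Qed.

Let mean_square : (mix (point_weight n) (fun k => (count_mean Q (nb r) k ^+ 2)%:E) <=
  (lam ^+ 2 + D * lam * e ^+ 2)%:E)%E.
Proof.
rewrite mix_point; last by move=> k; rewrite lee_fin sqr_ge0.
rewrite lee_fin lerDl; apply: mulr_ge0; last exact: sqr_ge0.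
exact: mulr_ge0 (ltW D_gt0) (ltW lam_gt0).
Qed.

Let mix_err : (mix (point_weight n) err <= (D * lam * e ^+ 2)%:E)%E.
Proof.
apply: (@le_trans _ _ (expR 3 * I * (D2 * e ^+ 2))%:E).
  apply: mix_err_le => //.
  move=> j v j3 v01; rewrite mix_point; last first.
    by move=> k; rewrite lee_fin ffw_ge0//; case/andP: v01.
  by rewrite lee_fin tn; exact: ffw_le.
rewrite lee_fin (_ : D * lam * e ^+ 2 = expR 3 * (2 * lam) * (D2 * e ^+ 2)); last first.
  by rewrite /D; ring.
apply: ler_wpM2r; first by rewrite mulr_ge0 ?sqr_ge0// ltW.
by apply: ler_wpM2l; [exact: expR_ge0|exact: lam_ge].
Qed.

Let mS k := measurable_isocount mnb k.

Lemma binomial_at_expectation : ('E_P[Wr W] = lam%:E)%E.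
Proof. exact: (mixture_expectation stein HW mean). Qed.

Lemma binomial_at_variance : exists2 v : R, ('V_P[Wr W] = v%:E)%E &
  `|v - I| <= (4 * D + D1) * I * e ^+ 2.
Proof.
have [v vE hv] := count_variance pw0 mS lam_ge0 err_ge0 stein mW HW lam_gt0 D_gt0 e_gt0 mean
  mean_square mix_err.
exists v => //; rewrite -[v](subrK lam) -addrA; apply: (le_trans (ler_normD _ _)).
have -> : (4 * D + D1) * I * e ^+ 2 = 4 * D * I * e ^+ 2 + D1 * I * e ^+ 2 by ring.
apply: lerD; last exact: binomial_at_mean.
apply: (le_trans hv); apply: ler_wpM2r; first exact: sqr_ge0.
have := ler_wpM2l (ltW D_gt0) lam_le; lra.
Qed.

(** The count is normalized by its own mean, which is at least I / 2; hence the
factor 2. *)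
Lemma binomial_at_dK : `|dK_normal P (fun w => (Wr W w - lam) / Num.sqrt lam)| <=
  2 * clt_const D * (e + (Num.sqrt I)^-1).
Proof.
have K0 : 0 <= clt_const D := ltW (clt_const_gt0 (ltW D_gt0)).
apply: (le_trans (count_dK pw0 mS lam_ge0 err_ge0 stein mW HW lam_gt0 D_gt0 e_gt0 e_le1 mean
  mean_square mix_err)).
rewrite [2 * _]mulrC -[leRHS]mulrA ler_wpM2l// mulrDr; apply: lerD.
  by rewrite ler_peMl ?(ltW e_gt0)// ler1n.
rewrite -[2 in leRHS]invrK -invfM lef_pV2 ?posrE ?mulr_gt0 ?invr_gt0 ?sqrtr_gt0//.
rewrite mulrC ler_pdivrMr//; rewrite -(@ler_pXn2r _ 2)// ?nnegrE ?mulr_ge0 ?sqrtr_ge0//.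
rewrite exprMn !sqr_sqrtr ?(ltW I_gt0) ?(ltW lam_gt0)//.
have := lam_ge; have := lam_gt0; rewrite -natrX; lra.
Qed.

End binomial.
End at_time.

(** * Moments and normal approximation of the number of isolated vertices *)

Lemma IpoissonE (R : realType) d (A : set 'rV[R]_d) (f : 'rV[R]_d -> R)
    (nu : probability 'rV[R]_d R) (r : R -> R) (t : R) : prob_density f ->
  (forall x, ~ A x -> f x = 0) ->
  (forall B, measurable B -> nu B = (\int[@lebesgue_rV R d]_(x in B) (f x)%:E)%E) ->
  Ipoisson A f r t = poisson_mean_at nu t (r t).
Proof.
move=> fd fz nuE; rewrite /Ipoisson /poisson_mean_at /mexp; congr (_ * fine _).
rewrite (integral_density fd fz nuE); last 2 first.
- by apply: measurable_expq; exact: measurable_within_dist.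
- exact: expq_ge0.
apply: eq_integral => x _; congr ((expR (- (t * _)) * _)%:E).
rewrite /near_pr /pr nuE//; exact: measurable_eball.
Qed.

Theorem proposition2p11 (R : realType) (d : nat) (hd : (2 <= d)%N)
  (A : set 'rV[R]_d)
  (A_compact : compact A) (A_connected : connected A) (A_nonempty : A !=set0)
  (A_regular : A = closure (A°))
  (A_shape : C2_boundary A \/ (d = 2%N /\ A = unit_cube))
  (f : 'rV[R]_d -> R)
  (f_density : prob_density f)
  (f_support : closure [set x | f x != 0] = A)
  (f_zero : forall x, ~ A x -> f x = 0)
  (f_continuous : {within A, continuous f})
  (f_inf : 0 < inf (f @` A))
  (dOm : measure_display) (Om : measurableType dOm) (P : probability Om R)
  (X : nat -> {RV P >-> 'rV[R]_d})
  (X_iid : iid_with_density P X f)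
  (Z : R -> {RV P >-> nat})
  (Z_poisson : unit_poisson_process P Z)
  (XZ_indep : independent_families P X Z)
  (r : R -> R) (r_pos : forall t, 1 <= t -> 0 < r t) :
  let I_ := Ipoisson A f r in
  let S := isolated_binomial X r in
  let S' := isolated_poisson X Z r in
  let ES n := fine 'E_P[S n]%E in
  exists2 delta : R, 0 < delta &
    let h t := expR (- (delta * (t * r t ^+ d))) in
    (n%:R * r n%:R ^+ d @[n --> \oo] --> +oo ->
     I_ n%:R @[n --> \oo] --> +oo ->
     [/\ eq_1plusO eventually_filterType (fun n => 'E_P[S n]%E)
           (fun n => I_ n%:R) (fun n => h n%:R),
         eq_1plusO eventually_filterType (fun n => 'V_P[S n]%E)
           (fun n => I_ n%:R) (fun n => h n%:R) &
         C2_boundary A ->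
         (fun n => dK_normal P (fun w => (S n w - ES n) / Num.sqrt (ES n)))
           =O_\oo (fun n => h n%:R + (Num.sqrt (I_ n%:R))^-1)])
    /\
    (t * r t ^+ d @[t --> +oo] --> +oo ->
     I_ t @[t --> +oo] --> +oo ->
     [/\ eq_1plusO (pinfty_filter_on R) (fun t => 'E_P[S' t]%E) I_ h,
         eq_1plusO (pinfty_filter_on R) (fun t => 'V_P[S' t]%E) I_ h &
         (fun t => dK_normal P (fun w => (S' t w - I_ t) / Num.sqrt (I_ t)))
           =O_+oo (fun t => h t + (Num.sqrt (I_ t))^-1)]).
Proof.
move=> I_ S S' ES.
have d0 : (0 < d)%N by exact: ltn_trans hd.
pose nu := point_law X.
have nuE : forall B, measurable B ->
    nu B = (\int[@lebesgue_rV R d]_(x in B) (f x)%:E)%E by exact: (point_lawE X_iid).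
have A_cone := support_cone d0 A_compact A_regular A_shape.
have mA := measurable_support f_density f_zero f_inf.
have nuA : nu A = 1%E by exact: (support_prob1 f_density f_zero f_inf nuE).
have no_atom x : near_pr nu (within_dist 0) x = 0.
  have [M _ hM] := density_bounded A_compact f_density f_zero f_continuous.
  apply/eqP; rewrite eq_le near_pr_ge0 andbT.
  have := ball_prob_le f_density nuE x hM (lexx 0).
  by rewrite mulr0 expr0n gtn_eqF// mulr0.
have [c [C [r1 [c0 C0 r10 ball_le ball_ge]]]] := ball_bounds d0 A_compact A_cone f_density
  f_zero f_continuous f_inf nuE.
have [D1 [s0 [I0 [D10 s00 reg]]]] := regime mA nuA c0 C0 r10 (fun r rr => (ball_ge r rr).1).
have [D2 D20 perr] := @poly_error R d c C c0 C0.
have IE t : I_ t = poisson_mean_at nu t (r t) by exact: IpoissonE.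
have e2_le t : 0 < t -> 1 <= t -> decay c (t * r t ^+ d) ^+ 2 <= decay c (t * r t ^+ d).
  move=> t0 t1; rewrite expr2 ler_piMl ?expR_ge0//; apply: decay_le1 => //.
  by rewrite mulr_ge0 ?exprn_ge0// ltW// r_pos.
exists (c / 4); first by rewrite divr_gt0.
move=> h; split=> [s_oo I_oo|s_oo I_oo].
- have ev : \forall n \near \oo, [/\ (0 < n)%N, s0 <= n%:R * r n%:R ^+ d & I0 <= I_ n%:R].
    near=> n; split; near: n; [exact: nbhs_infty_gt|
      by move/cvgryPge : s_oo => /(_ s0)|by move/cvgryPge : I_oo => /(_ I0)].
  pose K := 4 * (2 * expR 3 * D2) + D1.
  have K0 : 0 < K by rewrite addr_gt0// !mulr_gt0// expR_gt0.
  have at_n n : (0 < n)%N -> s0 <= n%:R * r n%:R ^+ d -> I0 <= I_ n%:R ->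
      let lam := count_mean (trajectory_law X) (within_dist (r n%:R)) n in
      [/\ 0 < I_ n%:R,
        'E_P[S n]%E = lam%:E /\ `|lam - I_ n%:R| <= K * I_ n%:R * h n%:R,
        exists2 v, 'V_P[S n]%E = v%:E & `|v - I_ n%:R| <= K * I_ n%:R * h n%:R &
        `|dK_normal P (fun w => (S n w - lam) / Num.sqrt lam)| <=
          2 * clt_const (2 * expR 3 * D2) * (h n%:R + (Num.sqrt (I_ n%:R))^-1)].
    move=> n0 sn In lam.
    have t1 : 1 <= n%:R :> R by rewrite ler1n.
    have t0 : 0 < n%:R :> R by rewrite ltr0n.
    rewrite IE in In *.
    have [I1 rr small err] := reg n%:R (r n%:R) t0 (r_pos _ t1) sn In.
    have /andP[r0 rlt] := rr.
    have I_gt0 := lt_le_trans ltr01 I1.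
    have weak (L : R) : 0 <= L -> L <= K ->
       L * poisson_mean_at nu n%:R (r n%:R) * decay c (n%:R * r n%:R ^+ d) ^+ 2 <=
       K * poisson_mean_at nu n%:R (r n%:R) * h n%:R.
      move=> L0 LK; apply: ler_pM => //; [exact: mulr_ge0 L0 (ltW I_gt0)|exact: sqr_ge0| |].
        by apply: ler_wpM2r LK; exact: ltW.
      exact: e2_le.
    split => //.
    + split; first exact: (binomial_at_expectation X_iid no_atom).
      apply: le_trans (binomial_at_mean X_iid C0 ball_le t0 r0 I1 small err erefl) _.
      by apply: weak; [exact: ltW|rewrite lerDr !mulr_ge0// ?expR_ge0// ltW].
    + have [v vE hv] := binomial_at_variance X_iid no_atom mA nuA c0 C0 D20 ball_le ball_ge
        perr t0 r0 rlt I1 small err erefl.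
      by exists v => //; apply: (le_trans hv); apply: weak => //; exact: ltW.
    + exact: (binomial_at_dK X_iid no_atom mA nuA c0 C0 D20 ball_le ball_ge
        perr t0 r0 rlt I1 small err erefl).
  split=> [||_].
  + apply: (eq_1plusO_of_bound K0); apply: filterS ev => n [n0 sn In].
    have [I_gt0 [E1 E2] _ _] := at_n n n0 sn In.
    by exists (count_mean (trajectory_law X) (within_dist (r n%:R)) n).
  + apply: (eq_1plusO_of_bound K0); apply: filterS ev => n [n0 sn In].
    have [I_gt0 _ [v vE hv] _] := at_n n n0 sn In.
    by exists v.
  + have D0 : 0 <= 2 * expR 3 * D2 by rewrite !mulr_ge0 ?expR_ge0// ltW.
    have L0 : 0 < 2 * clt_const (2 * expR 3 * D2) by rewrite mulr_gt0// clt_const_gt0.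
    apply: (eqO_of_bound L0); apply: filterS ev => n [n0 sn In].
    have [_ [E1 _] _ hd'] := at_n n n0 sn In.
    by rewrite /ES E1.
- have ev : \forall t \near +oo, [/\ 1 <= t, s0 <= t * r t ^+ d & I0 <= I_ t].
    near=> t; split; near: t; [exact: nbhs_pinfty_ge|
      by move/cvgryPge : s_oo => /(_ s0)|by move/cvgryPge : I_oo => /(_ I0)].
  pose K := 2 * D2; have K0 : 0 < K by rewrite mulr_gt0.
  have at_t t : 1 <= t -> s0 <= t * r t ^+ d -> I0 <= I_ t ->
      [/\ 0 < I_ t, 'E_P[S' t]%E = (I_ t)%:E,
        exists2 v, 'V_P[S' t]%E = v%:E & `|v - I_ t| <= K * I_ t * h t &
        `|dK_normal P (fun w => (S' t w - I_ t) / Num.sqrt (I_ t))| <=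
          clt_const D2 * (h t + (Num.sqrt (I_ t))^-1)].
    move=> t1 st It; have t0 : 0 < t := lt_le_trans ltr01 t1.
    rewrite IE in It *.
    have [I1 rr small err] := reg t (r t) t0 (r_pos _ t1) st It.
    have /andP[r0 rlt] := rr.
    have I_gt0 := lt_le_trans ltr01 I1.
    split => //.
    + exact: (poisson_at_expectation X_iid no_atom _ t0 Z_poisson XZ_indep).
    + have [v vE hv] := poisson_at_variance X_iid no_atom mA nuA c0 C0 D20 ball_le ball_ge
        perr t0 r0 rlt I1 small err Z_poisson XZ_indep.
      exists v => //; apply: (le_trans hv); apply: ler_wpM2l; last exact: e2_le.
      exact: mulr_ge0 (ltW K0) (ltW I_gt0).
    + exact: (poisson_at_dK X_iid no_atom mA nuA c0 C0 D20 ball_le ball_ge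
        perr t0 r0 rlt I1 small err Z_poisson XZ_indep).
  split.
  + apply: (eq_1plusO_of_bound ltr01); apply: filterS ev => t [t1 st It].
    have [I_gt0 E1 _ _] := at_t t t1 st It.
    exists (I_ t); split => //; rewrite subrr normr0.
    by apply: mulr_ge0; [rewrite mul1r ltW|exact: expR_ge0].
  + apply: (eq_1plusO_of_bound K0); apply: filterS ev => t [t1 st It].
    have [I_gt0 _ [v vE hv] _] := at_t t t1 st It.
    by exists v.
  + apply: (eqO_of_bound (clt_const_gt0 (ltW D20))); apply: filterS ev => t [t1 st It].
    by have [_ _ _] := at_t t t1 st It.
Unshelve. all: by end_near. Qed.
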